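(* There is an absolute constant $C$ such that for every finite undirected weighted graph $G$ on a vertex set $V$ (symmetric nonnegative edge weights $w_{vw}$, self-loops allowed, all degrees $d_v=\sum_w w_{vw}$ positive) and every integer $1\le k\le |V|$ the following hold. (i) There exist $k$ pairwise disjoint nonempty sets $S_1,\dots,S_k\subseteq V$ with $$\max_{1\le i\le k}\phi_G(S_i)\le C[1+\log(k+1)]^5\sqrt{\lambda_k(G)}.$$ (ii) There exist nonzero nonnegative functions $f_1,\dots,f_k:V\to\mathbb R$ with pairwise disjoint supports satisfying $$\mathcal R_G(f_i)\le C[1+\log(k+1)]^{10}\lambda_k(G)\qquad(1\le i\le k).$$
   Context: Let $A=(w_{vw})$, $D=\operatorname{diag}(d_v)$, $L=D-A$, and let $\mathcal L_G=D^{-1/2}LD^{-1/2}$ be the normalized Laplacian, with eigenvalues (counted with multiplicity) $0=\lambda_1(G)\le\cdots\le\lambda_{|V|}(G)$. For a nonempty vertex set $S$ the (one-sided) conductance is $$\phi_G(S)=\frac{\sum_{v\in S,\,w\notin S}w_{vw}}{\sum_{v\in S}d_v},$$ used even when $S$ has more than half of the total volume. The sets $S_i$ need not cover $V$. For a nonzero real function $f$ on $V$ the Rayleigh quotient is $$\mathcal R_G(f)=\frac{\sum_{\{v,w\}}w_{vw}(f(v)-f(w))^2}{\sum_v d_vf(v)^2},$$ where each unordered nonloop edge is counted once. The support of $f$ is $\{v:f(v)\neq0\}$. Logarithms are natural. *)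

(* Defs.v *)
From HB Require Import structures.
From mathcomp Require Import all_boot all_order all_algebra.
From mathcomp Require complex.
From mathcomp Require Import all_classical all_reals all_analysis.

Set Implicit Arguments.
Unset Strict Implicit.
Unset Printing Implicit Defensive.

Import Order.TTheory GRing.Theory Num.Theory.
Local Open Scope ring_scope.

Section Spectrum.
Variables (R : realType) (n : nat).

Definition is_spectrum (M : 'M[R]_n) (s : seq R) : Prop :=
  sorted <=%R s /\ char_poly M = \prod_(a <- s) ('X - a%:P).

(* The eigenvalues of M with multiplicity, in nondecreasing order; [::] is a
   junk value for matrices without a real spectrum, see spectrumP. *)
Definition spectrum (M : 'M[R]_n) : seq R :=
  xget [::] (is_spectrum M).

Lemma spectrum_unique (M : 'M[R]_n) (s t : seq R) :
  is_spectrum M s -> is_spectrum M t -> s = t.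
Proof.
move=> [ss Ms] [st Mt]; apply: (sorted_eq le_trans le_anti ss st).
by apply: prod_XsubC_eq; rewrite -Ms -Mt.
Qed.

Import complex.

Lemma symmetric_is_spectrum (M : 'M[R]_n) :
  M^T = M -> exists s, is_spectrum M s.
Proof.
move=> Msym; pose toC : {rmorphism R -> R[i]} := real_complex R.
pose B := map_mx toC M.
have toC_real x : toC x \is Num.real by apply/complex_realP; exists x.
have Bherm : B \is hermsymmx.
  apply: realsym_hermsym.
    apply/is_hermitianmxP; rewrite expr0 scale1r map_mx_id //.
    by rewrite /B map_trmx Msym.
  by apply/mxOverP => i j; rewrite mxE toC_real.
have Dreal := hermitian_spectral_diag_real Bherm.
have /orthomx_spectralP BE := hermitian_normalmx Bherm.
move: Dreal BE (spectral_unit B).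
set P := spectralmx B; set D := spectral_diag B => Dreal BE Punit.
have /choice[d dE] : forall i, exists x, D 0 i = toC x.
  by move=> i; apply/complex_realP; exact: (mxOverP Dreal).
have PB : char_poly B = \prod_i ('X - (D 0 i)%:P).
  transitivity (char_poly (diag_mx D)).
    rewrite /char_poly.
    have -> : char_poly_mx B =
        map_mx polyC (invmx P) *m char_poly_mx (diag_mx D) *m map_mx polyC P.
      rewrite BE /char_poly_mx mulmxBr mulmxBl !map_mxM; congr (_ - _).
      by rewrite -mulmxA -scalar_mxC mulmxA -map_mxM mulVmx // map_mx1 mul1mx.
    rewrite !det_mulmx mulrAC -det_mulmx -map_mxM mulVmx //.
    by rewrite map_mx1 det1 mul1r.
  rewrite char_poly_trig ?diag_mx_is_trig //.
  by apply: eq_bigr => i _; rewrite mxE eqxx mulr1n.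
exists (sort <=%R [seq d i | i <- enum 'I_n]); split.
  exact: (sort_sorted le_total).
apply: (map_poly_inj toC); rewrite map_char_poly -/B PB.
rewrite (perm_big [seq d i | i <- enum 'I_n]) ?perm_sort //=.
rewrite big_map big_enum /= rmorph_prod; apply: eq_bigr => i _.
by rewrite rmorphB /= map_polyX map_polyC /= dE.
Qed.

Lemma spectrumP (M : 'M[R]_n) : M^T = M -> is_spectrum M (spectrum M).
Proof.
by move=> /symmetric_is_spectrum[s Ms]; exact: xgetI Ms.
Qed.

End Spectrum.

Section WeightedGraph.
Variables (R : realType) (V : finType) (w : V -> V -> R).

(* A loop at v counts once in the degree of v. *)
Definition degree (v : V) : R := \sum_u w v u.

(* Matrices are indexed by 'I_#|V|, in bijection with V through enum_val. *)
Definition adjacency : 'M[R]_#|V| :=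
  \matrix_(i, j) w (enum_val i) (enum_val j).

Definition degree_row : 'rV[R]_#|V| := \row_i degree (enum_val i).

Definition laplacian : 'M[R]_#|V| := diag_mx degree_row - adjacency.

Definition inv_sqrt_degree : 'M[R]_#|V| :=
  diag_mx (map_mx (fun x => (Num.sqrt x)^-1) degree_row).

Definition normalized_laplacian : 'M[R]_#|V| :=
  inv_sqrt_degree *m laplacian *m inv_sqrt_degree.

(* k ranges over 1, ..., #|V|, whereas sequences are indexed from 0. *)
Definition lambda (k : nat) : R := (spectrum normalized_laplacian)`_k.-1.

Definition conductance (S : {set V}) : R :=
  (\sum_(v in S) \sum_(u in ~: S) w v u) / (\sum_(v in S) degree v).

(* The order on ranks selects each unordered pair {v, u}, v != u, once. *)
Definition rayleigh (f : V -> R) : R :=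
  (\sum_v \sum_(u | (enum_rank v < enum_rank u)%N) w v u * (f v - f u) ^+ 2)
    / (\sum_v degree v * f v ^+ 2).

Lemma normalized_laplacian_sym :
  (forall v u, w v u = w u v) -> normalized_laplacian^T = normalized_laplacian.
Proof.
move=> wC; rewrite /normalized_laplacian !trmx_mul !tr_diag_mx -mulmxA.
congr (_ *m (_ *m _)); rewrite /laplacian linearB /= tr_diag_mx; congr (_ - _).
by apply/matrixP => i j; rewrite !mxE wC.
Qed.

Lemma size_spectrum_normalized_laplacian :
  (forall v u, w v u = w u v) ->
  size (spectrum normalized_laplacian) = #|V|.
Proof.
move=> /normalized_laplacian_sym /spectrumP[_ E].
by have := size_char_poly normalized_laplacian; rewrite E size_prod_XsubC => -[].
Qed.

End WeightedGraph.

Definition fsupport (R : realType) (V : finType) (f : V -> R) : {set V} :=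
  [set v | f v != 0].

(* Main.v *)
(* Fix [L >= 2 lambda_k] and call disjointly supported functions with Rayleigh
   quotients O(L) a packing at level O(L). There are two ways to obtain packings.

   Concentration: functions of energy at most [L] whose mass lies, up to a small
   fraction, on disjoint sets (however rough) give a packing of the same size at
   level 500 L. Multiply each function by its share of the total in a competition
   weighted so that, by Blackwell approachability, all the costs stay bounded.

   Extension: [m] disjointly supported functions [f_j] and [a] orthonormal
   functions [Y_i] orthogonal to them, all of energy at most [L], give nearly
   [m + a] disjointly supported ones at level O(h^3 L), with h of order log k. On
   the support of [f_j], either |Y| is comparable with [f_j] on much of its mass,
   and then a random projection of Y cuts [f_j] in two, or |Y| is so large where
   it lives that [f_j] can be capped away from it. What remains of Y is localized
   by a matrix of h rows of random signs and a shifted grid.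

   Let m <= k be the largest size of a packing at level 500 L. Extending it by
   [k - m] combinations of the first [k] eigenfunctions gives about [k] functions,
   of which only m can be concentrated near the span of the first k modes. All
   others have mass in the modes with eigenvalue between lambda_k and O(h^3 L), so
   by Bessel's inequality there are at least [c (k - m)] such modes. Extending by
   combinations of these as well gives [k] functions, at level O(h^6 L).

   The sets are superlevel sets of these functions. If lambda_k = 0, let L tend to
   0: as there are finitely many families of sets, some have conductance 0. *)

Require Import Defs.
From HB Require Import structures.
From mathcomp Require Import all_boot all_order all_algebra.
From mathcomp Require Import boolp reals exp.
From mathcomp Require Import ring lra zify.
Import Order.TTheory GRing.Theory Num.Theory.
Local Open Scope ring_scope.

Set Implicit Arguments.
Unset Strict Implicit.
Unset Printing Implicit Defensive.

(** * Energy and mass *)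

(** The obstacle is the exact number k. Localizing a vector-valued function loses a proportion rho
    of its mass, and with it of the functions, so k modes alone give only about (1 - rho) k
    functions. The loss is therefore charged to the k - m new functions instead of to all k, and
    surplus modes make up for it. That they exist rests on concentration returning to the level 500
    L with no factor h: otherwise more than m concentrated functions would not contradict the choice
    of m.

    The factor h^3 arises as follows. A random row fails to separate two far directions with
    probability at most 4/5, and the pairs have total weight of order k^2, whence h of order log k
    rows. For the h rows together to lose little mass at the walls of the grid, its width must be of
    order h; the squared scale gives h^2, and the sum over the rows another h. The second extension
    starts from a level that already contains h^3, whence h^6. The functions thus have level log^6,
    where log^10 is claimed, and the sweep gives log^3 for log^5. *)

Section Forms.
Variables (R : realType) (V : finType).
Implicit Types (w : V -> V -> R) (d f g h : V -> R).

Definition mass d f : R := \sum_v d v * f v ^+ 2.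

Definition inner d f g : R := \sum_v d v * (f v * g v).

(* Every unordered pair is counted twice. *)
Definition energy w f : R := \sum_u \sum_v w u v * (f u - f v) ^+ 2.

Definition packs w d (I : finType) (c : R) : Prop :=
  exists g : I -> V -> R,
    [/\ forall i, 0 < mass d (g i),
        forall i, energy w (g i) <= c * mass d (g i) &
        forall i j v, i != j -> g i v = 0 \/ g j v = 0].

End Forms.

Section RealFacts.
Variable R : realType.
Implicit Types a b c x y : R.

Lemma ler_sqr_sub a x y : a <= y -> y <= x -> (a - y) ^+ 2 <= (a - x) ^+ 2.
Proof.
move=> ay yx; rewrite -subr_ge0.
have -> : (a - x) ^+ 2 - (a - y) ^+ 2 = (x - y) * (x - y + 2 * (y - a)) by ring.
by apply: mulr_ge0; lra.
Qed.

Lemma sqr_subC x y : (x - y) ^+ 2 = (y - x) ^+ 2.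
Proof. by rewrite -sqrrN opprB. Qed.

Lemma sqr_min_sub a b x y :
  (Num.min a b - Num.min x y) ^+ 2 <= (a - x) ^+ 2 + (b - y) ^+ 2.
Proof.
have h1 := sqr_ge0 (a - x); have h2 := sqr_ge0 (b - y).
case: (leP a b) => ab; case: (leP x y) => xy; [by lra| | |by lra].
- have [ay|/ltW ay] := leP a y.
    by have := ler_sqr_sub ay (ltW xy); lra.
  have := ler_sqr_sub ay ab.
  by rewrite (sqr_subC a) (sqr_subC b); lra.
- have [xb|/ltW xb] := leP x b.
    have := ler_sqr_sub xb (ltW ab).
    by rewrite (sqr_subC b x) (sqr_subC a); lra.
  by have := ler_sqr_sub xb xy; lra.
Qed.

Lemma sqr_max_sub a b x y :
  (Num.max a b - Num.max x y) ^+ 2 <= (a - x) ^+ 2 + (b - y) ^+ 2.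
Proof.
have := sqr_min_sub (- a) (- b) (- x) (- y).
by rewrite -!oppr_max -!opprD !sqrrN.
Qed.

Lemma sqr_pos_sub x y :
  (Num.max 0 x - Num.max 0 y) ^+ 2 <= (x - y) ^+ 2.
Proof. by have := sqr_max_sub 0 x 0 y; rewrite subrr expr0n /= add0r. Qed.

Lemma sqr_sub_le x y : 0 <= x -> 0 <= y -> (x - y) ^+ 2 <= x ^+ 2 + y ^+ 2.
Proof. by move=> x0 y0; have := mulr_ge0 x0 y0; rewrite sqrrB mulr2n; lra. Qed.

Lemma sqr_norm_sub x y : (`|x| - `|y|) ^+ 2 <= (x - y) ^+ 2.
Proof.
have := ler_norm (x * y); rewrite normrM => h.
have hx := real_normK (num_real x); have hy := real_normK (num_real y).
have -> : (`|x| - `|y|) ^+ 2 = x ^+ 2 + y ^+ 2 - 2 * (`|x| * `|y|).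
  by rewrite -hx -hy; ring.
have -> : (x - y) ^+ 2 = x ^+ 2 + y ^+ 2 - 2 * (x * y) by ring.
by lra.
Qed.

Lemma sqr_bigmax_sub (I : Type) (r : seq I) (P : pred I) (F G : I -> R) :
  (\big[Num.max/0]_(i <- r | P i) F i - \big[Num.max/0]_(i <- r | P i) G i) ^+ 2
    <= \sum_(i <- r | P i) (F i - G i) ^+ 2.
Proof.
elim/big_rec3: _ => [|i x y z _ h]; first by rewrite subrr expr0n.
exact: le_trans (sqr_max_sub _ _ _ _) (lerD _ _).
Qed.

Lemma sqr_bigmin_sub (I : Type) (r : seq I) (P : pred I) (F G : I -> R) c :
  (\big[Num.min/c]_(i <- r | P i) F i - \big[Num.min/c]_(i <- r | P i) G i) ^+ 2
    <= \sum_(i <- r | P i) (F i - G i) ^+ 2.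
Proof.
elim/big_rec3: _ => [|i x y z _ h]; first by rewrite subrr expr0n.
exact: le_trans (sqr_min_sub _ _ _ _) (lerD _ _).
Qed.

Lemma bigmax_ge0_sqr (I : Type) (r : seq I) (P : pred I) (F : I -> R) :
  (forall i, 0 <= F i) ->
  0 <= \big[Num.max/0]_(i <- r | P i) F i /\
  (\big[Num.max/0]_(i <- r | P i) F i) ^+ 2 <= \sum_(i <- r | P i) F i ^+ 2.
Proof.
move=> F0; split; first by elim/big_rec: _ => // i x _ h; rewrite le_max F0.
have := sqr_bigmax_sub r P F (fun=> 0).
have -> : \big[Num.max/0]_(i <- r | P i) (0 : R) = 0.
  by elim/big_rec: _ => // i x _ ->; rewrite maxxx.
rewrite subr0 => /le_trans -> //.
by apply: ler_sum => i _; rewrite subr0.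
Qed.

Lemma sum_indic_le1 (I : finType) (P : pred I) :
  (forall i j, P i -> P j -> i = j) -> \sum_i (P i)%:R <= 1 :> R.
Proof.
move=> h; have [i Pi|P0] := pickP P; last first.
  by rewrite big1 // => i _; rewrite P0.
rewrite (bigD1 i) //= Pi big1 ?addr0 // => j; have [Pj|//] := boolP (P j).
by rewrite (h _ _ Pi Pj) eqxx.
Qed.

End RealFacts.

Section FormFacts.
Variables (R : realType) (V : finType) (w : V -> V -> R) (d : V -> R).
Hypotheses (w_ge0 : forall u v, 0 <= w u v) (d_ge0 : forall v, 0 <= d v).
Implicit Types (f g h : V -> R).

Lemma mass_ge0 f : 0 <= mass d f.
Proof. by apply: sumr_ge0 => v _; rewrite mulr_ge0 ?sqr_ge0. Qed.

Lemma energy_ge0 f : 0 <= energy w f.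
Proof.
by apply: sumr_ge0 => u _; apply: sumr_ge0 => v _; rewrite mulr_ge0 ?sqr_ge0.
Qed.

Lemma eq_mass f g : f =1 g -> mass d f = mass d g.
Proof. by move=> fg; apply: eq_bigr => v _; rewrite fg. Qed.

Lemma eq_energy f g : f =1 g -> energy w f = energy w g.
Proof.
by move=> fg; apply: eq_bigr => u _; apply: eq_bigr => v _; rewrite !fg.
Qed.

Lemma ler_sum_edges (P Q : V -> V -> R) :
  (forall u v, P u v <= Q u v) ->
  \sum_u \sum_v w u v * P u v <= \sum_u \sum_v w u v * Q u v.
Proof.
move=> PQ; apply: ler_sum => u _; apply: ler_sum => v _.
exact: ler_wpM2l.
Qed.

Lemma sum_edgesD (P Q : V -> V -> R) :
  \sum_u \sum_v w u v * (P u v + Q u v) =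
  \sum_u \sum_v w u v * P u v + \sum_u \sum_v w u v * Q u v.
Proof.
rewrite -big_split; apply: eq_bigr => u _; rewrite -big_split.
by apply: eq_bigr => v _; rewrite mulrDr.
Qed.

Lemma sum_edgesZ (a : R) (P : V -> V -> R) :
  \sum_u \sum_v w u v * (a * P u v) = a * \sum_u \sum_v w u v * P u v.
Proof.
rewrite mulr_sumr; apply: eq_bigr => u _; rewrite mulr_sumr.
by apply: eq_bigr => v _; rewrite mulrCA.
Qed.

Lemma sum_edges_sum (I : Type) (r : seq I) (S : pred I) (P : I -> V -> V -> R) :
  \sum_u \sum_v w u v * (\sum_(i <- r | S i) P i u v) =
  \sum_(i <- r | S i) \sum_u \sum_v w u v * P i u v.
Proof.
rewrite [RHS]exchange_big; apply: eq_bigr => u _.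
by rewrite [RHS]exchange_big; apply: eq_bigr => v _; rewrite mulr_sumr.
Qed.

Lemma energy_ler2 (a b : R) f g h :
  (forall u v, (f u - f v) ^+ 2 <= a * (g u - g v) ^+ 2 + b * (h u - h v) ^+ 2) ->
  energy w f <= a * energy w g + b * energy w h.
Proof.
by move=> H; apply: le_trans (ler_sum_edges H) _; rewrite sum_edgesD !sum_edgesZ.
Qed.

Lemma energy_ler f g :
  (forall u v, (f u - f v) ^+ 2 <= (g u - g v) ^+ 2) -> energy w f <= energy w g.
Proof. exact: ler_sum_edges. Qed.

Lemma energyZ a f : energy w (fun v => a * f v) = a ^+ 2 * energy w f.
Proof.
rewrite /energy mulr_sumr; apply: eq_bigr => u _; rewrite mulr_sumr.
by apply: eq_bigr => v _; ring.
Qed.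

Lemma massZ a f : mass d (fun v => a * f v) = a ^+ 2 * mass d f.
Proof. by rewrite /mass mulr_sumr; apply: eq_bigr => v _; ring. Qed.

Lemma energy_norm f : energy w (fun v => `|f v|) <= energy w f.
Proof. by apply: energy_ler => u v; exact: sqr_norm_sub. Qed.

Lemma mass_norm f : mass d (fun v => `|f v|) = mass d f.
Proof. by apply: eq_bigr => v _; rewrite real_normK ?num_real. Qed.

(** Joint convexity of [energy w f / s] in [f] and the scale [s], for the scales [t] and 1 and with
    denominators cleared. It makes the cost of a sum of plays, divided by their number,
    subadditive. *)
Lemma energy_add_le (t : R) f g : 0 <= t ->
  t * energy w (fun v => f v + g v) <= (t + 1) * (energy w f + t * energy w g).
Proof.
move=> t0; rewrite /energy -sum_edgesZ -[X in _ * (_ + X)]sum_edgesZ -sum_edgesD -sum_edgesZ.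
apply: ler_sum_edges => u v; rewrite -subr_ge0.
suff -> : forall a b c e : R, (t + 1) * ((a - b) ^+ 2 + t * (c - e) ^+ 2)
  - t * (a + c - (b + e)) ^+ 2 = (a - b - t * (c - e)) ^+ 2 by exact: sqr_ge0.
by move=> *; ring.
Qed.

Lemma mass_add_le (t : R) f g : 0 <= t ->
  t * mass d (fun v => f v + g v) <= (t + 1) * (mass d f + t * mass d g).
Proof.
move=> t0; rewrite mulrDr mulrA /mass !mulr_sumr -big_split; apply: ler_sum => v _ /=.
rewrite -subr_ge0.
suff -> : forall a b c : R, (t + 1) * (c * a ^+ 2) + (t + 1) * t * (c * b ^+ 2)
  - t * (c * (a + b) ^+ 2) = c * (a - t * b) ^+ 2.
  by rewrite mulr_ge0 ?sqr_ge0.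
by move=> *; ring.
Qed.

Lemma packs_inj (I J : finType) (k : J -> I) c :
  injective k -> packs w d I c -> packs w d J c.
Proof.
move=> kinj [g [g0 ge gd]]; exists (fun j => g (k j)); split=> // i j v ij.
by apply: gd; rewrite (inj_eq kinj).
Qed.

Lemma packs_card (I J : finType) c :
  (#|J| <= #|I|)%N -> packs w d I c -> packs w d J c.
Proof.
move=> le; apply: (@packs_inj _ _ (fun j => enum_val (widen_ord le (enum_rank j)))).
move=> j j' /enum_val_inj /(congr1 val) /= /val_inj; exact: enum_rank_inj.
Qed.

Lemma packs_le (I : finType) c c' : c <= c' -> packs w d I c -> packs w d I c'.
Proof.
move=> cc' [g [g0 ge gd]]; exists g; split=> // i.
by apply: le_trans (ge i) _; rewrite ler_wpM2r // mass_ge0.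
Qed.

Lemma packs_normalized (I : finType) c : packs w d I c ->
  exists g : I -> V -> R,
    [/\ forall i v, 0 <= g i v, forall i, mass d (g i) = 1,
        forall i, energy w (g i) <= c &
        forall i j v, i != j -> g i v = 0 \/ g j v = 0].
Proof.
move=> [g [g0 ge gd]].
exists (fun i v => (Num.sqrt (mass d (g i)))^-1 * `|g i v|); split.
- by move=> i v; rewrite mulr_ge0 // invr_ge0 sqrtr_ge0.
- by move=> i; rewrite massZ mass_norm exprVn sqr_sqrtr ?ltW // mulVf ?gt_eqF.
- move=> i; rewrite energyZ exprVn sqr_sqrtr ?(ltW (g0 i)) // mulrC.
  by rewrite ler_pdivrMr //; apply: le_trans (ge i); exact: energy_norm.
- by move=> i j v /(gd _ _ v) [] ->; rewrite normr0 mulr0; [left|right].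
Qed.

End FormFacts.

(** * Functions concentrated on disjoint sets *)

Section Competition.
Variables (R : realType) (V : finType) (w : V -> V -> R) (d : V -> R).
Hypotheses (w_ge0 : forall u v, 0 <= w u v) (w_sym : forall u v, w u v = w v u).
Hypothesis w_le_d : forall v, \sum_u w v u <= d v.
Variables (m : nat) (p : 'I_m -> V -> R).
Hypothesis p_ge0 : forall j v, 0 <= p j v.
Implicit Types (b : 'I_m -> R) (i j : 'I_m) (u v : V).

Let d_ge0 v : 0 <= d v.
Proof. by apply: le_trans (w_le_d v); exact: sumr_ge0. Qed.

(** At each vertex the functions bid [b j * p j v]; [lead] is the margin by which [j] wins. Taking
    the margin, and not the whole bid of the winner, keeps it Lipschitz in the bids while at most
    one lead is nonzero at a vertex. *)
Definition rival b j v : R := \big[Num.max/0]_(i < m | i != j) (b i * p i v).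

Definition lead b j v : R := Num.max 0 (b j * p j v - rival b j v).

(** With [b j = 0] the value does not enter sums weighted by [b j], and 0 keeps the shares adding up
    to at most 1. Where [b j * p j v = 0], division by zero gives 0. *)
Definition share b j v : R :=
  if b j == 0 then 0 else lead b j v / (b j * p j v).

Lemma rival_ge0 b j v : (forall i, 0 <= b i) -> 0 <= rival b j v.
Proof. by move=> b0; apply: (bigmax_ge0_sqr _ _ _).1 => i; rewrite mulr_ge0. Qed.

Lemma lead_ge0 b j v : 0 <= lead b j v. Proof. by rewrite le_max lexx. Qed.

Lemma lead_le b j v : (forall i, 0 <= b i) -> lead b j v <= b j * p j v.
Proof.
move=> b0; rewrite ge_max mulr_ge0 //= lerBlDr lerDl; exact: rival_ge0.
Qed.

Lemma lead_uniq b i j v : lead b i v != 0 -> lead b j v != 0 -> i = j.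
Proof.
have pos k : lead b k v != 0 -> rival b k v < b k * p k v.
  rewrite /lead; case: (ltP 0 (b k * p k v - rival b k v)) => [h _|_].
    by rewrite -subr_gt0.
  by rewrite eqxx.
move=> /pos hi /pos hj; apply/eqP; apply: contraT => ij.
have : b i * p i v <= rival b j v by exact: (le_bigmax_cond _ (fun k => b k * p k v)).
have : b j * p j v <= rival b i v.
  by apply: (le_bigmax_cond _ (fun k => b k * p k v)); rewrite eq_sym.
by lra.
Qed.

Lemma share_lead b j v : (forall i, 0 <= b i) ->
  b j * (p j v * share b j v) = lead b j v.
Proof.
move=> b0; rewrite mulrA /share; case: eqP => [bj|/eqP bj].
  by apply: le_anti; rewrite mulr0 lead_ge0 (le_trans (lead_le j v b0)) ?bj ?mul0r.
have [z|nz] := eqVneq (b j * p j v) 0; last by rewrite mulrC divfK.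
by apply: le_anti; rewrite z mul0r lead_ge0 (le_trans (lead_le j v b0)) ?z.
Qed.

Lemma share_ge0 b j v : (forall i, 0 <= b i) -> 0 <= share b j v.
Proof.
by move=> b0; rewrite /share; case: eqP => // _; rewrite divr_ge0 ?lead_ge0 ?mulr_ge0.
Qed.

Lemma share_sum b v : (forall i, 0 <= b i) -> \sum_j share b j v <= 1.
Proof.
move=> b0; apply: le_trans (sum_indic_le1 _ (P := fun j => lead b j v != 0) _).
  apply: ler_sum => j _; rewrite /share; case: eqP => [//|_].
  have [->|nz] := eqVneq (lead b j v) 0; first by rewrite mul0r.
  rewrite ler_pdivrMr ?mul1r ?lead_le //.
  by apply: lt_le_trans (lead_le j v b0); rewrite lt_neqAle eq_sym nz lead_ge0.
by move=> i j; exact: lead_uniq.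
Qed.

Lemma share_le1 b j v : (forall i, 0 <= b i) -> share b j v <= 1.
Proof.
move=> b0; apply: le_trans (share_sum v b0); rewrite (bigD1 j) //= lerDl.
by apply: sumr_ge0 => i _; exact: share_ge0.
Qed.

(* On an edge at most two functions [lead b j] are nonzero, each of them being
   a Lipschitz function of the values [b i * p i]. *)
Lemma lead_edge b u v : (forall i, 0 <= b i) ->
  \sum_j (lead b j u - lead b j v) ^+ 2 <=
    4 * \sum_j b j ^+ 2 * (p j u - p j v) ^+ 2.
Proof.
move=> b0; set S := \sum_j b j ^+ 2 * _.
have S0 : 0 <= S by apply: sumr_ge0 => j _; rewrite mulr_ge0 ?sqr_ge0.
have le2 j : (lead b j u - lead b j v) ^+ 2 <= 2 * S.
  apply: le_trans (sqr_pos_sub _ _) _.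
  have h1 : (rival b j u - rival b j v) ^+ 2 <=
      \sum_(i | i != j) (b i * p i u - b i * p i v) ^+ 2 by exact: sqr_bigmax_sub.
  have -> : S = (b j * p j u - b j * p j v) ^+ 2 +
     \sum_(i | i != j) (b i * p i u - b i * p i v) ^+ 2.
    rewrite /S (bigD1 j) //= -mulrBr exprMn; congr (_ + _).
    by apply: eq_bigr => i _; rewrite -mulrBr exprMn.
  move: h1; move: (\sum_(i < m | i != j) _) (rival b j u) (rival b j v) => z x y h.
  move: (b j * p j u) (b j * p j v) => a c.
  rewrite -subr_ge0; have -> : 2 * ((a - c) ^+ 2 + z) - (a - x - (c - y)) ^+ 2
    = (a - c + (x - y)) ^+ 2 + 2 * (z - (x - y) ^+ 2) by ring.
  by rewrite addr_ge0 ?sqr_ge0 // mulr_ge0 // subr_ge0.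
apply: le_trans (_ : \sum_j 2 * S * ((lead b j u != 0)%:R + (lead b j v != 0)%:R) <= _).
  apply: ler_sum => j _.
  case: (eqVneq (lead b j u) 0) => hu; case: (eqVneq (lead b j v) 0) => hv /=.
  - by rewrite hu hv subrr expr0n /= addr0 mulr0.
  - by rewrite add0r mulr1.
  - by rewrite addr0 mulr1.
  - by apply: le_trans (le2 j) _; rewrite ler_peMr ?mulr_ge0 //; lra.
rewrite -mulr_sumr big_split /=.
have h := @sum_indic_le1 R 'I_m (fun j => lead b j u != 0) (fun i j => @lead_uniq b i j u).
have h' := @sum_indic_le1 R 'I_m (fun j => lead b j v != 0) (fun i j => @lead_uniq b i j v).
have -> : 4 * S = 2 * S * (1 + 1) by ring.
by apply: ler_wpM2l; [rewrite mulr_ge0|exact: lerD].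
Qed.

Variable A : 'I_m -> {set V}.
Hypothesis A_disj : forall i j, i != j -> [disjoint A i & A j].

(** A vertex lies in at most one [A k]. There the owner loses at most the best rival bid, whose
    square is one of the terms of the other functions, and every other function loses at most its
    own bid; hence the factor 2. *)
Lemma lead_loss b v : (forall i, 0 <= b i) ->
  \sum_j (b j * p j v - lead b j v) ^+ 2 <=
    2 * \sum_(j | v \notin A j) b j ^+ 2 * p j v ^+ 2.
Proof.
move=> b0.
have le1 j : (b j * p j v - lead b j v) ^+ 2 <= b j ^+ 2 * p j v ^+ 2.
  rewrite -exprMn ler_sqr ?nnegrE ?subr_ge0 ?lead_le ?mulr_ge0 //.
  by rewrite lerBlDr lerDl lead_ge0.
have sq0 j : 0 <= b j ^+ 2 * p j v ^+ 2 by rewrite mulr_ge0 ?sqr_ge0.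
case: (pickP (fun j => v \in A j)) => [k vk|none]; last first.
  rewrite [X in 2 * X](_ : _ = \sum_j b j ^+ 2 * p j v ^+ 2); last first.
    by apply: eq_bigl => j; rewrite none.
  have h : \sum_j (b j * p j v - lead b j v) ^+ 2 <= \sum_j b j ^+ 2 * p j v ^+ 2.
    exact: ler_sum.
  by apply: le_trans h _; rewrite ler_peMl ?sumr_ge0 //; lra.
rewrite [X in 2 * X](_ : _ = \sum_(j | j != k) b j ^+ 2 * p j v ^+ 2); last first.
  apply: eq_bigl => j; have [->|jk] := eqVneq j k; first by rewrite vk.
  by rewrite (disjointFl (A_disj jk) vk).
rewrite (bigD1 k) //= mulrDl mul1r; apply: lerD; last by apply: ler_sum.
have r0 := rival_ge0 k v b0.
apply: le_trans (_ : rival b k v ^+ 2 <= _); last first.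
  apply: le_trans (bigmax_ge0_sqr _ _ _).2 _ => [i|]; first by rewrite mulr_ge0.
  by apply: ler_sum => i _; rewrite exprMn.
rewrite ler_sqr ?nnegrE ?subr_ge0 ?lead_le //.
by rewrite lerBlDr -lerBlDl le_max lexx orbT.
Qed.

Variables (L eta B : R).
Hypotheses (pL : forall j, energy w (p j) <= L) (eta_ge0 : 0 <= eta) (B_ge0 : 0 <= B).
Hypothesis p_leak : forall j, \sum_(v | v \notin A j) d v * p j v ^+ 2 <= eta.

(** The number [s] is the value of [x] that means no loss: 1 for a single play, the number of plays
    for their sum. *)
Definition cost j (x : V -> R) (s : R) : R :=
  energy w (fun v => p j v * x v) + B * mass d (fun v => p j v * (s - x v)).

(** Blackwell's condition: every nonnegative direction has a response whose costs, averaged in that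
    direction, stay below a fixed level. The weights are squares because [b j] times the shared
    function is [lead b j], and the costs are quadratic. *)
Lemma share_cost b : (forall i, 0 <= b i) ->
  \sum_j b j ^+ 2 * cost j (share b j) 1 <= (4 * L + 2 * B * eta) * \sum_j b j ^+ 2.
Proof.
move=> b0; under eq_bigr => j _ do rewrite mulrDr.
rewrite big_split /= mulrDl; apply: lerD.
  rewrite (eq_bigr (fun j => energy w (lead b j))); last first.
    by move=> j _; rewrite -energyZ; apply: eq_energy => v; rewrite share_lead.
  rewrite /energy -sum_edges_sum.
  apply: le_trans (ler_sum_edges w_ge0 (fun u v => lead_edge u v b0)) _.
  rewrite sum_edgesZ sum_edges_sum -mulrA ler_pM2l // mulr_sumr.
  apply: ler_sum => j _; rewrite sum_edgesZ mulrC.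
  by apply: ler_wpM2r; [exact: sqr_ge0|exact: pL].
rewrite (eq_bigr (fun j => B * \sum_v d v * (b j * p j v - lead b j v) ^+ 2)); last first.
  move=> j _; rewrite mulrCA; congr (B * _); rewrite -massZ; apply: eq_bigr => v _.
  by rewrite mulrBr mulr1 mulrBr share_lead.
rewrite -mulr_sumr exchange_big /=.
rewrite (_ : 2 * B * eta * _ = B * (2 * (eta * \sum_j b j ^+ 2))); last by ring.
apply: ler_wpM2l => //.
apply: le_trans (_ : \sum_v d v * (2 * \sum_(j | v \notin A j) b j ^+ 2 * p j v ^+ 2) <= _).
  by apply: ler_sum => v _; rewrite -mulr_sumr; apply: ler_wpM2l => //; exact: lead_loss.
under eq_bigr => v _ do rewrite mulrCA mulr_sumr.
rewrite -mulr_sumr ler_pM2l // (exchange_big_dep predT) //= mulr_sumr.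
apply: ler_sum => j _; rewrite mulrC.
apply: le_trans (_ : b j ^+ 2 * \sum_(v | v \notin A j) d v * p j v ^+ 2 <= _).
  by rewrite mulr_sumr; apply: ler_sum => v _; rewrite mulrCA.
by apply: ler_wpM2l; [exact: sqr_ge0|exact: p_leak].
Qed.

End Competition.

(** * Repeated play and averaged shares *)

Section Averaging.
Variables (R : realType) (V : finType) (w : V -> V -> R) (d : V -> R).
Hypotheses (w_ge0 : forall u v, 0 <= w u v) (w_sym : forall u v, w u v = w v u).
Hypothesis w_le_d : forall v, \sum_u w v u <= d v.

Let d_ge0 v : 0 <= d v.
Proof. by apply: le_trans (w_le_d v); exact: sumr_ge0. Qed.

Lemma energy_le_mass (f : V -> R) :
  (forall v, 0 <= f v) -> energy w f <= 2 * mass d f.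
Proof.
move=> f0; rewrite /energy.
apply: le_trans (_ : \sum_u \sum_v w u v * (f u ^+ 2 + f v ^+ 2) <= _).
  apply: ler_sum_edges => // u v.
  have := mulr_ge0 (f0 u) (f0 v).
  have -> : (f u - f v) ^+ 2 = f u ^+ 2 + f v ^+ 2 - 2 * (f u * f v) by ring.
  by lra.
rewrite sum_edgesD mulrDl mul1r; apply: lerD.
  by apply: ler_sum => u _; rewrite -mulr_suml; apply: ler_wpM2r; rewrite ?sqr_ge0.
rewrite exchange_big; apply: ler_sum => u _; rewrite -mulr_suml.
apply: ler_wpM2r; first exact: sqr_ge0.
by under eq_bigr => v _ do rewrite w_sym.
Qed.

Variables (m : nat) (p : 'I_m -> V -> R).
Hypothesis p_ge0 : forall j v, 0 <= p j v.
Variables (A : 'I_m -> {set V}).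
Hypothesis A_disj : forall i j, i != j -> [disjoint A i & A j].
Variables (L eta B : R).
Hypotheses (L_gt0 : 0 < L) (eta_ge0 : 0 <= eta) (B_ge0 : 0 <= B).
Hypothesis pL : forall j, energy w (p j) <= L.
Hypothesis p_leak : forall j, \sum_(v | v \notin A j) d v * p j v ^+ 2 <= eta.

Local Notation fee := (cost w d p B).
(** [B0] is the level that the average costs approach, [z j] bounds the distance of a single cost
    from it, and [W] the growth of the squared excess per play. *)
Let B0 := 4 * L + 2 * B * eta.
Let z j := (2 + B) * mass d (p j) + B0.
Let W := \sum_j z j ^+ 2.

Let B0_gt0 : 0 < B0.
Proof. by rewrite ltr_pwDl ?mulr_gt0 ?mulr_ge0. Qed.

Lemma cost_ge0 j x s : 0 <= fee j x s.
Proof. by rewrite addr_ge0 ?mulr_ge0 ?mass_ge0 ?energy_ge0. Qed.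

Lemma cost_le j x : (forall v, 0 <= x v <= 1) -> fee j x 1 <= (2 + B) * mass d (p j).
Proof.
move=> x01.
have le (y : V -> R) : (forall v, 0 <= y v <= 1) ->
    mass d (fun v => p j v * y v) <= mass d (p j).
  move=> y01; apply: ler_sum => v _; apply: ler_wpM2l => //; rewrite exprMn.
  by have /andP[? ?] := y01 v; rewrite ler_piMr ?sqr_ge0 // expr_le1.
rewrite /cost mulrDl; apply: lerD.
  apply: le_trans (energy_le_mass _) _ => [v|].
    by have /andP[? ?] := x01 v; rewrite mulr_ge0.
  by rewrite ler_pM2l // le.
apply: ler_wpM2l => //; apply: le => v; have /andP[? ?] := x01 v.
by apply/andP; split; lra.
Qed.

Lemma cost_add (t : R) j (x y : V -> R) : 0 <= t ->
  t * fee j (fun v => x v + y v) (t + 1) <= (t + 1) * (fee j x t + t * fee j y 1).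
Proof.
move=> t0; rewrite /cost.
rewrite (eq_energy w (g := fun v => p j v * x v + p j v * y v)); last first.
  by move=> v; rewrite mulrDr.
rewrite (eq_mass d (f := fun v => p j v * (t + 1 - (x v + y v)))
   (g := fun v => p j v * (t - x v) + p j v * (1 - y v))); last first.
  by move=> v; ring.
have h1 := energy_add_le w_ge0 (fun v => p j v * x v) (fun v => p j v * y v) t0.
have h2 := mass_add_le d_ge0 (fun v => p j v * (t - x v)) (fun v => p j v * (1 - y v)) t0.
have h3 := ler_wpM2l B_ge0 h2.
move: h1 h3; move: (energy _ _) (energy _ _) (energy _ _) (mass _ _) (mass _ _) (mass _ _).
move=> e1 e2 e3 m1 m2 m3 h1 h3.
rewrite mulrDr mulrCA; apply: le_trans (lerD h1 h3) _.
by rewrite le_eqVlt; apply/orP; left; apply/eqP; ring.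
Qed.

(* Blackwell's approachability: each new play is a best response to the current
   excess of the costs over [B0], so that the squared norm of the positive part
   of the excess grows only linearly with the number of plays. *)
Lemma repeated_play (n : nat) : exists (X : 'I_m -> V -> R) (C : 'I_m -> R),
  [/\ forall j v, 0 <= X j v, forall v, \sum_j X j v <= n.+1%:R,
      forall j, fee j (X j) n.+1%:R <= n.+1%:R * C j &
      \sum_j Num.max 0 (C j - n.+1%:R * B0) ^+ 2 <= n.+1%:R * W].
Proof.
have pos b j v : (forall i, 0 <= b i) -> 0 <= share p b j v <= 1.
  by move=> b0; rewrite share_ge0 ?share_le1.
have zle b j : (forall i, 0 <= b i) -> (fee j (share p b j) 1 - B0) ^+ 2 <= z j ^+ 2.
  move=> b0; have h1 := cost_ge0 j (share p b j) 1.
  have h2 := cost_le j (pos b j ^~ b0).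
  have h3 : 0 <= (2 + B) * mass d (p j) by rewrite mulr_ge0 ?mass_ge0 // addr_ge0.
  have h4 := B0_gt0.
  rewrite -[leLHS]real_normK ?num_real //; apply: lerXn2r; rewrite ?nnegrE //.
    by rewrite /z; lra.
  by rewrite ler_norml /z; apply/andP; split; lra.
elim: n => [|n [X [C [X0 X1 XC CW]]]].
  pose b (_ : 'I_m) : R := 1; have b0 i : 0 <= b i by [].
  exists (share p b), (fun j => fee j (share p b j) 1); split.
  - by move=> j v; rewrite share_ge0.
  - by move=> v; rewrite share_sum.
  - by move=> j; rewrite mul1r.
  - rewrite [leRHS]mul1r /W; apply: ler_sum => j _; apply: le_trans (zle b j b0).
    have := sqr_pos_sub (fee j (share p b j) 1 - B0) 0.
    by rewrite maxxx !subr0 mul1r.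
set t : R := n.+1%:R in X1 XC CW *.
have t0 : 0 < t by rewrite ltr0n.
(* The response is taken in the direction of the current excess [Y]; since [share_cost] weighs by
   squares, the bids are its square roots. *)
pose Y j := Num.max 0 (C j - t * B0).
have Y0 j : 0 <= Y j by rewrite le_max lexx.
pose b j := Num.sqrt (Y j); have b0 j : 0 <= b j by exact: sqrtr_ge0.
have bY j : b j ^+ 2 = Y j by rewrite sqr_sqrtr.
pose c j := fee j (share p b j) 1.
have tS : n.+2%:R = t + 1 by rewrite -natr1.
exists (fun j v => X j v + share p b j v), (fun j => C j + c j); split.
- by move=> j v; rewrite addr_ge0 ?share_ge0.
- by move=> v; rewrite big_split /= tS lerD ?share_sum.
- move=> j; rewrite tS -(ler_pM2l t0).
  apply: le_trans (cost_add j (X j) (share p b j) (ltW t0)) _.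
  have -> : t * ((t + 1) * (C j + c j)) = (t + 1) * (t * C j + t * c j) by ring.
  by rewrite ler_pM2l ?lerD // ltr_wpDl ?ltW.
- rewrite tS [leRHS]mulrDl mul1r.
  apply: le_trans (_ : \sum_j (Y j ^+ 2 + 2 * (Y j * (c j - B0)) + z j ^+ 2) <= _).
    apply: ler_sum => j _; apply: le_trans (_ : (Y j + (c j - B0)) ^+ 2 <= _); last first.
      by rewrite sqrrD; have := zle b j b0; rewrite -/(c j) mulr2n; lra.
    rewrite -[leRHS]real_normK ?num_real // ler_sqr ?nnegrE ?le_max ?lexx //.
    rewrite ge_max normr_ge0 /=; apply: le_trans (ler_norm _).
    have : C j - t * B0 <= Y j by rewrite le_max lexx orbT.
    by lra.
  have -> : \sum_j (Y j ^+ 2 + 2 * (Y j * (c j - B0)) + z j ^+ 2) =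
      \sum_j Y j ^+ 2 + 2 * \sum_j Y j * (c j - B0) + W.
    by rewrite /W mulr_sumr -!big_split.
  (* The cross term is nonpositive by [share_cost] in the direction [Y], so a play adds at most
     [W]. *)
  rewrite lerD2r; suff h : \sum_j Y j * (c j - B0) <= 0.
    by rewrite -[leRHS]addr0; apply: lerD; [exact: CW|rewrite pmulr_rle0].
  have := share_cost w_ge0 w_le_d p_ge0 A_disj pL B_ge0 p_leak b0.
  rewrite -/B0; under eq_bigr => j _ do rewrite bY -/(c j).
  under [X in _ <= _ * X]eq_bigr => j _ do rewrite bY.
  under [X in _ -> X <= _]eq_bigr => j _ do rewrite mulrBr.
  by rewrite sumrB -mulr_suml; lra.
Qed.

Lemma fractional_shares : exists x : 'I_m -> V -> R,
  [/\ forall j v, 0 <= x j v, forall v, \sum_j x j v <= 1 &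
      forall j, fee j (x j) 1 <= 2 * B0].
Proof.
(* After [t > W / B0 ^+ 2] plays the excess is at most [t * B0], so that the average costs are at
   most [2 * B0]. *)
pose n := Num.truncn (W / B0 ^+ 2).
have [X [C [X0 X1 XC CW]]] := repeated_play n.
set t : R := n.+1%:R in X1 XC CW.
have t0 : 0 < t by rewrite ltr0n.
have tW : W <= t * B0 ^+ 2.
  by rewrite -ler_pdivrMr ?exprn_gt0 // ltW // truncnS_gt.
clearbody t.
exists (fun j v => t^-1 * X j v); split.
- by move=> j v; rewrite mulr_ge0 // invr_ge0 ltW.
- by move=> v; rewrite -mulr_sumr mulrC ler_pdivrMr // mul1r.
- move=> j.
  have -> : fee j (fun v => t^-1 * X j v) 1 = t^-1 ^+ 2 * fee j (X j) t.
    rewrite mulrDr mulrCA -energyZ -massZ; congr (_ + _ * _).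
      by apply: eq_energy => v; rewrite mulrCA.
    by apply: eq_mass => v; field; rewrite gt_eqF.
  have Cj : C j <= t * (2 * B0).
    have : Num.max 0 (C j - t * B0) ^+ 2 <= (t * B0) ^+ 2.
      apply: le_trans (_ : \sum_j Num.max 0 (C j - t * B0) ^+ 2 <= _).
        by rewrite (bigD1 j) //= lerDl; apply: sumr_ge0 => i _; exact: sqr_ge0.
      by apply: le_trans CW _; rewrite exprMn (expr2 t) -mulrA ler_pM2l.
    have tB : 0 <= t * B0 by rewrite ltW // mulr_gt0.
    by rewrite ler_sqr ?nnegrE ?le_max ?lexx // ge_max => /andP[_]; lra.
  rewrite exprVn mulrC ler_pdivrMr ?exprn_gt0 //; apply: le_trans (XC j) _.
  have -> : 2 * B0 * t ^+ 2 = t * (t * (2 * B0)) by ring.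
  by rewrite ler_pM2l.
Qed.

End Averaging.

(** Above the threshold the two sides differ by a square; below it [1 - y] exceeds 1/2 and the left
    side is nonpositive. So truncation at half a function keeps an eighth of its mass, up to the
    mass lost by the share. *)
Lemma sqr_excess (R : realType) (a y : R) : 0 <= a ->
  a ^+ 2 / 8 - (a * (1 - y)) ^+ 2 <= Num.max 0 (a * y - a / 2) ^+ 2.
Proof.
move=> a0; case: (leP 0 (a * y - a / 2)) => h.
  rewrite -subr_ge0.
  have -> : (a * y - a / 2) ^+ 2 - (a ^+ 2 / 8 - (a * (1 - y)) ^+ 2)
    = (a / 2 - 2 * (a * (1 - y))) ^+ 2 / 2 by field.
  by rewrite divr_ge0 ?sqr_ge0.
have : (a / 2) ^+ 2 <= (a * (1 - y)) ^+ 2 by rewrite ler_sqr ?nnegrE //; lra.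
by rewrite expr0n /=; have := sqr_ge0 a; lra.
Qed.

Section Concentrated.
Variables (R : realType) (V : finType) (w : V -> V -> R) (d : V -> R).
Hypotheses (w_ge0 : forall u v, 0 <= w u v) (w_sym : forall u v, w u v = w v u).
Hypothesis w_le_d : forall v, \sum_u w v u <= d v.

(* Functions of low energy that are concentrated on disjoint sets, however
   rough these sets are, can be replaced by disjointly supported ones. *)
Lemma concentrated_packs (m : nat) (p : 'I_m -> V -> R) (A : 'I_m -> {set V}) (L : R) :
  0 < L -> (forall i j, i != j -> [disjoint A i & A j]) ->
  (forall j, energy w (p j) <= L) -> (forall j, 99 / 100 <= mass d (p j)) ->
  (forall j, \sum_(v | v \notin A j) d v * p j v ^+ 2 <= 1 / 1000) ->
  packs w d 'I_m (500 * L).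
Proof.
move=> L0 Ad pL pm leak.
have d0 v : 0 <= d v by apply: le_trans (w_le_d v); exact: sumr_ge0.
pose q j v := `|p j v|.
have q0 j v : 0 <= q j v by exact: normr_ge0.
have qL j : energy w (q j) <= L by exact: le_trans (energy_norm _ _) (pL j).
have qleak j : \sum_(v | v \notin A j) d v * q j v ^+ 2 <= 1 / 1000.
  apply: le_trans (leak j); apply: ler_sum => v _.
  by rewrite real_normK ?num_real.
(* With [B = 1000 * L] and leakage 1/1000 the level is 4 L + 2 L = 6 L. Costs of at most 12 L mean
   energy at most 12 L and lost mass at most 12/1000. *)
have B0 : 0 <= 1000 * L by lra.
have e0 : 0 <= 1 / 1000 :> R by lra.
have [x [x0 x1 xc]] := fractional_shares w_ge0 w_sym w_le_d q0 Ad L0 e0 B0 qL qleak.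
have xE j : energy w (fun v => q j v * x j v) <= 12 * L.
  have := xc j; rewrite /cost.
  have : 0 <= 1000 * L * mass d (fun v => q j v * (1 - x j v)) by rewrite mulr_ge0 ?mass_ge0.
  by lra.
have xM j : mass d (fun v => q j v * (1 - x j v)) <= 12 / 1000.
  have := xc j; rewrite /cost.
  have := energy_ge0 w_ge0 (fun v => q j v * x j v).
  by move=> h1 h2; rewrite -(ler_pM2l L0); lra.
have fm j : 11 / 100 <= mass d (fun v => Num.max 0 (q j v * x j v - q j v / 2)).
  have : mass d (q j) / 8 - mass d (fun v => q j v * (1 - x j v)) <=
      mass d (fun v => Num.max 0 (q j v * x j v - q j v / 2)).
    rewrite mulr_suml -sumrB; apply: ler_sum => v _.
    rewrite -mulrA -mulrBr; apply: ler_wpM2l => //.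
    exact: sqr_excess.
  by have := pm j; have := xM j; rewrite -(mass_norm d (p j)) -/(q j); lra.
(* The shares add up to at most 1, so at most one exceeds 1/2: cutting [q j * x j] off at [q j / 2]
   makes the supports disjoint. *)
exists (fun j v => Num.max 0 (q j v * x j v - q j v / 2)); split.
- by move=> j; apply: lt_le_trans (fm j); lra.
- move=> j; apply: le_trans (_ : 2 * (12 * L) + 2^-1 * L <= _); last first.
    have := ler_wpM2l (ltW L0) (fm j); lra.
  apply: le_trans (_ : 2 * energy w (fun v => q j v * x j v) + 2^-1 * energy w (q j) <= _).
    apply: energy_ler2 => // u v; apply: le_trans (sqr_pos_sub _ _) _ => /=.
    rewrite -subr_ge0.
    suff -> : forall a b c e : R, 2 * (a - c) ^+ 2 + 2^-1 * (b - e) ^+ 2 -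
        (a - b / 2 - (c - e / 2)) ^+ 2 = (a - c + (b - e) / 2) ^+ 2.
      exact: sqr_ge0.
    by move=> *; field.
  by have := xE j; have := qL j; lra.
- move=> i j v ij.
  have half k : Num.max 0 (q k v * x k v - q k v / 2) != 0 -> 1 / 2 < x k v.
    case: (ltP 0 (q k v * x k v - q k v / 2)) => [h _|_]; last by rewrite eqxx.
    rewrite ltNge; apply/negP => xk; move: h; apply/negP; rewrite -leNgt.
    by rewrite subr_le0; apply: ler_wpM2l => //; lra.
  have [->|hi] := eqVneq (Num.max 0 (q i v * x i v - q i v / 2)) 0; first by left.
  have [->|hj] := eqVneq (Num.max 0 (q j v * x j v - q j v / 2)) 0; first by right.
  have := x1 v; rewrite (bigD1 i) //= (bigD1 j) 1?eq_sym //=.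
  have : 0 <= \sum_(k < m | (k != i) && (k != j)) x k v by exact: sumr_ge0.
  by have := half i hi; have := half j hj; lra.
Qed.

End Concentrated.

(** * Random signs *)

Section Signs.
Variables (R : realType) (T : finType).
Implicit Types (e : {ffun T -> bool}) (x : T -> R) (F G : {ffun T -> bool} -> R).

Definition avg F : R := (\sum_e F e) / #|{ffun T -> bool}|%:R.

Definition signed e x : R := \sum_t (-1) ^+ e t * x t.

Let N_gt0 : 0 < #|{ffun T -> bool}|%:R :> R.
Proof. by rewrite ltr0n; apply/card_gt0P; exists [ffun=> true]. Qed.

Lemma ler_avg F G : (forall e, F e <= G e) -> avg F <= avg G.
Proof. by move=> FG; rewrite ler_pM2r ?invr_gt0 //; apply: ler_sum. Qed.

Lemma eq_avg F G : F =1 G -> avg F = avg G.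
Proof. by move=> FG; congr (_ / _); apply: eq_bigr. Qed.

Lemma avgD F G : avg (fun e => F e + G e) = avg F + avg G.
Proof. by rewrite /avg big_split mulrDl. Qed.

Lemma avgZ a F : avg (fun e => a * F e) = a * avg F.
Proof. by rewrite /avg -mulr_sumr mulrA. Qed.

Lemma avg_sum (I : Type) (r : seq I) (P : pred I) (F : I -> {ffun T -> bool} -> R) :
  avg (fun e => \sum_(i <- r | P i) F i e) = \sum_(i <- r | P i) avg (F i).
Proof. by rewrite /avg exchange_big mulr_suml. Qed.

Lemma avg_const c : avg (fun=> c) = c.
Proof. by rewrite /avg sumr_const -[X in X / _]mulr_natr mulfK ?gt_eqF. Qed.

Lemma avg_ex_le F : exists e, F e <= avg F.
Proof.
apply/existsP; apply: contraT; rewrite negb_exists => /forallP h.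
suff : avg F < avg F by rewrite ltxx.
rewrite {2}/avg ltr_pdivlMr // {1}mulr_natr -sumr_const.
apply: ltr_sum => [|e _]; first by apply/hasP; exists [ffun=> true]; rewrite ?mem_index_enum.
by rewrite ltNge.
Qed.

Let flip t e : {ffun T -> bool} := [ffun u => (u == t) (+) e u].

(** Averaging over the sign at [t] first cancels its odd powers; this plays the part of
    independence. *)
Let avg_flip t F : avg F = avg (fun e => (F e + F (flip t e)) / 2).
Proof.
have flipK : involutive (flip t).
  by move=> e; apply/ffunP => u; rewrite !ffunE addbA addbb.
have -> : avg (fun e => (F e + F (flip t e)) / 2) = 2^-1 * (avg F + avg (F \o flip t)).
  by rewrite -avgD -avgZ; apply: eq_avg => e /=; rewrite mulrC.
suff <- : avg F = avg (F \o flip t) by field.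
by rewrite /avg (reindex_inj (inv_inj flipK)).
Qed.

Let psum (r : seq T) x e : R := \sum_(t <- r) (-1) ^+ e t * x t.

Let psum_flip t r x e : t \notin r -> psum r x (flip t e) = psum r x e.
Proof.
move=> tr; apply: eq_big_seq => u ur; rewrite ffunE.
by have /negPf-> : u != t by apply: contraNneq tr => <-.
Qed.

Let avg_psum2 r x : uniq r -> avg (fun e => psum r x e ^+ 2) = \sum_(t <- r) x t ^+ 2.
Proof.
elim: r => [_|t r IH /= /andP[tr ur]].
  by rewrite big_nil -[RHS]avg_const; apply: eq_avg => e; rewrite /psum big_nil expr0n.
rewrite (avg_flip t) big_cons -IH // -[x t ^+ 2]avg_const -avgD; apply: eq_avg => e.
rewrite [psum (t :: r) x e]big_cons [psum (t :: r) x _]big_cons -!/(psum _ _ _).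
rewrite psum_flip // ffunE eqxx signr_addb /=.
by case: (e t); rewrite ?expr0 ?expr1; field.
Qed.

(** Khintchine's inequality for fourth moments. A new term [c] adds [6 c^2 s + c^4] to the moment
    and [6 c^2 s + 3 c^4] to the bound, where [s] is the previous sum of squares. *)
Let avg_psum4 r x : uniq r ->
  avg (fun e => psum r x e ^+ 4) <= 3 * (\sum_(t <- r) x t ^+ 2) ^+ 2.
Proof.
elim: r => [_|t r IH /= /andP[tr ur]].
  rewrite big_nil expr0n /= mulr0 -[leRHS]avg_const.
  by apply: ler_avg => e; rewrite /psum big_nil expr0n.
rewrite (avg_flip t) big_cons.
have -> : avg (fun e => (psum (t :: r) x e ^+ 4 + psum (t :: r) x (flip t e) ^+ 4) / 2)
   = avg (fun e => psum r x e ^+ 4) + 6 * x t ^+ 2 * avg (fun e => psum r x e ^+ 2) + x t ^+ 4.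
  rewrite -avgZ -avgD -[X in _ + X]avg_const -avgD; apply: eq_avg => e.
  rewrite [psum (t :: r) x e]big_cons [psum (t :: r) x _]big_cons -!/(psum _ _ _).
  rewrite psum_flip // ffunE eqxx signr_addb /=.
  by case: (e t); rewrite ?expr0 ?expr1; field.
rewrite avg_psum2 //; move: (IH ur); move: (\sum_(u <- r) _) (avg _) => s a h.
apply: le_trans (lerD (lerD h (lexx _)) (lexx _)) _.
rewrite -subr_ge0; set c := x t.
have -> : 3 * (c ^+ 2 + s) ^+ 2 - (3 * s ^+ 2 + 6 * c ^+ 2 * s + c ^+ 4) = 2 * (c ^+ 2) ^+ 2.
  by ring.
by rewrite mulr_ge0 ?sqr_ge0.
Qed.

Lemma avg_signed2 x : avg (fun e => signed e x ^+ 2) = \sum_t x t ^+ 2.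
Proof. exact/avg_psum2/index_enum_uniq. Qed.

Lemma avg_signed4 x : avg (fun e => signed e x ^+ 4) <= 3 * (\sum_t x t ^+ 2) ^+ 2.
Proof. exact/avg_psum4/index_enum_uniq. Qed.

Lemma signedB e x y : signed e (fun t => x t - y t) = signed e x - signed e y.
Proof. by rewrite -sumrB; apply: eq_bigr => t _; rewrite mulrBr. Qed.

Lemma signedZ e a x : signed e (fun t => a * x t) = a * signed e x.
Proof. by rewrite mulr_sumr; apply: eq_bigr => t _; rewrite mulrCA. Qed.

(* Anti-concentration by a Chebyshev bound for [signed e x ^+ 2] around 4 times
   its mean. *)
Lemma avg_signed_small x c : 0 < c -> c <= (\sum_t x t ^+ 2) / 4 ->
  avg (fun e => (signed e x ^+ 2 < c)%R%:R) <= 4 / 5.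
Proof.
move=> c0 cm; set m := \sum_t _ in cm *.
have m0 : 0 < m by lra.
(* On the event, [4 m - s^2] exceeds [15/4 m], while its square has mean at most
   [(3 - 8 + 16) m^2 = 11 m^2], which is below [4/5 (15/4 m)^2]. *)
have D0 : 0 < (15 / 4 * m) ^+ 2 by rewrite exprn_gt0 // mulr_gt0 //; lra.
rewrite -(ler_pM2l D0) -avgZ.
apply: le_trans (_ : avg (fun e => (signed e x ^+ 4 + (- (8 * m)) * signed e x ^+ 2)
   + 16 * m ^+ 2) <= _).
  apply: ler_avg => e; set s := signed e x.
  have -> : s ^+ 4 + - (8 * m) * s ^+ 2 + 16 * m ^+ 2 = (4 * m - s ^+ 2) ^+ 2 by ring.
  case: ltP => h; last by rewrite mulr0 sqr_ge0.
  by rewrite mulr1 ler_sqr ?nnegrE; lra.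
rewrite avgD avgD (avgZ _ (fun e => signed e x ^+ 2)) avg_signed2 avg_const -/m.
have := avg_signed4 x; rewrite -/m; move: (avg _) => a h.
have -> : (15 / 4 * m) ^+ 2 * (4 / 5) = 45 / 4 * m ^+ 2 by field.
have -> : - (8 * m) * m = - (8 * m ^+ 2) by ring.
by have := sqr_ge0 m; lra.
Qed.

End Signs.

(** * Localization of vector-valued functions *)

Section Grid.
Variables (R : realType) (q : nat).
Hypothesis q_gt0 : (0 < q)%N.
Implicit Types x y : R.

Definition gcell x : int := Num.floor (x / q%:R).

(** The distance to the boundary of the cell of [x], capped at 1 so that it is exactly 1 for most
    shifts of the grid. *)
Definition bump x : R :=
  Num.min 1 (Num.min (x - q%:R * (gcell x)%:~R) (q%:R * ((gcell x)%:~R + 1) - x)).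

Let q0 : 0 < q%:R :> R. Proof. by rewrite ltr0n. Qed.

Lemma gcell_le x : q%:R * (gcell x)%:~R <= x.
Proof. by rewrite mulrC -ler_pdivlMr // floor_le. Qed.

Lemma gcell_gt x : x < q%:R * ((gcell x)%:~R + 1).
Proof. by rewrite mulrC -ltr_pdivrMr // (_ : _ + 1 = (gcell x + 1)%:~R) ?floorD1_gt // intrD. Qed.

Lemma bump_ge0 x : 0 <= bump x.
Proof. by rewrite !le_min ler01 !subr_ge0 gcell_le ltW // gcell_gt. Qed.

Lemma bump_same x y : gcell x = gcell y -> (bump x - bump y) ^+ 2 <= (x - y) ^+ 2.
Proof.
move=> e; rewrite /bump e; set a := q%:R * _; set b := q%:R * _.
have -> : (x - y) ^+ 2 = `|x - y| ^+ 2 by rewrite real_normK ?num_real.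
rewrite -[leLHS]real_normK ?num_real //; apply: lerXn2r; rewrite ?nnegrE //.
suff le u v : Num.min 1 (Num.min (u - a) (b - u)) <=
    Num.min 1 (Num.min (v - a) (b - v)) + `|u - v|.
  by rewrite ler_norml; have := le x y; have := le y x; rewrite distrC => *; apply/andP; split; lra.
have h1 := ler_norm (u - v); have h2 := ler_norm (v - u); rewrite distrC in h2.
have h3 := normr_ge0 (u - v).
rewrite -lerBlDr !le_min !lerBlDr; apply/and3P; split; rewrite ge_min.
- by rewrite lerDl h3.
- by rewrite ge_min; apply/orP; right; apply/orP; left; lra.
- by rewrite ge_min; apply/orP; right; apply/orP; right; lra.
Qed.

(** The segment from [x] to [y] leaves the cell of [x], hence is at least as long as the distance
    from [x] to its boundary. *)
Lemma bump_diff x y : gcell x != gcell y -> bump x ^+ 2 <= (x - y) ^+ 2.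
Proof.
move=> ne.
have -> : (x - y) ^+ 2 = `|x - y| ^+ 2 by rewrite real_normK ?num_real.
apply: lerXn2r; rewrite ?nnegrE ?bump_ge0 //.
rewrite /bump !ge_min; apply/orP; right.
move: ne; rewrite neq_lt => /orP[lt|lt].
  have : (gcell x + 1)%:~R <= (gcell y)%:~R :> R by rewrite ler_int; lia.
  rewrite intrD -(ler_pM2l q0) => h; have := gcell_le y; have := ler_norm (y - x).
  by rewrite distrC => *; apply/orP; right; lra.
have : (gcell y + 1)%:~R <= (gcell x)%:~R :> R by rewrite ler_int; lia.
rewrite intrD -(ler_pM2l q0) => h; have := gcell_gt y; have := ler_norm (x - y).
by move=> *; apply/orP; left; lra.
Qed.

Lemma gcell_same x y : gcell x = gcell y -> (x - y) ^+ 2 < q%:R ^+ 2.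
Proof.
move=> e; rewrite -[ltLHS]real_normK ?num_real //.
rewrite ltr_sqr ?nnegrE ?(ltW q0) // ltr_norml.
have := gcell_le x; have := gcell_gt x; have := gcell_le y; have := gcell_gt y.
by rewrite e => *; apply/andP; split; lra.
Qed.

(** A point within distance 1 of the lower wall of its cell determines the shift modulo [q], and so
    does one near the upper wall: these are the cases [P 0] and [P 1]. *)
Lemma bump_shift x : \sum_(t < q) (bump (x - t%:R) < 1)%R%:R <= 2 :> R.
Proof.
have floorE t k : t%:R + q%:R * k%:~R <= x < t%:R + q%:R * k%:~R + 1 ->
    Num.floor x = t%:Z + q%:Z * k.
  by move=> /andP[h1 h2]; apply: floor_def; rewrite !intrD intrM -!pmulrn h1.
have mod_ord (t : 'I_q) (k : int) : ((t%:Z + q%:Z * k) %% q%:Z)%Z = t%:Z.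
  by rewrite mulrC addrC modzMDl modz_small // ltz_nat ltn_ord.
pose P c (t : 'I_q) := t%:Z == ((Num.floor x + c) %% q%:Z)%Z.
have Puniq c : \sum_t (P c t)%:R <= 1 :> R.
  apply: sum_indic_le1 => t t' /eqP h /eqP h'; apply: val_inj.
  by have := etrans h (esym h') => -[].
apply: le_trans (_ : \sum_(t < q) ((P 0 t)%:R + (P 1 t)%:R) <= _); last first.
  by rewrite big_split /=; have := Puniq 0; have := Puniq 1; lra.
apply: ler_sum => t _; set y := x - t%:R.
case: ltP => [h|_]; last by rewrite addr_ge0.
suff : P 0 t || P 1 t by case: (P 0 t) => /= [_|->]; rewrite ?lerDl ?add0r.
move: h; rewrite /bump gt_min ltxx /= gt_min => /orP[h|h]; apply/orP.
  left; rewrite /P addr0 (floorE t (gcell y)) ?mod_ord //.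
  by have := gcell_le y; rewrite /y in h *; move=> ?; apply/andP; split; lra.
right; rewrite /P (_ : Num.floor x + 1 = t%:Z + q%:Z * (gcell y + 1)) ?mod_ord //.
have : Num.floor (x + 1) = t%:Z + q%:Z * (gcell y + 1).
  apply: floor_def; rewrite !intrD intrM intrD -!pmulrn.
  by have := gcell_gt y; rewrite /y in h *; move=> ?; apply/andP; split; lra.
by rewrite floorDrz // ?floor1 // => ->.
Qed.

End Grid.

Section Grouping.
Variables (R : realType) (I : finType) (a : I -> R) (b : R).
Hypotheses (a_ge0 : forall i, 0 <= a i) (a_le : forall i, a i <= b) (b_ge1 : 1 <= b).

(* By minimality, two distinct elements of the set carry together more than
   twice the excess over 1/2, so that the total weight is below 1. *)
Lemma minimal_group (D : {set I}) : 1 / 2 <= \sum_(i in D) a i ->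
  exists F : {set I}, [/\ F \subset D, F != set0, 1 / 2 <= \sum_(i in F) a i &
    \sum_(i in F) a i <= b].
Proof.
move=> hD; pose P (F : {set I}) := (F \subset D) && (1 / 2 <= \sum_(i in F) a i).
have PD : P D by rewrite /P subxx.
have [F /andP[FD hF] Fmin] := @arg_minnP _ D P (fun F => #|F|) PD.
have F0 : F != set0.
  by apply: contraTneq hF => ->; rewrite big_set0 -ltNge; lra.
have drop i : i \in F -> \sum_(k in F) a k - a i < 1 / 2.
  move=> iF; rewrite ltNge; apply/negP => h.
  have : P (F :\ i).
    rewrite /P (subset_trans (subsetDl _ _) FD) /=.
    by move: h; rewrite (big_setD1 i) //= addrAC subrr add0r.
  by move=> /Fmin; rewrite (cardsD1 i F) iF add1n ltnn.
exists F; split => //; have /set0Pn[i iF] := F0.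
have iE : \sum_(k in F) a k = a i + \sum_(k in F :\ i) a k by rewrite (big_setD1 i).
have [F1|/set0Pn[j jF]] := eqVneq (F :\ i) set0.
  by rewrite iE F1 big_set0 addr0.
have : a j <= \sum_(k in F :\ i) a k.
  by rewrite (big_setD1 j) //= lerDl; apply: sumr_ge0.
have jF' : j \in F by move: jF; rewrite !inE => /andP[].
by have := drop i iF; have := drop j jF'; move: b_ge1; lra.
Qed.

(** Groups from [minimal_group] are peeled off until less than 1/2 remains. The rest keeps the label
    0, which does no harm since groups are only bounded from below. *)
Lemma grouping : exists (n : nat) (lab : I -> nat),
  (forall l, (l < n)%N -> 1 / 2 <= \sum_(i | lab i == l) a i) /\
  \sum_i a i <= n%:R * b + 1 / 2.
Proof.
suff H (D : {set I}) : exists (n : nat) (lab : I -> nat),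
    (forall l, (l < n)%N -> 1 / 2 <= \sum_(i in D | lab i == l) a i) /\
    \sum_(i in D) a i <= n%:R * b + 1 / 2.
  have [n [lab [h1 h2]]] := H [set: I]; exists n, lab; split.
    by move=> l /h1; rewrite (eq_bigl (fun i => lab i == l)) // => i; rewrite inE.
  by move: h2; rewrite (eq_bigl predT) // => i; rewrite inE.
have [s sD] := ubnP #|D|; elim: s D sD => // s IH D sD.
have [small|big] := ltP (\sum_(i in D) a i) (1 / 2).
  by exists 0%N, (fun=> 0%N); split=> //; rewrite mul0r add0r ltW.
have [F [FD F0 hF Fb]] := minimal_group big.
have lt : (#|D :\: F| < s)%N.
  apply: leq_trans (ltnSE sD).
  by rewrite cardsD (setIidPr FD) ltn_subrL card_gt0 F0 card_gt0; apply: contraNneq F0 => D0;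
     rewrite -subset0 -D0.
have [n [lab [h1 h2]]] := IH _ lt.
exists n.+1, (fun i => if i \in F then n else lab i); split.
  move=> l; rewrite ltnS leq_eqVlt => /orP[/eqP->|ln].
    apply: le_trans hF _; rewrite [leRHS](bigID (mem F)) /=.
    apply: le_trans (_ : \sum_(i in F) a i <= _) => //.
    rewrite [X in _ <= X + _](eq_bigl (mem F)); last first.
      move=> i /=; case: (boolP (i \in F)) => [iF|]; last by rewrite andbF.
      by rewrite (subsetP FD) ?eqxx.
    by rewrite lerDl; apply: sumr_ge0.
  apply: le_trans (h1 l ln) _; rewrite le_eqVlt; apply/orP; left; apply/eqP/eq_bigl => i.
  rewrite !inE; case: (i \in F) => //=.
  by rewrite gtn_eqF // andbF.
rewrite (big_setID F) /= (setIidPr FD) -natr1 mulrDl mul1r; lra.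
Qed.

End Grouping.

(** * Polar coordinates of a vector-valued function *)

Section Polar.
Variables (R : realType) (V T : finType) (G : T -> V -> R).
Implicit Types (u v : V) (e : {ffun T -> bool}).

Definition sqnorm v : R := \sum_t G t v ^+ 2.
Definition rad v : R := Num.sqrt (sqnorm v).
(* [dir t v] is 0 when [rad v] is. *)
Definition dir t v : R := G t v / rad v.
Definition gap u v : R := \sum_t (dir t u - dir t v) ^+ 2.

Lemma sqnorm_ge0 v : 0 <= sqnorm v.
Proof. by apply: sumr_ge0 => t _; exact: sqr_ge0. Qed.

Lemma rad_ge0 v : 0 <= rad v. Proof. exact: sqrtr_ge0. Qed.

Lemma rad_sqr v : rad v ^+ 2 = sqnorm v.
Proof. by rewrite sqr_sqrtr // sqnorm_ge0. Qed.

Lemma rad_eq0 v t : rad v = 0 -> G t v = 0.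
Proof.
move=> r0; have : sqnorm v = 0 by rewrite -rad_sqr r0 expr0n.
by move=> /eqP; rewrite psumr_eq0 => [/allP/(_ t)|i _]; rewrite ?sqr_ge0 // mem_index_enum
  sqrf_eq0 => /(_ isT)/eqP.
Qed.

Lemma rad_dir t v : rad v * dir t v = G t v.
Proof.
have [r0|r0] := eqVneq (rad v) 0; first by rewrite r0 mul0r rad_eq0.
by rewrite mulrC divfK.
Qed.

Lemma sum_dir v : rad v * \sum_t dir t v ^+ 2 = rad v.
Proof.
have [->|r0] := eqVneq (rad v) 0; first by rewrite mul0r.
have -> : \sum_t dir t v ^+ 2 = (rad v ^+ 2)^-1 * sqnorm v.
  by rewrite mulr_sumr; apply: eq_bigr => t _; rewrite expr_div_n mulrC.
by rewrite -rad_sqr mulVf ?mulr1 // sqrf_eq0.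
Qed.

Lemma sum_dir_le1 v : \sum_t dir t v ^+ 2 <= 1.
Proof.
have [r0|r0] := eqVneq (rad v) 0; last first.
  by have -> : \sum_t dir t v ^+ 2 = 1 by apply: (mulfI r0); rewrite sum_dir mulr1.
by rewrite big1 ?ler01 // => t _; rewrite /dir r0 invr0 mulr0 expr0n.
Qed.

Let sum_sqrB (a b : R) (x y : T -> R) : \sum_t (a * x t - b * y t) ^+ 2 =
  a ^+ 2 * (\sum_t x t ^+ 2) + b ^+ 2 * (\sum_t y t ^+ 2) - 2 * a * b * \sum_t x t * y t.
Proof.
by rewrite !mulr_sumr -big_split -sumrB; apply: eq_bigr => t _ /=; ring.
Qed.

Lemma gapE u v : gap u v =
  \sum_t dir t u ^+ 2 + \sum_t dir t v ^+ 2 - 2 * \sum_t dir t u * dir t v.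
Proof.
have := sum_sqrB 1 1 (dir^~ u) (dir^~ v); rewrite !mulr1 expr1n !mul1r => <-.
by apply: eq_bigr => t _; rewrite !mul1r.
Qed.

Lemma gap_ge0 u v : 0 <= gap u v.
Proof. by apply: sumr_ge0 => t _; exact: sqr_ge0. Qed.

(** The law of cosines. With [x] and [y] the radii it splits an increment into radial and angular
    parts; it is also needed for reduced radii along the same directions. *)
Lemma polar_scaled (x y : R) u v :
  (rad u = 0 -> x = 0) -> (rad v = 0 -> y = 0) ->
  \sum_t (x * dir t u - y * dir t v) ^+ 2 = (x - y) ^+ 2 + x * y * gap u v.
Proof.
move=> x0 y0; rewrite sum_sqrB gapE.
have unit (s : R) z : (rad z = 0 -> s = 0) -> s * \sum_t dir t z ^+ 2 = s.
  move=> s0; have [/s0->|rz] := eqVneq (rad z) 0; first by rewrite mul0r.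
  by apply: (mulfI rz); rewrite mulrCA sum_dir mulrC.
have := unit x u x0; have := unit y v y0.
move: (\sum_t dir t u ^+ 2) (\sum_t dir t v ^+ 2) (\sum_t _ * _) => a b c hb ha.
rewrite !expr2 -(mulrA x x a) -(mulrA y y b) ha hb.
have -> : x * y * (a + b - 2 * c) = y * (x * a) + x * (y * b) - 2 * x * y * c by ring.
by rewrite ha hb; ring.
Qed.

Lemma polar u v : \sum_t (G t u - G t v) ^+ 2 =
  (rad u - rad v) ^+ 2 + rad u * rad v * gap u v.
Proof.
by rewrite -polar_scaled //; apply: eq_bigr => t _; rewrite !rad_dir.
Qed.

Lemma sqr_radB_le u v : (rad u - rad v) ^+ 2 <= \sum_t (G t u - G t v) ^+ 2.
Proof. by rewrite polar lerDl !mulr_ge0 ?rad_ge0 ?gap_ge0. Qed.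

Definition proj e v : R := signed e (dir^~ v).

Lemma projB e u v : proj e u - proj e v = signed e (fun t => dir t u - dir t v).
Proof. by rewrite signedB. Qed.

Lemma avg_proj u v : avg (fun e => (proj e u - proj e v) ^+ 2) = gap u v.
Proof. by rewrite /gap -avg_signed2; apply: eq_avg => e; rewrite projB. Qed.

End Polar.

(** * Rows of signs that separate directions *)

Section Rows.
Variables (R : realType) (V T : finType) (w : V -> V -> R) (d : V -> R).
Hypotheses (w_ge0 : forall u v, 0 <= w u v) (d_ge0 : forall v, 0 <= d v).
Variable G : T -> V -> R.
Local Notation rad := (rad G).
Local Notation proj := (proj G).
Local Notation gap := (gap G).
Variable delta : R.
Hypothesis delta_gt0 : 0 < delta.

Definition weight v : R := d v * sqnorm G v.

Definition stretch e : R :=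
  \sum_u \sum_v w u v * (rad u * rad v * (proj e u - proj e v) ^+ 2).

(** The quarter matches [avg_signed_small]: a random row leaves a pair with gap at least [delta]
    near with probability at most 4/5. *)
Definition near e u v : bool := (proj e u - proj e v) ^+ 2 < delta / 4.

Definition far_pair u v : R := weight u * weight v * (delta <= gap u v)%R%:R.

Definition collisions (S : seq {ffun T -> bool}) : R :=
  \sum_u \sum_v far_pair u v * (all (fun e => near e u v) S)%:R.

Definition spread_energy : R := \sum_u \sum_v w u v * (rad u * rad v * gap u v).

Lemma weight_ge0 v : 0 <= weight v.
Proof. by rewrite mulr_ge0 ?sqnorm_ge0. Qed.

Lemma far_pair_ge0 u v : 0 <= far_pair u v.
Proof. by apply: mulr_ge0 => //; apply: mulr_ge0; exact: weight_ge0. Qed.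

Lemma stretch_ge0 e : 0 <= stretch e.
Proof.
apply: sumr_ge0 => u _; apply: sumr_ge0 => v _.
by rewrite mulr_ge0 // mulr_ge0 ?sqr_ge0 // mulr_ge0 ?rad_ge0.
Qed.

Lemma collisions_ge0 S : 0 <= collisions S.
Proof.
apply: sumr_ge0 => u _; apply: sumr_ge0 => v _; apply: mulr_ge0 => //.
exact: far_pair_ge0.
Qed.

Lemma avg_stretch : avg stretch = spread_energy.
Proof.
rewrite avg_sum; apply: eq_bigr => u _; rewrite avg_sum; apply: eq_bigr => v _.
by rewrite !avgZ avg_proj.
Qed.

Lemma avg_collisions S : avg (fun e => collisions (e :: S)) <= 4 / 5 * collisions S.
Proof.
rewrite avg_sum mulr_sumr; apply: ler_sum => u _; rewrite avg_sum mulr_sumr.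
apply: ler_sum => v _ /=.
rewrite (eq_avg (G := fun e => far_pair u v * (all (fun e => near e u v) S)%:R *
  (near e u v)%:R)); last by move=> e; rewrite -mulrA -natrM mulnb andbC.
rewrite avgZ mulrC; have [far|close] := boolP (delta <= gap u v); last first.
  by rewrite /far_pair (negbTE close) !(mulr0, mul0r).
apply: ler_wpM2r; first by apply: mulr_ge0 => //; exact: far_pair_ge0.
rewrite (eq_avg (G := fun e =>
    (signed e (fun t => dir G t u - dir G t v) ^+ 2 < delta / 4)%R%:R)); last first.
  by move=> e; rewrite /near projB.
by apply: avg_signed_small; [rewrite divr_gt0|rewrite ler_pM2r ?invr_gt0].
Qed.

(* The rows of a random sign matrix, chosen one after the other by the method
   of conditional expectations. *)
Lemma sign_rows (h : nat) (beta : R) : 0 <= beta ->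
  exists S : seq {ffun T -> bool}, size S = h /\
    beta * (\sum_(e <- S) stretch e) + collisions S <=
      beta * h%:R * spread_energy + (4 / 5) ^+ h * (\sum_v weight v) ^+ 2.
Proof.
elim: h beta => [|h IH] beta b0.
  exists [::]; split=> //; rewrite big_nil !mulr0 !mul0r !add0r mul1r expr2 mulr_suml.
  apply: ler_sum => u _; rewrite mulr_sumr; apply: ler_sum => v _.
  by rewrite mulr1 /far_pair ler_piMr ?lern1 ?leq_b1 //; apply: mulr_ge0; exact: weight_ge0.
(* The factor 5/4 compensates the 4/5 by which one more row reduces the collisions. *)
have [|S [<- hS]] := IH (beta * (5 / 4)); first by rewrite mulr_ge0 //; lra.
have [e he] := avg_ex_le (fun e => beta * stretch e + collisions (e :: S)).
exists (e :: S); split=> //; rewrite big_cons mulrDr.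
rewrite avgD avgZ avg_stretch in he.
have h3 := avg_collisions S; move: he hS h3; rewrite [(4 / 5) ^+ _.+1]exprS -[(size S).+1%:R]natr1.
set a := (\sum_v weight v) ^+ 2; set b := (4 / 5) ^+ _; set k : R := (size S)%:R.
set x := avg _; set y := collisions (e :: S); set z := collisions S.
set s := \sum_(e <- S) _; set t := stretch e; set E := spread_energy => h1 h2 h3.
have : 4 / 5 * (beta * (5 / 4) * s + z) <= 4 / 5 * (beta * (5 / 4) * k * E + b * a).
  by rewrite ler_pM2l //; lra.
have -> : 4 / 5 * (beta * (5 / 4) * s + z) = beta * s + 4 / 5 * z by field.
have -> : 4 / 5 * (beta * (5 / 4) * k * E + b * a) = beta * k * E + 4 / 5 * b * a by field.
by lra.
Qed.

End Rows.

(** * Cells of the shifted grid *)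

Section Clusters.
Variables (R : realType) (V T : finType) (w : V -> V -> R) (d : V -> R).
Hypotheses (w_ge0 : forall u v, 0 <= w u v) (d_ge0 : forall v, 0 <= d v).
Variable G : T -> V -> R.
Variables (S : seq {ffun T -> bool}) (q : nat) (sc : R) (t : nat).
Hypothesis q_gt0 : (0 < q)%N.
Local Notation rad := (rad G).
Local Notation weight := (weight d G).

Definition coord (e : {ffun T -> bool}) v : R := proj G e v * sc - t%:R.

Definition key v : seq int := [seq gcell q (coord e v) | e <- S].

Definition soft v : R := \big[Num.min/1]_(e <- S) bump q (coord e v).

Definition travel u v : R := sc ^+ 2 * \sum_(e <- S) (proj G e u - proj G e v) ^+ 2.

Lemma soft_ge0 v : 0 <= soft v.
Proof.
by rewrite /soft; elim/big_rec: _ => // e x _ x0; rewrite le_min bump_ge0.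
Qed.

Lemma soft_le1 v : soft v <= 1.
Proof. by rewrite /soft; elim/big_rec: _ => // e x _ h; rewrite ge_min h orbT. Qed.

Lemma soft_le e v : e \in S -> soft v <= bump q (coord e v).
Proof.
rewrite /soft; elim: S => // f r IH; rewrite inE big_cons => /orP[/eqP->|/IH h].
  by rewrite ge_min lexx.
by rewrite ge_min h orbT.
Qed.

Lemma soft_lt1 v : (soft v < 1)%R%:R <= \sum_(e <- S) (bump q (coord e v) < 1)%R%:R :> R.
Proof.
rewrite /soft; elim: S => [|f r IH]; first by rewrite !big_nil ltxx.
rewrite !big_cons gt_min.
case: (bump q (coord f v) < 1) => /=; last by rewrite add0r.
by rewrite lerDl; apply: sumr_ge0.
Qed.

Lemma travelE u v : travel u v = \sum_(e <- S) (coord e u - coord e v) ^+ 2.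
Proof. by rewrite /travel mulr_sumr; apply: eq_bigr => e _; rewrite /coord; ring. Qed.

Lemma travel_ge0 u v : 0 <= travel u v.
Proof. by rewrite travelE; apply: sumr_ge0 => e _; exact: sqr_ge0. Qed.

Lemma travelC u v : travel u v = travel v u.
Proof. by rewrite !travelE; apply: eq_bigr => e _; rewrite sqr_subC. Qed.

Lemma same_key u v e : key u = key v -> e \in S ->
  gcell q (coord e u) = gcell q (coord e v).
Proof. by move=> /eq_in_map h /h. Qed.

Lemma soft_same u v : key u = key v -> (soft u - soft v) ^+ 2 <= travel u v.
Proof.
move=> kuv; apply: le_trans (sqr_bigmin_sub _ _ _ _ _) _.
rewrite travelE big_seq [leRHS]big_seq; apply: ler_sum => e eS.
exact: bump_same (same_key kuv eS).
Qed.

Lemma soft_diff u v : key u != key v -> soft u ^+ 2 <= travel u v.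
Proof.
move=> kuv.
have [/allP same|/allPn[e eS ne]] :=
    boolP (all (fun e => gcell q (coord e u) == gcell q (coord e v)) S).
  by case/eqP: kuv; apply/eq_in_map => e /same/eqP.
apply: le_trans (_ : bump q (coord e u) ^+ 2 <= _).
  by apply: lerXn2r; rewrite ?nnegrE ?soft_ge0 ?bump_ge0 ?soft_le.
apply: le_trans (bump_diff q_gt0 ne) _; rewrite travelE (big_rem e) //= lerDl.
by apply: sumr_ge0 => f _; exact: sqr_ge0.
Qed.

Definition local v : R := rad v * soft v.

(** What an edge contributes to the total energy when [local] is cut into a separate function on
    each cell. *)
Definition crossing u v : R :=
  if key u == key v then (local u - local v) ^+ 2 else local u ^+ 2 + local v ^+ 2.

Let lip a b x y z : 0 <= a -> a <= b -> 0 <= y <= 1 -> (x - y) ^+ 2 <= z ->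
  (a * x - b * y) ^+ 2 <= 2 * ((a - b) ^+ 2 + a * b * z) :> R.
Proof.
move=> a0 ab /andP[y0 y1] h.
have h1 : a ^+ 2 * (x - y) ^+ 2 <= a * b * z.
  apply: ler_pM => //; rewrite ?sqr_ge0 //.
  by rewrite expr2; apply: ler_wpM2l.
have h2 : (a - b) ^+ 2 * y ^+ 2 <= (a - b) ^+ 2.
  by rewrite ler_piMr ?sqr_ge0 // expr_le1.
have -> : (a * x - b * y) ^+ 2 = 2 * (a ^+ 2 * (x - y) ^+ 2) +
   2 * ((a - b) ^+ 2 * y ^+ 2) - (a * (x - y) - (a - b) * y) ^+ 2 by ring.
by have := sqr_ge0 (a * (x - y) - (a - b) * y); lra.
Qed.

(** Inside a cell [soft] is Lipschitz in the coordinates; across cells each of its two values is at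
    most the distance to a wall that the edge crosses. The bound is [polar] with [travel] in place
    of [gap], up to the factor 4. *)
Lemma crossing_le u v :
  crossing u v <= 4 * ((rad u - rad v) ^+ 2 + rad u * rad v * travel u v).
Proof.
have r0 := rad_ge0 G; have s0 := soft_ge0; have s1 := soft_le1.
have X0 : 0 <= (rad u - rad v) ^+ 2 + rad u * rad v * travel u v.
  by rewrite addr_ge0 ?sqr_ge0 // mulr_ge0 ?travel_ge0 // mulr_ge0.
rewrite /crossing; case: eqP => [kuv|/eqP kuv].
  apply: le_trans (_ : 2 * ((rad u - rad v) ^+ 2 + rad u * rad v * travel u v) <= _);
    last by lra.
  have h := soft_same kuv; rewrite /local.
  have [le|/ltW le] := leP (rad u) (rad v); first by apply: lip => //; rewrite s0 s1.
  have := @lip (rad v) (rad u) (soft v) (soft u) (travel u v) (r0 v) le.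
  rewrite s0 s1 (sqr_subC (soft v)) (sqr_subC (rad v * soft v)) (sqr_subC (rad v)).
  by rewrite (mulrC (rad v) (rad u)) => -> //.
have side (a b x z : R) : 0 <= a -> 0 <= b -> 0 <= x <= 1 -> x ^+ 2 <= z -> (a * x) ^+ 2 <=
    2 * ((a - b) ^+ 2 + a * b * z).
  move=> a0 b0 /andP[x0 x1] h; have z0 : 0 <= z by apply: le_trans h; exact: sqr_ge0.
  have [le|/ltW le] := leP a b.
    have := @lip a b x 0 z a0 le; rewrite lexx ler01 !subr0 mulr0 subr0 => -> //.
  have h1 : b ^+ 2 * x ^+ 2 <= a * b * z.
    by apply: ler_pM => //; rewrite ?sqr_ge0 // expr2; apply: ler_wpM2r.
  have h2 : (a - b) ^+ 2 * x ^+ 2 <= (a - b) ^+ 2.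
    by rewrite ler_piMr ?sqr_ge0 // expr_le1.
  have -> : (a * x) ^+ 2 = 2 * (b ^+ 2 * x ^+ 2) +
     2 * ((a - b) ^+ 2 * x ^+ 2) - ((a - b) * x - b * x) ^+ 2 by ring.
  by have := sqr_ge0 ((a - b) * x - b * x); lra.
have h1 := side (rad u) (rad v) (soft u) (travel u v) (r0 u) (r0 v).
have h2 := side (rad v) (rad u) (soft v) (travel u v) (r0 v) (r0 u).
move: h1 h2; rewrite !s0 !s1 (sqr_subC (rad v)) (mulrC (rad v) (rad u)) => h1 h2.
have := h1 isT (soft_diff kuv); have := h2 isT; rewrite travelC => h3.
have := h3 (soft_diff (_ : key v != key u)); rewrite eq_sym => h4.
by have := h4 kuv; rewrite travelC /local; lra.
Qed.

Variable delta : R.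
Hypotheses (delta_gt0 : 0 < delta) (sc_gt0 : 0 < sc).
Hypothesis q_sc : q%:R ^+ 2 <= sc ^+ 2 * (delta / 4).

Lemma same_key_near u v : key u = key v -> all (fun e => near G delta e u v) S.
Proof.
move=> kuv; apply/allP => e eS.
have := lt_le_trans (gcell_same q_gt0 (same_key kuv eS)) q_sc.
have -> : coord e u - coord e v = sc * (proj G e u - proj G e v) by rewrite /coord; ring.
by rewrite exprMn ltr_pM2l ?exprn_gt0.
Qed.

Hypothesis spread : forall c : T -> R,
  \sum_v d v * (\sum_t c t * G t v) ^+ 2 <= \sum_t c t ^+ 2.

Let dotp u v : R := \sum_t dir G t u * dir G t v.

(** The hypothesis [spread] in the direction of [v]: no single direction carries mass more than
    1. *)
Lemma sum_weight_dotp v : \sum_u weight u * dotp u v ^+ 2 <= 1.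
Proof.
apply: le_trans (sum_dir_le1 G v); apply: le_trans (spread (dir G ^~ v)).
rewrite le_eqVlt; apply/orP; left; apply/eqP; apply: eq_bigr => u _.
rewrite -mulrA; congr (_ * _); rewrite -rad_sqr -exprMn; congr (_ ^+ 2).
by rewrite mulr_sumr; apply: eq_bigr => s _; rewrite mulrA rad_dir mulrC.
Qed.

(** If the directions in a cell nearly agree, then [dotp ^+ 2 >= 1 - delta], and [sum_weight_dotp]
    bounds [(1 - delta) * m ^+ 2] by [m]. Pairs whose directions differ more are counted in
    [collisions], because no row separates them. *)
Lemma cell_mass u0 (m := \sum_(v | key v == key u0) weight v) : delta <= 1 ->
  (1 - delta) * m ^+ 2 <= m + collisions d G delta S.
Proof.
move=> d1.
have W0 := weight_ge0 d_ge0 G.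
have m2 : m ^+ 2 = \sum_(v | key v == key u0) \sum_(u | key u == key u0) weight u * weight v.
  by rewrite expr2 mulr_sumr; apply: eq_bigr => v _; rewrite mulr_suml.
rewrite m2 mulr_sumr.
apply: le_trans (_ : \sum_(v | key v == key u0) \sum_(u | key u == key u0)
   (weight v * (weight u * dotp u v ^+ 2) + far_pair d G delta u v) <= _).
  apply: ler_sum => v _; rewrite mulr_sumr; apply: ler_sum => u _.
  have P0 : 0 <= weight u * weight v by rewrite mulr_ge0.
  have -> : weight v * (weight u * dotp u v ^+ 2) = weight u * weight v * dotp u v ^+ 2.
    by ring.
  have W z : rad z = 0 -> weight z = 0 by move=> rz; rewrite /weight -rad_sqr rz expr0n mulr0.
  have [/W wu|ru] := eqVneq (rad u) 0; first by rewrite /far_pair wu !(mul0r, mulr0, addr0).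
  have [/W wv|rv] := eqVneq (rad v) 0; first by rewrite /far_pair wv !(mul0r, mulr0, addr0).
  rewrite /far_pair -mulrDr mulrC; apply: ler_wpM2l => //.
  have [_|close] := leP delta (gap G u v); rewrite ?mulr1n ?addr0.
    by move: (sqr_ge0 (dotp u v)) delta_gt0; lra.
  have unit z : rad z != 0 -> \sum_s dir G s z ^+ 2 = 1.
    by move=> rz; apply: (mulfI rz); rewrite sum_dir mulr1.
  have := gapE G u v; rewrite !unit // -/(dotp u v) => g.
  have -> : dotp u v = 1 - gap G u v / 2 by lra.
  by have := sqr_ge0 (gap G u v); rewrite sqrrB; lra.
under eq_bigr => v _ do rewrite big_split /=.
rewrite big_split /=; apply: lerD.
  apply: ler_sum => v _; rewrite -mulr_sumr ler_piMr //.
  apply: le_trans (sum_weight_dotp v); rewrite big_mkcond; apply: ler_sum => u _.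
  by case: ifP => // _; rewrite mulr_ge0 ?sqr_ge0.
have F0 := far_pair_ge0 d_ge0 G delta.
rewrite /collisions exchange_big [leRHS](bigID (fun v => key v == key u0)) /=.
rewrite ler_wpDr //.
  by apply: sumr_ge0 => v _; apply: sumr_ge0 => u _; rewrite mulr_ge0.
apply: ler_sum => u /eqP ku.
rewrite [leRHS](bigID (fun v => key v == key u0)) /= ler_wpDr //.
  by apply: sumr_ge0 => v _; rewrite mulr_ge0.
apply: ler_sum => v /eqP kv; rewrite same_key_near ?mulr1 //.
by rewrite ku kv.
Qed.

End Clusters.

Section Localization.
Variables (R : realType) (V T : finType) (w : V -> V -> R) (d : V -> R).
Hypotheses (w_ge0 : forall u v, 0 <= w u v) (d_ge0 : forall v, 0 <= d v).
Variable G : T -> V -> R.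
Hypothesis spread : forall c : T -> R,
  \sum_v d v * (\sum_t c t * G t v) ^+ 2 <= \sum_t c t ^+ 2.

Local Notation M := (\sum_v weight d G v).

(** Each row spoils at most 2 of the [N * size S] shifts at a given vertex, so that the average
    proportion of spoiled mass is at most [2 / N <= rho]. *)
Lemma good_shift (S : seq {ffun T -> bool}) (N : nat) (rho sc : R) :
  0 < M -> (0 < N * size S)%N -> 2 <= rho * N%:R ->
  exists t : nat, (1 - rho) * M <=
    \sum_v weight d G v * soft G S (N * size S) sc t v ^+ 2.
Proof.
move=> M0 q0 hN; set q := (N * size S)%N.
pose loss (t : nat) : R := \sum_v weight d G v * (soft G S q sc t v < 1)%R%:R.
have W0 := weight_ge0 d_ge0 G.
have tot : \sum_(t < q) loss t <= 2 * (size S)%:R * M.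
  rewrite exchange_big mulr_sumr; apply: ler_sum => v _ /=.
  rewrite -mulr_sumr mulrC; apply: ler_wpM2r => //.
  apply: le_trans (_ : \sum_(t < q) \sum_(e <- S) (bump q (coord G sc t e v) < 1)%R%:R <= _).
    by apply: ler_sum => t _; exact: soft_lt1.
  rewrite exchange_big /=.
  apply: le_trans (_ : \sum_(e <- S) 2 <= _).
    by apply: ler_sum => e _; exact: bump_shift.
  by rewrite big_const_seq count_predT iter_addr_0 mulr_natr.
have [t ht] : exists t : 'I_q, loss t <= rho * M.
  apply/existsP; apply: contraT; rewrite negb_exists => /forallP h.
  have : \sum_(t < q) rho * M < \sum_(t < q) loss t.
    apply: ltr_sum => [|t _]; last by rewrite ltNge.
    by apply/hasP; exists (Ordinal q0); rewrite ?mem_index_enum.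
  rewrite sumr_const card_ord -mulr_natr => /lt_le_trans/(_ tot).
  rewrite -mulrA (mulrC M) mulrA ltr_pM2r // /q natrM mulrA ltNge => /negP[].
  by apply: ler_wpM2r.
exists t; apply: le_trans (_ : M - loss t <= _); first by lra.
rewrite -sumrB; apply: ler_sum => v _; rewrite -[X in X - _]mulr1 -mulrBr.
apply: ler_wpM2l => //; have s1 := soft_le1 G S q sc t v.
move: s1; rewrite le_eqVlt => /orP[/eqP->|->]; first by rewrite ltxx expr1n subr0.
by rewrite subrr sqr_ge0.
Qed.

Lemma cell_bound (S : seq {ffun T -> bool}) (q : nat) (sc rho : R) (t : nat) u :
  (0 < q)%N -> 0 < rho -> rho <= 1 / 2 -> 0 < sc ->
  q%:R ^+ 2 <= sc ^+ 2 * (rho / 4 / 4) -> collisions d G (rho / 4) S <= rho / 4 ->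
  \sum_(v | key G S q sc t v == key G S q sc t u) weight d G v <= 1 + rho.
Proof.
move=> q0 r0 r1 sc0 hq hS.
have r40 : 0 < rho / 4 by lra.
have r41 : rho / 4 <= 1 by lra.
have := @cell_mass _ _ _ d d_ge0 G S q sc t q0 (rho / 4) r40 sc0 hq spread u r41.
set m := \sum_(v | _) _ => h.
rewrite leNgt; apply/negP => mb.
have m1 : 1 < m by lra.
have : (1 - rho / 4) * m ^+ 2 <= m * (1 + rho / 4).
  have : rho / 4 <= m * (rho / 4) by rewrite ler_peMl ?ltW.
  by lra.
rewrite expr2 mulrCA ler_pM2l; last by lra.
have : (1 - rho / 4) * (1 + rho) < (1 - rho / 4) * m by rewrite ltr_pM2l //; lra.
have : 0 <= rho * (1 / 2 - rho) by apply: mulr_ge0; lra.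
by lra.
Qed.

(** The number of functions comes from mass: cells weigh at most [1 + rho], so grouping yields
    nearly [M] groups of weight at least 1/2. The factor [h ^ 3] is [sc ^ 2], of order [(N h) ^ 2],
    times the total stretch of [h] rows. *)
Lemma localization (h N : nat) (rho L : R) :
  (0 < h)%N -> 0 < rho -> rho <= 1 / 2 -> 2 <= rho * N%:R -> 0 < L -> 0 < M ->
  \sum_t energy w (G t) <= L * M -> (4 / 5) ^+ h * M ^+ 2 <= rho / 8 ->
  exists (n : nat) (g : 'I_n -> V -> R),
  [/\ (1 - 4 * rho) * M - 1 / 2 <= n%:R,
      forall l, 0 < mass d (g l),
      forall l, energy w (g l) <=
        8 * (1 + 32 * N%:R ^+ 2 / rho) / rho * h%:R ^+ 3 * L * mass d (g l),
      forall l l' v, l != l' -> g l v = 0 \/ g l' v = 0 &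
      forall l v, (forall t, G t v = 0) -> g l v = 0].
Proof.
move=> h0 r0 r1 hN L0 M0 GE hh.
have W0 := weight_ge0 d_ge0 G.
have N0 : (0 < N)%N.
  by rewrite lt0n; apply: contraTneq hN => ->; rewrite mulr0 -ltNge.
pose E0 := \sum_u \sum_v w u v * (rad G u - rad G v) ^+ 2.
have E0_ge0 : 0 <= E0.
  by apply: sumr_ge0 => u _; apply: sumr_ge0 => v _; rewrite mulr_ge0 ?sqr_ge0.
have E1_ge0 : 0 <= spread_energy w G.
  apply: sumr_ge0 => u _; apply: sumr_ge0 => v _.
  by rewrite mulr_ge0 // mulr_ge0 ?gap_ge0 // mulr_ge0 ?rad_ge0.
have EE : E0 + spread_energy w G <= L * M.
  apply: le_trans GE; rewrite /energy -sum_edges_sum /spread_energy /E0 -sum_edgesD.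
  by apply: ler_sum_edges => // u v; rewrite polar.
have LM0 : 0 < L * M by rewrite mulr_gt0.
have hR : 1 <= h%:R :> R by rewrite ler1n.
have hLM : 0 < h%:R * (L * M) by rewrite mulr_gt0 // ltr0n.
(* This choice makes each of the two terms of [sign_rows] at most [rho / 8], which bounds the
   collisions by [rho / 4] and the stretch by twice its mean. *)
pose beta := rho / 8 / (h%:R * (L * M)).
have b0 : 0 < beta by rewrite divr_gt0 //; lra.
have [|S [Sh hS]] := @sign_rows R V T w d d_ge0 G (rho / 4) _ h beta (ltW b0).
  by lra.
have bE : beta * h%:R * spread_energy w G <= rho / 8.
  have : beta * (h%:R * spread_energy w G) <= beta * (h%:R * (L * M)).
    by rewrite !ler_pM2l ?ltr0n //; lra.
  by rewrite mulrA /beta divfK // gt_eqF.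
have st0 : 0 <= \sum_(e <- S) stretch w G e by apply: sumr_ge0 => e _; exact: stretch_ge0.
have co0 := collisions_ge0 d_ge0 G (rho / 4) S.
have coll : collisions d G (rho / 4) S <= rho / 4.
  by have := mulr_ge0 (ltW b0) st0; lra.
have str : \sum_(e <- S) stretch w G e <= 2 * h%:R * (L * M).
  rewrite -(ler_pM2l b0).
  have -> : beta * (2 * h%:R * (L * M)) = rho / 4.
    by rewrite /beta; field; rewrite !gt_eqF // ltr0n.
  by lra.
have q0 : (0 < N * h)%N by rewrite muln_gt0 N0.
(* The smallest scale at which two points of one cell are near in every row. *)
pose sc := Num.sqrt (16 * (N * h)%:R ^+ 2 / rho).
have sc2 : sc ^+ 2 = 16 * (N * h)%:R ^+ 2 / rho.
  by rewrite sqr_sqrtr // divr_ge0 ?mulr_ge0 ?sqr_ge0 // ltW.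
have sc0 : 0 < sc by rewrite sqrtr_gt0 divr_gt0 // mulr_gt0 // exprn_gt0 // ltr0n.
have hq : (N * h)%:R ^+ 2 <= sc ^+ 2 * (rho / 4 / 4).
  rewrite sc2 le_eqVlt; apply/orP; left; apply/eqP; field; lra.
have [|t ht] := @good_shift S N rho sc M0 _ hN; first by rewrite Sh.
rewrite Sh in ht; set q := (N * h)%N in q0 sc sc2 sc0 hq ht.
pose cell v := [set u | key G S q sc t u == key G S q sc t v].
have cellE u v : (cell u == cell v) = (key G S q sc t u == key G S q sc t v).
  apply/eqP/eqP => [e|e]; last by apply/setP => z; rewrite !inE e.
  by apply/eqP; have : u \in cell u by [rewrite inE]; rewrite e inE.
(* The weights are indexed by all vertex sets; a set that is not a cell has weight 0. *)
pose a (c : {set V}) := \sum_(v | cell v == c) weight d G v * soft G S q sc t v ^+ 2.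
have s01 v : 0 <= soft G S q sc t v ^+ 2 <= 1.
  by rewrite sqr_ge0 expr_le1 ?soft_ge0 ?soft_le1.
have wsoft v : 0 <= weight d G v * soft G S q sc t v ^+ 2.
  by rewrite mulr_ge0 ?sqr_ge0.
have a0 c : 0 <= a c by apply: sumr_ge0.
have ab c : a c <= 1 + rho.
  have [u /eqP uc|none] := pickP (fun u => cell u == c); last first.
    by rewrite /a big_pred0 // addr_ge0 // ltW.
  apply: le_trans (cell_bound t u q0 r0 r1 sc0 hq coll).
  rewrite /a -uc (eq_bigl _ _ (fun v => cellE v u)); apply: ler_sum => v _.
  by have /andP[_ ?] := s01 v; rewrite ler_piMr.
have b1 : 1 <= 1 + rho by rewrite lerDl ltW.
have [n [lab [hlab hn]]] := grouping a0 ab b1.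
pose g (l : 'I_n) v := if lab (cell v) == l then local G S q sc t v else 0.
have gm l : 1 / 2 <= mass d (g l).
  apply: le_trans (hlab l (ltn_ord l)) _; rewrite /a.
  rewrite (exchange_big_dep predT) //= le_eqVlt; apply/orP; left; apply/eqP.
  apply: eq_bigr => v _; rewrite /g; case: ifP => hv.
    rewrite (big_pred1 (cell v)) ?exprMn ?rad_sqr ?mulrA // => c /=.
    rewrite (eq_sym (cell v)); case: (eqVneq c (cell v)) => [->|_]; last by rewrite andbF.
    by rewrite hv.
  rewrite expr0n mulr0 big1 // => c /andP[/eqP lc /eqP vc].
  by move: hv; rewrite vc lc eqxx.
have atot : (1 - rho) * M <= \sum_c a c.
  by apply: le_trans ht _; rewrite (partition_big cell predT).
have other k (ln : (k < n)%N) (l : 'I_n) : l != Ordinal ln -> (k == l) = false.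
  by move=> ne; apply: contraNF ne => /eqP kl; apply/eqP/val_inj.
have gE : \sum_l energy w (g l) <= 4 * (L * M * (h%:R ^+ 3 * (1 + 32 * N%:R ^+ 2 / rho))).
  apply: le_trans (_ : \sum_u \sum_v w u v * crossing G S q sc t u v <= _).
    rewrite /energy -sum_edges_sum; apply: ler_sum_edges => // u v.
    rewrite /crossing -cellE; case: eqP => [uv|uv].
      rewrite /g uv; case: (ltnP (lab (cell v)) n) => ln.
        rewrite (bigD1 (Ordinal ln)) //= eqxx big1 ?addr0 // => l.
        by move=> /(other _ ln) ->; rewrite subrr expr0n.
      rewrite big1 ?sqr_ge0 // => l _; rewrite gtn_eqF ?subrr ?expr0n //.
      exact: leq_trans (ltn_ord l) ln.
    apply: le_trans (_ : \sum_l (g l u ^+ 2 + g l v ^+ 2) <= _).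
      apply: ler_sum => l _.
      have l0 z : 0 <= g l z.
        by rewrite /g; case: ifP => // _; rewrite mulr_ge0 ?rad_ge0 ?soft_ge0.
      exact: sqr_sub_le.
    have one z : \sum_l g l z ^+ 2 <= local G S q sc t z ^+ 2.
      case: (ltnP (lab (cell z)) n) => ln.
        rewrite (bigD1 (Ordinal ln)) //= /g /= eqxx big1 ?addr0 // => l.
        by move=> /(other _ ln) ->; rewrite expr0n.
      rewrite big1 ?sqr_ge0 // => l _; rewrite /g gtn_eqF ?expr0n //.
      exact: leq_trans (ltn_ord l) ln.
    by rewrite big_split /= lerD.
  apply: le_trans (ler_sum_edges w_ge0 (crossing_le G S sc t q0)) _.
  rewrite sum_edgesZ sum_edgesD -/E0 ler_pM2l //.
  have -> : \sum_u \sum_v w u v * (rad G u * rad G v * travel G S sc u v) =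
      sc ^+ 2 * \sum_(e <- S) stretch w G e.
    rewrite -sum_edges_sum -sum_edgesZ; apply: eq_bigr => u _; apply: eq_bigr => v _.
    by rewrite /travel -mulr_sumr; ring.
  have h1 : sc ^+ 2 * \sum_(e <- S) stretch w G e <= sc ^+ 2 * (2 * h%:R * (L * M)).
    by rewrite ler_pM2l // exprn_gt0.
  have h2 : sc ^+ 2 * (2 * h%:R * (L * M)) = L * M * (h%:R ^+ 3 * (32 * N%:R ^+ 2 / rho)).
    by rewrite sc2 /q natrM; field; rewrite !gt_eqF ?ltr0n.
  have h3 : L * M <= L * M * h%:R ^+ 3.
    by rewrite ler_peMr ?(ltW LM0) // exprn_ege1.
  rewrite mulrDr mulr1 mulrDr; lra.
pose C := 8 * (1 + 32 * N%:R ^+ 2 / rho) / rho * h%:R ^+ 3 * L.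
have C0 : 0 < C.
  rewrite /C mulr_gt0 // mulr_gt0 // ?exprn_gt0 ?ltr0n // divr_gt0 // mulr_gt0 //.
  by rewrite ltr_pwDl // divr_ge0 ?(ltW r0) // mulr_ge0 ?sqr_ge0.
(* Markov's inequality: a bad function has energy above [C / 2], as its mass is at least 1/2, so
   there are at most [rho * M] of them. *)
pose good := [set l : 'I_n | energy w (g l) <= C * mass d (g l)].
have badle : #|~: good|%:R <= rho * M.
  have : #|~: good|%:R * (C / 2) <= C / 2 * (rho * M).
    have -> : C / 2 * (rho * M) = 4 * (L * M * (h%:R ^+ 3 * (1 + 32 * N%:R ^+ 2 / rho))).
      by rewrite /C; field; rewrite gt_eqF.
    apply: le_trans gE; rewrite mulr_natl -sumr_const [leRHS](bigID (mem (~: good))) /=.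
    apply: ler_wpDr; first by apply: sumr_ge0 => l _; exact: energy_ge0.
    apply: ler_sum => l; rewrite !inE -ltNge => /ltW; apply: le_trans.
    by rewrite ler_pM2l // -div1r.
  by rewrite mulrC ler_pM2l // divr_gt0.
exists #|good|, (fun i => g (enum_val i)); split.
- have : n%:R = #|good|%:R + #|~: good|%:R :> R by rewrite -natrD cardsC card_ord.
  have := le_trans atot hn.
  move: badle; move: #|good|%:R #|~: good|%:R n%:R => x y z hy hz ez.
  have rM : 0 < rho * M by rewrite mulr_gt0.
  have [zM|Mz] := leP z M.
    have : z * rho <= M * rho by rewrite ler_pM2r.
    by lra.
  by lra.
- by move=> l; apply: lt_le_trans (gm _); rewrite divr_gt0.
- by move=> l; have := enum_valP l; rewrite inE.
- move=> l l' v ll; rewrite /g; case: eqP => [e|]; last by left.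
  case: eqP => [e'|]; last by right.
  case/eqP: ll; apply: enum_val_inj; apply: val_inj; exact: etrans (esym e) e'.
- move=> l v G0; rewrite /g; case: ifP => // _.
  rewrite /local /rad (_ : sqnorm G v = 0) ?sqrtr0 ?mul0r //.
  by apply: big1 => s _; rewrite G0 expr0n.
Qed.

End Localization.

(** * Splitting a function in two *)

(** If no value of [y] served as [a], each vertex would have little mass below it or little mass at
    distance [r] above it. The former vertices have total mass at most [c / 4], as seen from the
    highest of them; the latter contribute at most [c / 4] pairs, and [c / 2 < c]. *)
Lemma balanced_levels (R : realType) (V : finType) (nu y : V -> R) (r c : R) :
  (forall v, 0 <= nu v) -> \sum_v nu v <= 1 -> 0 < c ->
  c <= \sum_u \sum_v nu u * nu v * (y v + r <= y u)%R%:R ->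
  exists a, c / 4 <= \sum_(v | y v <= a) nu v /\ c / 4 <= \sum_(v | a + r <= y v) nu v.
Proof.
move=> nu0 nu1 c0 hc.
pose lo a := \sum_(v | y v <= a) nu v; pose hi a := \sum_(v | a + r <= y v) nu v.
have [v0 /andP[h1 h2]|none] := pickP (fun v => (c / 4 <= lo (y v)) && (c / 4 <= hi (y v))).
  by exists (y v0).
have hi1 a : 0 <= hi a <= 1.
  rewrite sumr_ge0 //=; apply: le_trans nu1; rewrite [leRHS](bigID (fun v => a + r <= y v)) /=.
  by rewrite lerDl sumr_ge0.
have hE : \sum_u \sum_v nu u * nu v * (y v + r <= y u)%R%:R = \sum_v nu v * hi (y v).
  rewrite exchange_big; apply: eq_bigr => v _; rewrite mulr_sumr [RHS]big_mkcond /=.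
  by apply: eq_bigr => u _; case: ifP => _; rewrite ?mulr0 // mulr1 mulrC.
have small : \sum_(v | lo (y v) < c / 4) nu v <= c / 4.
  have [v1 hv1|no] := pickP (fun v => lo (y v) < c / 4); last by rewrite big_pred0 // ltW; lra.
  have [v2 h2 hmax] := @Order.TotalTheory.arg_maxP _ _ _ v1 (fun v => lo (y v) < c / 4) y hv1.
  apply: le_trans (ltW h2); rewrite /lo [leRHS](bigID (fun v => lo (y v) < c / 4)) /=.
  rewrite -[leLHS]addr0; apply: lerD; last by apply: sumr_ge0.
  rewrite le_eqVlt; apply/orP; left; apply/eqP; apply: eq_bigl => v.
  case: (boolP (lo (y v) < c / 4)) => [lv|]; last by rewrite andbF.
  by rewrite andbT; apply/esym; exact: hmax.
have : \sum_v nu v * hi (y v) <= c / 4 + c / 4.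
  rewrite (bigID (fun v => lo (y v) < c / 4)) /=; apply: lerD.
    apply: le_trans small; apply: ler_sum => v _.
    by have /andP[_ ?] := hi1 (y v); rewrite ler_piMr.
  apply: le_trans (_ : \sum_(v | ~~ (lo (y v) < c / 4)) nu v * (c / 4) <= _).
    apply: ler_sum => v lov; apply: ler_wpM2l => //.
    by have := none v; rewrite /= leNgt lov /= leNgt => /negbFE/ltW.
  rewrite -mulr_suml -[leRHS]mul1r; apply: ler_wpM2r; first by lra.
  apply: le_trans nu1; rewrite [leRHS](bigID (fun v => lo (y v) < c / 4)) /=.
  by rewrite lerDr; apply: sumr_ge0.
by rewrite -hE => h; exfalso; lra.
Qed.

Section RandomProjection.
Variables (R : realType) (V T : finType) (w : V -> V -> R) (nu : V -> R).
Variables (z Y : T -> V -> R) (near : V -> V -> R) (K2 L tau c : R).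
Hypotheses (nu_ge0 : forall v, 0 <= nu v) (nu_le1 : \sum_v nu v <= 1).
Hypotheses (w_ge0 : forall u v, 0 <= w u v) (near_ge0 : forall u v, 0 <= near u v).
Hypothesis z_le : forall v, nu v != 0 -> \sum_t z t v ^+ 2 <= K2.
Hypotheses (L_gt0 : 0 < L) (tau_gt0 : 0 < tau) (K2_gt0 : 0 < K2) (c_gt0 : 0 < c).
Hypothesis Y_energy :
  \sum_u \sum_v w u v * (near u v * \sum_t (Y t u - Y t v) ^+ 2) <= L * tau.
Hypothesis z_mass : \sum_v nu v * \sum_t z t v ^+ 2 <= tau.

Let Q0 := \sum_u \sum_v nu u * nu v * \sum_t (z t u - z t v) ^+ 2.
Hypothesis variance : c * tau <= Q0.

Local Notation p e v := (signed e (z ^~ v)).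
Local Notation y e v := (signed e (Y ^~ v)).

Let Q e := \sum_u \sum_v nu u * nu v * (p e u - p e v) ^+ 2.
Let R4 e := \sum_u \sum_v nu u * nu v * (p e u - p e v) ^+ 4.
Let En e := \sum_u \sum_v w u v * (near u v * (y e u - y e v) ^+ 2).
Let Z e := \sum_v nu v * p e v ^+ 2.

Let Q0_gt0 : 0 < Q0.
Proof. by apply: lt_le_trans variance; rewrite mulr_gt0. Qed.

Let avgQ : avg Q = Q0.
Proof.
rewrite avg_sum; apply: eq_bigr => u _; rewrite avg_sum; apply: eq_bigr => v _.
by rewrite avgZ -avg_signed2; congr (_ * _); apply: eq_avg => e; rewrite -signedB.
Qed.

Let avgR4 : avg R4 <= 12 * K2 * Q0.
Proof.
rewrite avg_sum mulr_sumr; apply: ler_sum => u _; rewrite avg_sum mulr_sumr.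
apply: ler_sum => v _; rewrite avgZ.
have [->|nu0] := eqVneq (nu u) 0; first by rewrite !mul0r mulr0.
have [->|nv0] := eqVneq (nu v) 0; first by rewrite !(mulr0, mul0r).
rewrite [leRHS]mulrCA; apply: ler_wpM2l; first by rewrite mulr_ge0.
rewrite (eq_avg (G := fun e => signed e (fun t => z t u - z t v) ^+ 4)); last first.
  by move=> e; rewrite -signedB.
apply: le_trans (avg_signed4 _) _.
have S0 : 0 <= \sum_t (z t u - z t v) ^+ 2 by apply: sumr_ge0 => t _; exact: sqr_ge0.
have S1 : \sum_t (z t u - z t v) ^+ 2 <= 4 * K2.
  apply: le_trans (_ : \sum_t (2 * z t u ^+ 2 + 2 * z t v ^+ 2) <= _).
    apply: ler_sum => t _; have := sqr_ge0 (z t u + z t v).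
    by rewrite sqrrD sqrrB !mulr2n; lra.
  by rewrite big_split /= -!mulr_sumr; have := z_le nu0; have := z_le nv0; lra.
rewrite expr2 mulrA; apply: ler_wpM2r => //; lra.
Qed.

Let avgEn : avg En <= L * tau.
Proof.
apply: le_trans Y_energy; rewrite avg_sum; apply: ler_sum => u _; rewrite avg_sum.
apply: ler_sum => v _; rewrite !avgZ -avg_signed2 le_eqVlt; apply/orP; left; apply/eqP.
by congr (_ * (_ * _)); apply: eq_avg => e; rewrite -signedB.
Qed.

Let avgZz : avg Z <= tau.
Proof.
apply: le_trans z_mass; rewrite avg_sum; apply: ler_sum => v _.
by rewrite avgZ -avg_signed2.
Qed.

(* Paley-Zygmund: the fourth moment [R4] prevents the variance from being
   carried by a few pairs only. *)
Lemma good_projection : exists (e : {ffun T -> bool}) (r a : R),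
  [/\ 0 < r, c * tau / 4 <= r ^+ 2, c * tau / (12288 * K2) <= \sum_(v | p e v <= a) nu v,
      c * tau / (12288 * K2) <= \sum_(v | a + r <= p e v) nu v &
      En e <= 256 * L * K2 / c /\ Z e <= 512 * K2 / c].
Proof.
(* The coefficients give the first three terms means of at most [Q0 / 4], [Q0 / 4] and [Q0 / 8], so
   that [3 / 8 * Q0] of the variance is left for a suitable [e]. *)
have [e he] := avg_ex_le (fun e => (48 * K2)^-1 * R4 e + Q0 / (4 * (L * tau)) * En e +
  Q0 / (8 * tau) * Z e + - 1 * Q e).
have K48 : 0 < (48 * K2)^-1 by rewrite invr_gt0 mulr_gt0.
have a1 : 0 < Q0 / (4 * (L * tau)) by rewrite divr_gt0 // !mulr_gt0.
have a2 : 0 < Q0 / (8 * tau) by rewrite divr_gt0 // mulr_gt0.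
have R40 : 0 <= R4 e.
  apply: sumr_ge0 => u _; apply: sumr_ge0 => v _.
  by rewrite mulr_ge0 ?exprn_even_ge0 // mulr_ge0.
have En0 : 0 <= En e.
  apply: sumr_ge0 => u _; apply: sumr_ge0 => v _.
  by rewrite mulr_ge0 // mulr_ge0 ?sqr_ge0.
have Z0 : 0 <= Z e by apply: sumr_ge0 => v _; rewrite mulr_ge0 ?sqr_ge0.
have key : (48 * K2)^-1 * R4 e + Q0 / (4 * (L * tau)) * En e +
    Q0 / (8 * tau) * Z e + 3 / 8 * Q0 <= Q e.
  move: he; rewrite !avgD !avgZ avgQ.
  have h1 : (48 * K2)^-1 * avg R4 <= Q0 / 4.
    have -> : Q0 / 4 = (48 * K2)^-1 * (12 * K2 * Q0) by field; rewrite gt_eqF.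
    by rewrite ler_pM2l.
  have h2 : Q0 / (4 * (L * tau)) * avg En <= Q0 / 4.
    have -> : Q0 / 4 = Q0 / (4 * (L * tau)) * (L * tau) by field; rewrite !gt_eqF.
    by rewrite ler_pM2l.
  have h3 : Q0 / (8 * tau) * avg Z <= Q0 / 8.
    have -> : Q0 / 8 = Q0 / (8 * tau) * tau by field; rewrite gt_eqF.
    by rewrite ler_pM2l.
  by lra.
have p1 := mulr_ge0 (ltW K48) R40.
have p2 := mulr_ge0 (ltW a1) En0.
have p3 := mulr_ge0 (ltW a2) Z0.
have hQ0 := Q0_gt0; have hv := variance.
(* Pairs closer than [r] contribute at most [Q0 / 4] to [Q e], less than the [3 / 8 * Q0]
   available. *)
pose r := Num.sqrt (Q0 / 4).
have r2 : r ^+ 2 = Q0 / 4 by rewrite sqr_sqrtr // ltW // divr_gt0.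
have r0 : 0 < r by rewrite sqrtr_gt0 divr_gt0.
pose far u v : R := (r ^+ 2 <= (p e u - p e v) ^+ 2)%R%:R.
pose P := \sum_u \sum_v nu u * nu v * far u v.
have tot : \sum_u \sum_v nu u * nu v <= 1.
  rewrite -(mul1r 1); under eq_bigr => u _ do rewrite -mulr_sumr.
  by rewrite -mulr_suml; apply: ler_pM => //; apply: sumr_ge0.
(* By [key], the fourth powers summed with this coefficient give at most [Q e / 4], so a far pair
   essentially counts for [48 * K2]. *)
have amgm x : x ^+ 2 <= (192 * K2)^-1 * x ^+ 4 + 48 * K2.
  have -> : x ^+ 4 = (x ^+ 2) ^+ 2 by ring.
  rewrite -subr_ge0; have K0 := K2_gt0.
  have -> : (192 * K2)^-1 * (x ^+ 2) ^+ 2 + 48 * K2 - x ^+ 2 =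
     (192 * K2)^-1 * (x ^+ 2 - 96 * K2) ^+ 2 by field; rewrite gt_eqF.
  by rewrite mulr_ge0 ?sqr_ge0 // invr_ge0 mulr_ge0 // ltW.
have R4Q : (192 * K2)^-1 * R4 e <= Q e / 4.
  have -> : (192 * K2)^-1 * R4 e = (48 * K2)^-1 * R4 e / 4 by field; rewrite gt_eqF.
  by lra.
have Qup : Q e <= 64 * K2.
  have : Q e <= (192 * K2)^-1 * R4 e + 48 * K2 * \sum_u \sum_v nu u * nu v.
    rewrite !mulr_sumr -big_split; apply: ler_sum => u _ /=.
    rewrite !mulr_sumr -big_split; apply: ler_sum => v _ /=.
    have := ler_wpM2l (mulr_ge0 (nu_ge0 u) (nu_ge0 v)) (amgm (p e u - p e v)).
    by rewrite mulrDr; lra.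
  have K0 := K2_gt0.
  have : 48 * K2 * (\sum_u \sum_v nu u * nu v) <= 48 * K2.
    by rewrite ler_piMr // mulr_ge0 // ltW.
  by lra.
have g1 : c * tau / 4 <= r ^+ 2 by rewrite r2; lra.
have g2 : En e <= 256 * L * K2 / c.
  rewrite ler_pdivlMr // -(ler_pM2r tau_gt0).
  have : Q0 / (4 * (L * tau)) * En e <= 64 * K2 by lra.
  rewrite mulrAC ler_pdivrMr ?mulr_gt0 // => h.
  have := ler_wpM2r En0 hv; lra.
have g3 : Z e <= 512 * K2 / c.
  rewrite ler_pdivlMr // -(ler_pM2r tau_gt0).
  have : Q0 / (8 * tau) * Z e <= 64 * K2 by lra.
  rewrite mulrAC ler_pdivrMr ?mulr_gt0 // => h.
  have := ler_wpM2r Z0 hv; lra.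
(* The constant 1536 here, 2 for ordering the pairs and 4 from [balanced_levels] make 12288. *)
have Pbig : Q0 / (1536 * K2) <= P.
  have : Q e <= Q0 / 4 * (\sum_u \sum_v nu u * nu v) + (192 * K2)^-1 * R4 e + 48 * K2 * P.
    rewrite !mulr_sumr -!big_split; apply: ler_sum => u _ /=.
    rewrite !mulr_sumr -!big_split; apply: ler_sum => v _ /=.
    have n0 := mulr_ge0 (nu_ge0 u) (nu_ge0 v); have K0 := K2_gt0.
    have x4 : 0 <= (192 * K2)^-1 * (p e u - p e v) ^+ 4.
      by apply: mulr_ge0; rewrite ?exprn_even_ge0 // invr_ge0 mulr_ge0 // ltW.
    have := amgm (p e u - p e v); rewrite /far r2; case: (leP (Q0 / 4)) => h hm.
      have := ler_wpM2l n0 hm; have := mulr_ge0 n0 (ltW hQ0).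
      by rewrite mulr1 mulrDr; lra.
    have := ler_wpM2l n0 (ltW h); have := mulr_ge0 n0 x4.
    by rewrite !mulr0 addr0; lra.
  have : Q0 / 4 * (\sum_u \sum_v nu u * nu v) <= Q0 / 4 by rewrite ler_piMr // divr_ge0 // ltW.
  rewrite ler_pdivrMr ?mulr_gt0 //; lra.
pose half := \sum_u \sum_v nu u * nu v * (p e v + r <= p e u)%R%:R.
have Phalf : P <= 2 * half.
  rewrite mulrDl mul1r [X in _ <= _ + X]exchange_big -big_split /=.
  apply: ler_sum => u _; rewrite -big_split; apply: ler_sum => v _ /=.
  rewrite (mulrC (nu v)) -mulrDr; apply: ler_wpM2l; first by rewrite mulr_ge0.
  rewrite /far -natrD ler_nat; case: (leP (r ^+ 2)) => // h.
  suff : (p e v + r <= p e u) || (p e u + r <= p e v).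
    by case: (p e v + r <= p e u) => //= ->.
  have [uv|vu] := leP (p e v) (p e u).
    by apply/orP; left; move: h; rewrite ler_sqr ?nnegrE ?subr_ge0 ?(ltW r0) // lerBrDl.
  apply/orP; right; move: h; rewrite sqr_subC ler_sqr ?nnegrE ?subr_ge0 ?(ltW r0) ?(ltW vu) //.
  by rewrite lerBrDl.
have c0 : 0 < c * tau / (3072 * K2) by rewrite divr_gt0 ?mulr_gt0.
have hhalf : c * tau / (3072 * K2) <= half.
  have : c * tau / (1536 * K2) <= Q0 / (1536 * K2) by rewrite ler_pM2r // invr_gt0 mulr_gt0.
  have -> : c * tau / (1536 * K2) = 2 * (c * tau / (3072 * K2)) by field; rewrite gt_eqF.
  by move=> h; rewrite -(ler_pM2l (ltr0n R 2)); exact: le_trans (le_trans h Pbig) Phalf.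
have [a [ha1 ha2]] := balanced_levels nu_ge0 nu_le1 c0 hhalf.
have eqc : c * tau / (3072 * K2) / 4 = c * tau / (12288 * K2) by field; rewrite gt_eqF.
by exists e, r, a; rewrite -eqc.
Qed.

End RandomProjection.

Section Splitting.
Variables (R : realType) (V T : finType) (w : V -> V -> R) (d : V -> R).
Hypotheses (w_ge0 : forall u v, 0 <= w u v) (d_ge0 : forall v, 0 <= d v).
Variables (f : V -> R) (Y : T -> V -> R).

Definition touch u v : R := ((f u != 0) || (f v != 0))%:R.

Definition local_energy : R :=
  \sum_u \sum_v w u v * (touch u v * \sum_t (Y t u - Y t v) ^+ 2).

Definition local_mass : R := \sum_(v | f v != 0) d v * sqnorm Y v.

Definition bulk (K2 : R) v : bool := (f v != 0) && (sqnorm Y v < K2 * f v ^+ 2).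

Definition bulk_mass K2 : R := \sum_(v | bulk K2 v) d v * sqnorm Y v.

(* Equal to [f] where the norm of [Y] is at most [K * f], and 0 where it is at
   least [2 * K * f]. *)
Definition cap (K : R) v : R := Num.max 0 (Num.min (f v) (2 * f v - rad Y v / K)).

Hypothesis f_ge0 : forall v, 0 <= f v.

Lemma touch_ge0 u v : 0 <= touch u v. Proof. exact: ler0n. Qed.

Lemma local_energy_ge0 : 0 <= local_energy.
Proof.
apply: sumr_ge0 => u _; apply: sumr_ge0 => v _; rewrite mulr_ge0 // mulr_ge0 ?touch_ge0 //.
by apply: sumr_ge0 => t _; exact: sqr_ge0.
Qed.

Lemma local_mass_ge0 : 0 <= local_mass.
Proof. by apply: sumr_ge0 => v _; rewrite mulr_ge0 ?sqnorm_ge0. Qed.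

Lemma cap_ge0 K v : 0 <= cap K v. Proof. by rewrite le_max lexx. Qed.

Lemma cap_le K v : cap K v <= f v.
Proof. by rewrite ge_max f_ge0 ge_min lexx. Qed.

Lemma cap_eq0 K v : f v = 0 -> cap K v = 0.
Proof. by move=> f0; apply: le_anti; rewrite cap_ge0 -{1}f0 cap_le. Qed.

Lemma cap_id K v : 0 < K -> sqnorm Y v <= K ^+ 2 * f v ^+ 2 -> cap K v = f v.
Proof.
move=> K0 h; have h1 : rad Y v <= K * f v.
  rewrite -ler_sqr ?nnegrE ?rad_ge0 ?mulr_ge0 ?(ltW K0) //.
  by rewrite rad_sqr exprMn.
rewrite /cap (min_idPl _) ?(max_idPr _) //.
by rewrite lerBrDr -lerBrDl ler_pdivrMr //; lra.
Qed.

Lemma cap_gt0 K v : 0 < K -> cap K v != 0 -> rad Y v < 2 * K * f v.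
Proof.
move=> K0; rewrite /cap; case: (ltP 0 (Num.min (f v) (2 * f v - rad Y v / K))) => [|_];
  last by rewrite eqxx.
rewrite lt_min => /andP[_]; rewrite subr_gt0 ltr_pdivrMr // => h _; lra.
Qed.

Lemma cap_edge K u v : 0 < K -> (cap K u - cap K v) ^+ 2 <=
  9 * (f u - f v) ^+ 2 + 2 / K ^+ 2 * (touch u v * \sum_t (Y t u - Y t v) ^+ 2).
Proof.
move=> K0; rewrite /touch; have [|] := boolP ((f u != 0) || (f v != 0)) => /= h; last first.
  have /andP[/eqP fu /eqP fv] : (f u == 0) && (f v == 0).
    by move: h; rewrite negb_or !negbK.
  by rewrite !cap_eq0 // fu fv subrr expr0n /= !(mulr0, mul0r, addr0).
rewrite mul1r; apply: le_trans (sqr_pos_sub _ _) _; apply: le_trans (sqr_min_sub _ _ _ _) _.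
have h1 := sqr_radB_le Y u v.
have h2 : 2 / K ^+ 2 * (rad Y u - rad Y v) ^+ 2 <= 2 / K ^+ 2 * \sum_t (Y t u - Y t v) ^+ 2.
  by apply: ler_wpM2l => //; rewrite divr_ge0 // sqr_ge0.
apply: le_trans (lerD (lexx _) h2).
rewrite -subr_ge0.
suff -> : forall a b x y : R, 9 * (a - b) ^+ 2 + 2 / K ^+ 2 * (x - y) ^+ 2 -
    ((a - b) ^+ 2 + (2 * a - x / K - (2 * b - y / K)) ^+ 2) =
  (2 * (a - b) + (x - y) / K) ^+ 2 by exact: sqr_ge0.
by move=> *; field; rewrite gt_eqF.
Qed.

Lemma cap_energy K : 0 < K ->
  energy w (cap K) <= 9 * energy w f + 2 / K ^+ 2 * local_energy.
Proof.
move=> K0; apply: le_trans (ler_sum_edges w_ge0 (fun u v => cap_edge u v K0)) _.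
by rewrite sum_edgesD !sum_edgesZ.
Qed.

Section Split.
Variables (rho B L tau : R).
Hypotheses (L_gt0 : 0 < L) (tau_gt0 : 0 < tau) (rho_gt0 : 0 < rho) (rho_le1 : rho <= 1).
Hypotheses (B_big : 4 <= rho * B) (f_mass : mass d f = 1) (f_energy : energy w f <= L).
Hypothesis orth : forall t, inner d f (Y t) = 0.
Hypotheses (mass_le : local_mass <= tau) (energy_le : local_energy <= L * tau).
Hypothesis spread_out : rho * tau < bulk_mass (B * tau).

Let K2 := B * tau.
(** On the bulk the quotient [z = Y / f] is bounded by the square root of [K2], and [f] has nearly
    all its mass there. To split [f] is to find a projection of [z] that is far from constant for
    the measure [nu]. *)
Let nu v : R := if bulk K2 v then d v * f v ^+ 2 else 0.
Let z t v := Y t v / f v.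

Let B_gt0 : 0 < B.
Proof.
rewrite -(pmulr_rgt0 _ rho_gt0); apply: lt_le_trans B_big; lra.
Qed.

Let K2_gt0 : 0 < K2. Proof. by rewrite mulr_gt0. Qed.

Let nu_ge0 v : 0 <= nu v.
Proof. by rewrite /nu; case: ifP => // _; rewrite mulr_ge0 ?sqr_ge0. Qed.

Let nuE t v : nu v * z t v = if bulk K2 v then d v * (f v * Y t v) else 0.
Proof.
rewrite /nu; case: ifP => [/andP[f0 _]|_]; last by rewrite mul0r.
by rewrite /z; field.
Qed.

Let zE v : bulk K2 v -> \sum_t z t v ^+ 2 = sqnorm Y v / f v ^+ 2.
Proof.
by move=> _; rewrite mulr_suml; apply: eq_bigr => t _; rewrite expr_div_n.
Qed.

Let nu_sum : \sum_v nu v <= 1.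
Proof.
rewrite -f_mass; apply: ler_sum => v _; rewrite /nu; case: ifP => // _.
by rewrite mulr_ge0 ?sqr_ge0.
Qed.

(** Chebyshev: outside the bulk [f ^+ 2] is at most [sqnorm Y / K2], whose total is at most
    [tau / K2 = 1 / B]. *)
Let outside : 1 - \sum_v nu v <= B^-1.
Proof.
rewrite -f_mass -sumrB.
have -> : B^-1 = K2^-1 * tau by rewrite /K2 invfM -mulrA mulVf ?mulr1 // gt_eqF.
apply: le_trans (_ : K2^-1 * local_mass <= _); last first.
  by rewrite ler_pM2l ?invr_gt0.
rewrite /local_mass mulr_sumr [leRHS]big_mkcond /=; apply: ler_sum => v _.
rewrite /nu /bulk; have [->|f0 /=] := eqVneq (f v) 0.
  by rewrite expr0n /= mulr0 subr0.
case: ltP => h /=; first by rewrite subrr !mulr_ge0 ?sqnorm_ge0 // invr_ge0 ltW.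
rewrite subr0 [leRHS]mulrCA; apply: ler_wpM2l => //.
by rewrite mulrC ler_pdivlMr // mulrC.
Qed.

Let nu_z : \sum_v nu v * \sum_t z t v ^+ 2 = bulk_mass K2.
Proof.
rewrite /bulk_mass [RHS]big_mkcond; apply: eq_bigr => v _.
rewrite {1}/nu; case: ifP => [bv|_]; last by rewrite mul0r.
by rewrite zE //; case/andP: bv => f0 _; field.
Qed.

(** As [f] is orthogonal to [Y], the integral of [f * Y] over the bulk is minus the one outside.
    Cauchy-Schwarz, as an arithmetic-geometric mean inequality with weight [B], bounds the latter
    since [f] has mass at most [1 / B] there. *)
Let mean_sqr : \sum_t (\sum_v nu v * z t v) ^+ 2 <= tau / B.
Proof.
pose mt t := \sum_v nu v * z t v; set m2 := \sum_t _.
pose out v := (f v != 0) && ~~ bulk K2 v.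
have mtE t : mt t = - \sum_(v | out v) d v * (f v * Y t v).
  have := orth t; rewrite /inner (bigID (bulk K2)) /= => h.
  rewrite /mt (eq_bigr _ (fun v _ => nuE t v)).
  have -> : \sum_(v | out v) d v * (f v * Y t v) =
      \sum_(v | ~~ bulk K2 v) d v * (f v * Y t v).
    rewrite [LHS]big_mkcond [RHS]big_mkcond; apply: eq_bigr => v _ /=.
    rewrite /out; case: (boolP (bulk K2 v)) => /=; rewrite ?andbF ?andbT // => _.
    by case: eqP => [->|]; rewrite ?mul0r ?mulr0.
  by rewrite -big_mkcond /=; apply/eqP; rewrite -addr_eq0 h.
have Bn := B_gt0.
have h1 : m2 <= B / 2 * (m2 * (1 - \sum_v nu v)) + (2 * B)^-1 * local_mass.
  have m2E : m2 = \sum_(v | out v) d v * (\sum_t - (mt t * (f v * Y t v))).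
    under [RHS]eq_bigr => v _ do rewrite mulr_sumr.
    rewrite exchange_big; apply: eq_bigr => t _; rewrite -/(mt t) expr2 {2}mtE.
    rewrite mulrN mulr_sumr -sumrN; apply: eq_bigr => v _; ring.
  rewrite {1}m2E.
  apply: le_trans (_ : \sum_(v | out v)
     (B / 2 * (m2 * (d v * f v ^+ 2)) + (2 * B)^-1 * (d v * sqnorm Y v)) <= _).
    apply: ler_sum => v _.
    have -> : B / 2 * (m2 * (d v * f v ^+ 2)) + (2 * B)^-1 * (d v * sqnorm Y v) =
       d v * \sum_t (B / 2 * (mt t ^+ 2 * f v ^+ 2) + (2 * B)^-1 * Y t v ^+ 2).
      rewrite big_split /= -!mulr_sumr -mulr_suml (_ : \sum_t mt t ^+ 2 = m2) // /sqnorm.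
      by ring.
    apply: ler_wpM2l => //; apply: ler_sum => t _; rewrite -subr_ge0.
    have -> : B / 2 * (mt t ^+ 2 * f v ^+ 2) + (2 * B)^-1 * Y t v ^+ 2 -
       - (mt t * (f v * Y t v)) = (2 * B)^-1 * (B * (mt t * f v) + Y t v) ^+ 2.
      by field; rewrite gt_eqF.
    by rewrite mulr_ge0 ?sqr_ge0 // invr_ge0 mulr_ge0 // ltW.
  rewrite big_split /= -!mulr_sumr; apply: lerD.
    apply: ler_wpM2l; first by rewrite divr_ge0 // ltW.
    apply: ler_wpM2l; first by apply: sumr_ge0 => t _; exact: sqr_ge0.
    rewrite -f_mass -sumrB [leLHS]big_mkcond; apply: ler_sum => v _ /=.
    rewrite /out /nu; case: (boolP (bulk K2 v)) => /= _; rewrite ?andbF ?andbT ?subrr // subr0.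
    by case: ifP => // _; rewrite mulr_ge0 ?sqr_ge0.
  apply: ler_wpM2l; first by rewrite invr_ge0 mulr_ge0 // ltW.
  rewrite /local_mass [leRHS](bigID (bulk K2)) /= -[leLHS]add0r; apply: lerD => //.
  by apply: sumr_ge0 => v _; rewrite mulr_ge0 ?sqnorm_ge0.
have m0 : 0 <= m2 by apply: sumr_ge0 => t _; exact: sqr_ge0.
have h2 : B / 2 * (m2 * (1 - \sum_v nu v)) <= m2 / 2.
  have -> : m2 / 2 = B / 2 * (m2 * B^-1) by field; rewrite gt_eqF.
  by apply: ler_wpM2l; [rewrite divr_ge0 // ltW|apply: ler_wpM2l].
have h3 : (2 * B)^-1 * local_mass <= (2 * B)^-1 * tau.
  by apply: ler_wpM2l => //; rewrite invr_ge0 mulr_ge0 // ltW.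
have -> : tau / B = 2 * ((2 * B)^-1 * tau) by field; rewrite gt_eqF.
by lra.
Qed.

(** Second moment minus squared mean: the former exceeds [rho * tau] by [spread_out], the latter is
    small by [mean_sqr]. Without orthogonality [z] could be constant. *)
Let variance :
  rho * tau <= \sum_u \sum_v nu u * nu v * \sum_t (z t u - z t v) ^+ 2.
Proof.
have -> : \sum_u \sum_v nu u * nu v * \sum_t (z t u - z t v) ^+ 2 =
   2 * ((\sum_v nu v) * bulk_mass K2) - 2 * \sum_t (\sum_v nu v * z t v) ^+ 2.
  rewrite -nu_z.
  transitivity (\sum_u \sum_v (nu u * (nu v * \sum_t z t v ^+ 2) +
     (nu u * \sum_t z t u ^+ 2) * nu v - 2 * \sum_t nu u * z t u * (nu v * z t v))).
    apply: eq_bigr => u _; apply: eq_bigr => v _.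
    rewrite !mulr_sumr mulr_suml -big_split -sumrB; apply: eq_bigr => t _ /=; ring.
  have sep (a b : V -> R) : \sum_u \sum_v a u * b v = (\sum_u a u) * \sum_v b v.
    by rewrite mulr_suml; apply: eq_bigr => u _; rewrite mulr_sumr.
  under eq_bigr => u _ do rewrite sumrB big_split /=.
  have -> : \sum_t (\sum_v nu v * z t v) ^+ 2 =
      \sum_u \sum_v \sum_t nu u * z t u * (nu v * z t v).
    under [RHS]eq_bigr => u _ do rewrite exchange_big /=.
    by rewrite exchange_big /=; apply: eq_bigr => t _; rewrite sep expr2.
  rewrite sumrB big_split /= !sep; congr (_ - _); first by ring.
  by rewrite mulr_sumr; apply: eq_bigr => u _; rewrite mulr_sumr.
have h1 := mean_sqr; have h2 := outside; have h3 := nu_sum; have hs := spread_out.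
rewrite -/K2 in hs; have Bn := B_gt0; have tn := tau_gt0; have rn := rho_gt0.
have h4 : B^-1 <= rho / 4.
  rewrite -(ler_pM2l Bn) mulfV ?gt_eqF // mulrA ler_pdivlMr // mul1r mulrC.
  exact: B_big.
have h5 : tau / B <= tau * (rho / 4) by rewrite ler_pM2l.
have h6 : (1 - rho / 4) * (rho * tau) <= (\sum_v nu v) * bulk_mass K2.
  have r1 := rho_le1; apply: ler_pM; [lra|by rewrite mulr_ge0 // ltW|lra|exact: ltW].
have h7 : rho * (rho * tau) <= rho * tau.
  by rewrite ler_piMl ?rho_le1 // mulr_ge0 // ltW.
have h8 : 0 <= rho * tau by rewrite mulr_ge0 // ltW.
by lra.
Qed.

(** The first factor is the inverse of the mass [c0] of each part. In the second, 9 and [2 / B] come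
    from the cap, the term with 256 from the projection of [Y], and the last from [mid ^+ 2]. *)
Definition split_const : R :=
  12288 * B / rho * (9 + 2 / B + 32 * B / rho * (256 / rho + 512 * 12288 * B / rho ^+ 2)).

Lemma splitting : exists g : bool -> V -> R,
  [/\ forall b, 0 < mass d (g b),
      forall b, energy w (g b) <= split_const * L * mass d (g b),
      forall v, g true v = 0 \/ g false v = 0 &
      forall b v, f v = 0 -> g b v = 0].
Proof.
have half_le (x : R) : 0 < x -> x / 2 <= x by lra.
have quarter_le (x y : R) : x / 4 <= y -> 8 * x <= 32 * y by lra.
have tn := tau_gt0; have rn := rho_gt0; have Bn := B_gt0; have Kn := K2_gt0.
have z_le v : nu v != 0 -> \sum_t z t v ^+ 2 <= K2.
  rewrite /nu; case: ifP => [bv _|]; last by rewrite eqxx.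
  rewrite zE //; case/andP: bv => f0 /ltW h; rewrite ler_pdivrMr ?exprn_gt0 //.
  by rewrite lt_neqAle eq_sym f0 f_ge0.
have z_mass : \sum_v nu v * \sum_t z t v ^+ 2 <= tau.
  rewrite nu_z; apply: le_trans mass_le; rewrite /bulk_mass /local_mass.
  rewrite [leLHS]big_mkcond [leRHS]big_mkcond; apply: ler_sum => v _ /=.
  by rewrite /bulk; case: (f v != 0) => //=; case: ifP => // _; rewrite mulr_ge0 ?sqnorm_ge0.
have [e [r [a [r0 r2 lo hi EZ]]]] := good_projection nu_ge0 nu_sum w_ge0 touch_ge0 z_le
  L_gt0 tau_gt0 K2_gt0 rho_gt0 energy_le z_mass variance.
pose c0 := rho / (12288 * B).
have c0_gt0 : 0 < c0 by rewrite divr_gt0 // mulr_gt0.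
have cE : rho * tau / (12288 * K2) = c0 by rewrite /c0 /K2; field; rewrite !gt_eqF.
rewrite cE in lo hi; clear cE.
pose p v : R := signed e (z ^~ v); pose y v : R := signed e (Y ^~ v).
have yp v : f v != 0 -> y v = f v * p v.
  move=> f0; rewrite /y /p -signedZ; apply: eq_bigr => t _; congr (_ * _).
  by rewrite /z; field.
pose mid := a + r / 2; pose K := Num.sqrt K2.
have K0 : 0 < K by rewrite sqrtr_gt0.
have KK : K ^+ 2 = K2 by rewrite sqr_sqrtr // ltW.
pose sg (b : bool) : R := if b then 1 else -1.
(* The cut is at [p = y / f = mid], but it is made with [y - mid * f], whose energy is under
   control. The slope [2 / r] lets it reach [f] on the bulk for [p <= a] or [p >= a + r]. *)
pose g b v := Num.min (cap K v) (Num.max 0 (sg b * (y v - mid * f v) * (2 / r))).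
have g_ge0 b v : 0 <= g b v by rewrite le_min cap_ge0 le_max lexx.
have r20 : 0 < 2 / r by rewrite divr_gt0.
have gf b v : f v = 0 -> g b v = 0.
  by move=> f0; apply: le_anti; rewrite g_ge0 /g cap_eq0 // ge_min lexx.
have gnu b v : (if b then a + r <= p v else p v <= a) -> nu v <= d v * g b v ^+ 2.
  rewrite /nu; case: (boolP (bulk K2 v)) => [bv hp|_ _]; last by rewrite mulr_ge0 ?sqr_ge0.
  case/andP: bv => f0 hb.
  have fp : 0 < f v by rewrite lt_neqAle eq_sym f0 f_ge0.
  have bE : cap K v = f v by apply: cap_id => //; rewrite KK ltW.
  suff -> : g b v = f v by [].
  rewrite /g bE (min_idPl _) // le_max; apply/orP; right.
  rewrite yp // (mulrC mid) -mulrBr.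
  have -> : sg b * (f v * (p v - mid)) * (2 / r) = f v * (sg b * (p v - mid) / (r / 2)).
    by field; rewrite gt_eqF.
  rewrite ler_peMr ?(ltW fp) // ler_pdivlMr ?mul1r ?divr_gt0 //.
  rewrite /sg /mid; case: b hp => hp; last by rewrite mulN1r opprB lerBrDr addrC lerD2r.
  by rewrite mul1r lerBrDr addrC -addrA -splitr.
have gm b : c0 <= mass d (g b).
  have sub (P : pred V) : c0 <= \sum_(v | P v) nu v ->
      (forall v, P v -> nu v <= d v * g b v ^+ 2) -> c0 <= mass d (g b).
    move=> hP hg; apply: le_trans hP _; rewrite big_mkcond; apply: ler_sum => v _.
    by case: ifP => [/hg|] // _; rewrite mulr_ge0 ?sqr_ge0.
  move: sub; case: b => sub; [apply: sub hi _|apply: sub lo _] => v hv.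
    exact: (gnu true).
  exact: (gnu false).
(* One of the two sides has [p ^+ 2 >= mid ^+ 2] throughout and [nu]-mass at least [c0], so the
   second moment of [p] bounds [mid]. *)
have mid2 : mid ^+ 2 <= 512 * K2 / rho / c0.
  rewrite ler_pdivlMr //; case: EZ => _; apply: le_trans.
  have sub (P : pred V) : c0 <= \sum_(v | P v) nu v ->
      (forall v, P v -> mid ^+ 2 <= p v ^+ 2) ->
      mid ^+ 2 * c0 <= \sum_v nu v * signed e (z^~ v) ^+ 2.
    move=> hP hg; apply: le_trans (_ : mid ^+ 2 * \sum_(v | P v) nu v <= _).
      by apply: ler_wpM2l => //; exact: sqr_ge0.
    rewrite mulr_sumr big_mkcond; apply: ler_sum => v _; case: ifP => [Pv|_].
      by rewrite mulrC; apply: ler_wpM2l => //; exact: hg.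
    by rewrite mulr_ge0 ?sqr_ge0.
  have [m0|/ltW m0] := leP 0 mid.
    apply: sub hi _ => v; rewrite -/(p v) => hv.
    have mp : mid <= p v by apply: le_trans hv; rewrite lerD2l half_le.
    by rewrite ler_sqr ?nnegrE // (le_trans m0 mp).
  apply: sub lo _ => v; rewrite -/(p v) => hv.
  have hm : - mid <= - p v by rewrite lerN2 (le_trans hv) // lerDl divr_ge0 // ltW.
  have m1 : 0 <= - mid by rewrite oppr_ge0.
  by rewrite -sqrrN -[leRHS]sqrrN ler_sqr ?nnegrE // (le_trans m1 hm).
pose En : R := \sum_u \sum_v w u v * (touch u v * (y u - y v) ^+ 2).
have gE b : energy w (g b) <= 9 * L + 2 / K ^+ 2 * (L * tau) + 2 * (2 / r) ^+ 2 * En +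
    2 * (2 / r) ^+ 2 * mid ^+ 2 * L.
  apply: le_trans (_ : \sum_u \sum_v w u v * ((9 * (f u - f v) ^+ 2 +
      2 / K ^+ 2 * (touch u v * \sum_t (Y t u - Y t v) ^+ 2)) +
      2 * (2 / r) ^+ 2 * (touch u v * (y u - y v) ^+ 2) +
      2 * (2 / r) ^+ 2 * mid ^+ 2 * (f u - f v) ^+ 2) <= _); last first.
    rewrite !sum_edgesD !sum_edgesZ -/En; apply: lerD; last first.
      by apply: ler_wpM2l => //; rewrite mulr_ge0 ?sqr_ge0 // mulr_ge0 // sqr_ge0.
    rewrite lerD2r; apply: lerD; first by apply: ler_wpM2l.
    by apply: ler_wpM2l => //; rewrite divr_ge0 // sqr_ge0.
  apply: ler_sum_edges => // u v.
  have hc := cap_edge u v K0.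
  have r22 : 0 <= 2 * (2 / r) ^+ 2 by rewrite mulr_ge0 ?sqr_ge0.
  have [nz|] := boolP ((f u != 0) || (f v != 0)); last first.
    rewrite negb_or !negbK => /andP[/eqP fu /eqP fv].
    rewrite !gf // subrr expr0n /= addr_ge0 //; last first.
      by apply: mulr_ge0; rewrite ?sqr_ge0 // mulr_ge0 // sqr_ge0.
    rewrite addr_ge0 ?(le_trans (sqr_ge0 _) hc) //.
    by apply: mulr_ge0 => //; rewrite mulr_ge0 ?touch_ge0 ?sqr_ge0.
  rewrite [X in _ + 2 * (2 / r) ^+ 2 * X + _](_ : _ = 1 * (y u - y v) ^+ 2); last first.
    by rewrite /touch nz.
  apply: le_trans (sqr_min_sub _ _ _ _) _; rewrite -addrA; apply: lerD => //.
  apply: le_trans (sqr_pos_sub _ _) _; rewrite mul1r.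
  have sg2 : sg b ^+ 2 = 1 by rewrite /sg; case: (b); rewrite ?sqrrN expr1n.
  rewrite -subr_ge0.
  have -> : 2 * (2 / r) ^+ 2 * (y u - y v) ^+ 2 + 2 * (2 / r) ^+ 2 * mid ^+ 2 * (f u - f v) ^+ 2 -
      (sg b * (y u - mid * f u) * (2 / r) - sg b * (y v - mid * f v) * (2 / r)) ^+ 2 =
      (2 / r) ^+ 2 * (2 * (y u - y v) ^+ 2 + 2 * mid ^+ 2 * (f u - f v) ^+ 2 -
        sg b ^+ 2 * (y u - y v - mid * (f u - f v)) ^+ 2) by ring.
  rewrite sg2 mul1r mulr_ge0 ?sqr_ge0 //.
  have -> : 2 * (y u - y v) ^+ 2 + 2 * mid ^+ 2 * (f u - f v) ^+ 2 -
    (y u - y v - mid * (f u - f v)) ^+ 2 = (y u - y v + mid * (f u - f v)) ^+ 2 by ring.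
  exact: sqr_ge0.
have bd : 9 * L + 2 / K ^+ 2 * (L * tau) + 2 * (2 / r) ^+ 2 * En +
    2 * (2 / r) ^+ 2 * mid ^+ 2 * L <= split_const * L * c0.
  have i2 : 2 * (2 / r) ^+ 2 <= 32 / (rho * tau).
    have -> : 2 * (2 / r) ^+ 2 = 8 / r ^+ 2 by field; rewrite gt_eqF.
    rewrite ler_pdivrMr ?exprn_gt0 // mulrAC ler_pdivlMr ?mulr_gt0 //.
    exact: quarter_le.
  have h1 : 2 * (2 / r) ^+ 2 * En <= 32 / (rho * tau) * (256 * L * K2 / rho).
    have [EnL _] := EZ; apply: ler_pM => //; first by rewrite mulr_ge0 // sqr_ge0.
    apply: sumr_ge0 => u _; apply: sumr_ge0 => v _.
    by rewrite mulr_ge0 // mulr_ge0 ?touch_ge0 ?sqr_ge0.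
  have h2 : 2 * (2 / r) ^+ 2 * mid ^+ 2 <= 32 / (rho * tau) * (512 * K2 / rho / c0).
    by apply: ler_pM => //; rewrite ?sqr_ge0 // mulr_ge0 // sqr_ge0.
  have h3 := ler_wpM2r (ltW L_gt0) h2.
  apply: le_trans (lerD (lerD (lexx _) h1) h3) _.
  rewrite le_eqVlt; apply/orP; left; apply/eqP; rewrite KK /split_const /c0 /K2.
  by field; rewrite !gt_eqF.
exists g; split=> //.
- by move=> b; apply: lt_le_trans (gm b).
- move=> b; apply: le_trans (gE b) _; apply: (le_trans bd); apply: ler_wpM2l => //.
  have := le_trans (energy_ge0 w_ge0 _) (le_trans (gE true) bd).
  by rewrite pmulr_lge0.
- move=> v; have side b : sg b * (y v - mid * f v) <= 0 -> g b v = 0.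
    move=> h; rewrite /g (max_idPl _); last by rewrite pmulr_lle0.
    by rewrite (min_idPr _) // cap_ge0.
  have [h|/ltW h] := leP (y v - mid * f v) 0; [left|right]; apply: side; rewrite /sg ?mul1r //.
  by rewrite mulN1r oppr_le0.
Qed.

End Split.
End Splitting.

(** * Extending a packing *)

Section Orthonormal.
Variables (R : realType) (V : finType) (d : V -> R).

Definition orthonormal (T : finType) (F : T -> V -> R) : Prop :=
  forall s t, inner d (F s) (F t) = (s == t)%:R.

Lemma inner_suml (T : finType) (c : T -> R) (F : T -> V -> R) g :
  inner d (fun v => \sum_t c t * F t v) g = \sum_t c t * inner d (F t) g.
Proof.
rewrite /inner; under eq_bigr => v _ do rewrite mulr_suml mulr_sumr.
rewrite exchange_big; apply: eq_bigr => t _; rewrite mulr_sumr.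
by apply: eq_bigr => v _; ring.
Qed.

Lemma innerC f g : inner d f g = inner d g f.
Proof. by apply: eq_bigr => v _; rewrite (mulrC (f v)). Qed.

Lemma inner_mass f : inner d f f = mass d f.
Proof. by apply: eq_bigr => v _; rewrite expr2. Qed.

Lemma mass_orthonormal (T : finType) (F : T -> V -> R) (c : T -> R) :
  orthonormal F -> mass d (fun v => \sum_t c t * F t v) = \sum_t c t ^+ 2.
Proof.
move=> oF; rewrite -inner_mass inner_suml; apply: eq_bigr => t _.
rewrite innerC inner_suml (bigD1 t) //= big1 ?addr0 => [|s st].
  by rewrite oF eqxx mulr1.
by rewrite oF (negbTE st) mulr0.
Qed.

End Orthonormal.

Section DisjointSums.
Variables (R : realType) (I : finType).
Implicit Types F G : I -> R.

Definition separated F := forall i j, i != j -> F i = 0 \/ F j = 0.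

Lemma sqr_sum_separated F : separated F -> (\sum_i F i) ^+ 2 = \sum_i F i ^+ 2.
Proof.
move=> sF; rewrite expr2 mulr_suml; apply: eq_bigr => i _.
rewrite mulr_sumr (bigD1 i) //= big1 ?addr0 ?expr2 // => j ji.
by case: (sF _ _ ji) => ->; rewrite ?mulr0 ?mul0r.
Qed.

Lemma sqr_sub_separated F G : separated F -> separated G ->
  (forall i, 0 <= F i) -> (forall i, 0 <= G i) ->
  (\sum_i F i - \sum_i G i) ^+ 2 <= \sum_i (F i - G i) ^+ 2.
Proof.
move=> sF sG F0 G0.
have h : \sum_i F i * G i <= (\sum_i F i) * \sum_i G i.
  rewrite mulr_suml; apply: ler_sum => i _; apply: ler_wpM2l => //.
  by rewrite (bigD1 i) //= lerDl sumr_ge0.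
have -> : \sum_i (F i - G i) ^+ 2 = \sum_i F i ^+ 2 + \sum_i G i ^+ 2 - 2 * \sum_i F i * G i.
  by rewrite mulr_sumr -big_split -sumrB; apply: eq_bigr => i _ /=; ring.
rewrite sqrrB !sqr_sum_separated // mulr2n; lra.
Qed.

End DisjointSums.

Section Extension.
Variables (R : realType) (V : finType) (w : V -> V -> R) (d : V -> R).
Hypotheses (w_ge0 : forall u v, 0 <= w u v) (d_ge0 : forall v, 0 <= d v).
Variables (m a : nat) (f : 'I_m -> V -> R) (Y : 'I_a -> V -> R) (L : R).
Hypotheses (L_gt0 : 0 < L) (a_gt0 : (0 < a)%N).
Hypotheses (f_ge0 : forall j v, 0 <= f j v) (f_mass : forall j, mass d (f j) = 1).
Hypothesis f_energy : forall j, energy w (f j) <= L.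
Hypothesis f_disj : forall i j v, i != j -> f i v = 0 \/ f j v = 0.
Hypotheses (Y_on : orthonormal d Y) (fY : forall j i, inner d (f j) (Y i) = 0).
Hypothesis Y_energy : forall i, energy w (Y i) <= L.

Let s j := local_mass d (f j) Y.
Let e j := local_energy w (f j) Y.
(* The last summand keeps the levels positive and adds up to at most 1. *)
Definition level j : R := s j + e j / L + m.+1%:R^-1.

Let aR : 1 <= a%:R :> R. Proof. by rewrite ler1n. Qed.

Let s_ge0 j : 0 <= s j. Proof. exact: local_mass_ge0. Qed.

Let e_ge0 j : 0 <= e j. Proof. exact: local_energy_ge0. Qed.

Lemma level_gt0 j : 0 < level j.
Proof.
by rewrite /level ltr_wpDl ?invr_gt0 ?ltr0n // addr_ge0 ?divr_ge0 ?(ltW L_gt0).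
Qed.

Lemma local_mass_level j : s j <= level j.
Proof.
by rewrite /level -addrA lerDl addr_ge0 ?invr_ge0 ?divr_ge0 ?(ltW L_gt0).
Qed.

Lemma local_energy_level j : e j <= L * level j.
Proof.
rewrite -ler_pdivrMl // mulrC /level [s j + _]addrC -addrA lerDl.
by rewrite addr_ge0 ?invr_ge0.
Qed.

Lemma total_mass : \sum_v d v * sqnorm Y v = a%:R.
Proof.
transitivity (\sum_v \sum_i d v * Y i v ^+ 2).
  by apply: eq_bigr => v _; rewrite /sqnorm mulr_sumr.
rewrite exchange_big -[a in RHS]card_ord -sum1_card natr_sum.
apply: eq_bigr => i _; have := Y_on i i; rewrite inner_mass eqxx; exact.
Qed.

(** The supports are disjoint: a vertex is charged once and an edge at most twice, which gives
    [a + 2 * a]; the last summands add at most [1 <= a]. *)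
Lemma sum_level : \sum_j level j <= 4 * a%:R.
Proof.
have hs : \sum_j s j <= a%:R.
  rewrite -total_mass /s /local_mass (exchange_big_dep predT) //=.
  apply: ler_sum => v _; rewrite (eq_bigr (fun j => (f j v != 0)%:R * (d v * sqnorm Y v))) => [|j ->]; last by rewrite mul1r.
  rewrite big_mkcond /=; apply: le_trans (_ : \sum_j (f j v != 0)%:R * (d v * sqnorm Y v) <= _).
    by apply: ler_sum => j _; case: (f j v != 0); rewrite ?mul0r.
  rewrite -mulr_suml ler_piMl ?mulr_ge0 ?sqnorm_ge0 //.
  apply: sum_indic_le1 => i j hi hj; apply/eqP; apply: contraT => /(f_disj v) [] h.
    by rewrite h eqxx in hi.
  by rewrite h eqxx in hj.
have he : \sum_j e j <= 2 * (a%:R * L).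
  apply: le_trans (_ : 2 * \sum_i energy w (Y i) <= _); last first.
    rewrite ler_pM2l // -[a in leRHS]card_ord -sum1_card natr_sum mulr_suml.
    by apply: ler_sum => i _; rewrite mul1r.
  rewrite /e /local_energy /energy -!sum_edges_sum -sum_edgesZ.
  apply: ler_sum_edges => // u v; rewrite -mulr_suml; apply: ler_wpM2r.
    by apply: sumr_ge0 => i _; exact: sqr_ge0.
  have one z : \sum_j (f j z != 0)%:R <= 1 :> R.
    apply: sum_indic_le1 => i j hi hj; apply/eqP; apply: contraT => /(f_disj z) [] h.
      by rewrite h eqxx in hi.
    by rewrite h eqxx in hj.
  apply: le_trans (_ : \sum_j ((f j u != 0)%:R + (f j v != 0)%:R) <= _).
    by apply: ler_sum => j _; rewrite /touch; case: (f j u != 0); rewrite /= ?add0r // lerDl.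
  by rewrite big_split /=; have := one u; have := one v; lra.
rewrite /level !big_split /= -mulr_suml.
have h1 : (\sum_j e j) / L <= 2 * a%:R by rewrite ler_pdivrMr // -mulrA.
have h2 : \sum_(j < m) m.+1%:R^-1 <= 1 :> R.
  by rewrite sumr_const card_ord -[leLHS]mulr_natl ler_pdivrMr ?ltr0n // mul1r ler_nat.
by have h3 := aR; lra.
Qed.

Variable rho : R.
Hypotheses (rho_gt0 : 0 < rho) (rho_le : rho <= 1 / 2).
(** Equal to [(16 / rho) ^+ 2 * 2], so that outside the bulk of an unsplit [f j] the wall is at most
    [rho / 8] of the norm of [Y]. *)
Let B : R := 512 / rho ^+ 2.

(** The dichotomy: these functions meet the hypothesis [spread_out] of [splitting], and on the bulk
    of any other one [Y] has so little mass that it can be sacrificed. *)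
Definition splittable : {set 'I_m} :=
  [set j | rho / 16 * level j < bulk_mass d (f j) Y (B * level j)].

Lemma split_const_ge0 : 0 <= split_const (rho / 16) B.
Proof.
have B0 : 0 < B by rewrite /B divr_gt0 ?exprn_gt0.
have r0 : 0 < rho / 16 by rewrite divr_gt0.
rewrite /split_const; move: (rho / 16) B r0 B0 => x y x0 y0.
have y' : 0 < 12288 * y by apply: mulr_gt0.
have p1 : 0 < 12288 * y / x by apply: divr_gt0.
have p2 : 0 < 2 / y by apply: divr_gt0.
have p3 : 0 < 32 * y / x by apply: divr_gt0 => //; apply: mulr_gt0.
have p4 : 0 < 256 / x by apply: divr_gt0.
have p5 : 0 < 512 * 12288 * y / x ^+ 2.
  by apply: divr_gt0; [rewrite -mulrA; apply: mulr_gt0|apply: exprn_gt0].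
apply: mulr_ge0; first exact: ltW.
by rewrite addr_ge0 ?(ltW (mulr_gt0 p3 (addr_gt0 p4 p5))) // addr_ge0 // ltW.
Qed.

Lemma split_all : (a <= #|splittable|)%N ->
  packs w d 'I_(m + a) ((split_const (rho / 16) B + 1) * L).
Proof.
move=> aS.
have C0 := split_const_ge0.
have /fin_all_exists[g gP] : forall j, exists g : bool -> V -> R, j \in splittable ->
  [/\ forall b, 0 < mass d (g b),
      forall b, energy w (g b) <= split_const (rho / 16) B * L * mass d (g b),
      forall v, g true v = 0 \/ g false v = 0 &
      forall b v, f j v = 0 -> g b v = 0].
  move=> j; have [jS|_] := boolP (j \in splittable); last by exists (fun _ => f j).
  have r0 : 0 < rho / 16 by rewrite divr_gt0.
  have r1 : rho / 16 <= 1 by move: rho_le; lra.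
  have Bb : 4 <= rho / 16 * B.
    rewrite (_ : rho / 16 * B = 32 / rho); last by rewrite /B; field; rewrite gt_eqF.
    by rewrite ler_pdivlMr //; move: rho_le; lra.
  have bm : rho / 16 * level j < bulk_mass d (f j) Y (B * level j) by move: jS; rewrite inE.
  have [g gP] := splitting w_ge0 d_ge0 (f_ge0 j) L_gt0 (level_gt0 j) r0 r1 Bb (f_mass j)
    (f_energy j) (fY j) (local_mass_level j) (local_energy_level j) bm.
  by exists g.
pose I := ('I_m + {j : 'I_m | j \in splittable})%type.
pose F (i : I) := match i with
  | inl j => if j \in splittable then g j true else f j
  | inr j => g (val j) false end.
pose own (i : I) := match i with inl j => j | inr j => val j end.
have Fown i v : f (own i) v = 0 -> F i v = 0.
  case: i => [j|j] /=; last by have [_ _ _ h] := gP _ (valP j); exact: h.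
  by case: ifP => // jS; have [_ _ _ h] := gP _ jS; exact: h.
have leC j : split_const (rho / 16) B * L * mass d j <=
    (split_const (rho / 16) B + 1) * L * mass d j.
  by rewrite ler_wpM2r ?mass_ge0 // ler_wpM2r ?(ltW L_gt0) // lerDl.
apply: (@packs_card _ _ w d I).
  by rewrite card_ord card_sum card_ord card_sig leq_add2l (eq_card (B := splittable)).
exists F; split.
- case=> [j|j] /=; last by have [h _ _ _] := gP _ (valP j); exact: h.
  by case: ifP => [jS|_]; [have [h _ _ _] := gP _ jS; exact: h|rewrite f_mass].
- case=> [j|j] /=; last first.
    by have [_ h _ _] := gP _ (valP j); apply: le_trans (h false) _; exact: leC.
  case: ifP => [jS|_]; first by have [_ h _ _] := gP _ jS; apply: le_trans (h true) _; exact: leC.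
  rewrite f_mass mulr1; apply: le_trans (f_energy j) _.
  by rewrite ler_peMl ?(ltW L_gt0) // lerDr.
- move=> i i' v ii; have [same|diff] := eqVneq (own i) (own i'); last first.
    by have [/Fown|/Fown] := f_disj v diff; [left|right].
  case: i i' ii same => [j|j] [j'|j'] /= ii same.
  + by case/eqP: ii; rewrite same.
  + rewrite same (valP j'); have [_ _ h _] := gP _ (valP j'); exact: h.
  + rewrite -same (valP j); have [_ _ h _] := gP _ (valP j).
    by case: (h v); [right|left].
  + by case/eqP: ii; congr inr; exact: val_inj.
Qed.

(** The factor 2 makes capping at [kap j] lose at most half of the mass of [f j]. *)
Let kap j : R := Num.sqrt (2 * level j).

Let kap_gt0 j : 0 < kap j.
Proof. by rewrite sqrtr_gt0 mulr_gt0 ?level_gt0. Qed.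

Let kap_sqr j : kap j ^+ 2 = 2 * level j.
Proof. by rewrite sqr_sqrtr // mulr_ge0 // ltW ?level_gt0. Qed.

Definition collar j v : R := if j \in splittable then 0 else 2 * kap j * f j v.

Lemma collar_ge0 j v : 0 <= collar j v.
Proof.
rewrite /collar; case: ifP => // _; apply: mulr_ge0 => //.
by rewrite mulr_ge0 // ltW.
Qed.

Lemma collar_eq0 j v : f j v = 0 -> collar j v = 0.
Proof. by move=> fv; rewrite /collar fv mulr0 if_same. Qed.

Lemma collar_separated v : separated (collar^~ v).
Proof.
by move=> i j /(f_disj v)[] h; [left|right]; exact: collar_eq0.
Qed.

(* [shrunk] vanishes where [wall] exceeds the norm of [Y], that is, on the
   support of [cap (f j) Y (kap j)] for each [j] that is not split. *)
Definition wall v : R := \sum_j collar j v.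

Lemma wall_ge0 v : 0 <= wall v.
Proof. by apply: sumr_ge0 => j _; exact: collar_ge0. Qed.

Lemma wallE j v : f j v != 0 -> wall v = collar j v.
Proof.
move=> fv; rewrite /wall (bigD1 j) //= big1 ?addr0 // => i ij.
have [/collar_eq0//|fj] := f_disj v ij.
by rewrite fj eqxx in fv.
Qed.

Definition shrunk v : R := Num.max 0 (rad Y v - wall v).

(** Splittable functions become coordinates, to be localized together with [Y]; an unsplit one gets
    the coordinate 0 and is capped instead. Only the radius of [Y] changes, so that [polar_scaled]
    applies. *)
Definition trimmed (t : 'I_a + 'I_m) v : R := match t with
  | inl i => shrunk v * dir Y i v
  | inr j => if j \in splittable then f j v else 0 end.

Lemma shrunk_ge0 v : 0 <= shrunk v. Proof. by rewrite le_max lexx. Qed.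

Lemma shrunk_le v : shrunk v <= rad Y v.
Proof. by rewrite ge_max rad_ge0 lerBlDr lerDl wall_ge0. Qed.

Lemma shrunk_eq0 v : rad Y v = 0 -> shrunk v = 0.
Proof. by move=> h; apply: le_anti; rewrite shrunk_ge0 -{1}h shrunk_le. Qed.

Lemma sqnorm_trimmed v :
  sqnorm trimmed v = shrunk v ^+ 2 + \sum_(j in splittable) f j v ^+ 2.
Proof.
rewrite /sqnorm big_sumType /=; congr (_ + _).
  rewrite (eq_bigr (fun i => shrunk v ^+ 2 * dir Y i v ^+ 2)) => [|i _]; last by rewrite exprMn.
  rewrite -mulr_sumr; have [r0|r0] := eqVneq (rad Y v) 0.
    by rewrite shrunk_eq0 // expr0n mul0r.
  have -> : \sum_t dir Y t v ^+ 2 = 1 by apply: (mulfI r0); rewrite sum_dir mulr1.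
  by rewrite mulr1.
rewrite [RHS]big_mkcond; apply: eq_bigr => j _; case: ifP => // _.
by rewrite expr0n.
Qed.

(** A wall below [rho / 8] of the norm costs at most [rho / 4] of its square. A higher wall belongs
    to an unsplit [f j] and puts [v] in its bulk, where the whole square may be lost. *)
Lemma shrunk_loss v : rad Y v ^+ 2 - shrunk v ^+ 2 <= rho / 4 * rad Y v ^+ 2 +
  \sum_(j | j \notin splittable) (bulk (f j) Y (B * level j) v)%:R * rad Y v ^+ 2.
Proof.
have x0 := rad_ge0 Y v; have b0 := wall_ge0 v.
have rn := rho_gt0.
have S0 : 0 <= \sum_(j | j \notin splittable) (bulk (f j) Y (B * level j) v)%:R * rad Y v ^+ 2.
  by apply: sumr_ge0 => j _; rewrite mulr_ge0 ?ler0n ?sqr_ge0.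
have [small|big] := leP (wall v) (rho / 8 * rad Y v).
  apply: (@le_trans _ _ (rho / 4 * rad Y v ^+ 2)); last by rewrite lerDl.
  have xw : wall v <= rad Y v.
    apply: le_trans small _; rewrite ler_piMl //; move: rho_le; lra.
  rewrite /shrunk (max_idPr _) ?subr_ge0 //.
  have h := ler_wpM2l x0 small.
  have -> : rad Y v ^+ 2 - (rad Y v - wall v) ^+ 2 =
    2 * (rad Y v * wall v) - wall v ^+ 2 by ring.
  have -> : rho / 4 * rad Y v ^+ 2 = 2 * (rad Y v * (rho / 8 * rad Y v)) by field.
  by have := sqr_ge0 (wall v); lra.
have wv : wall v != 0.
  by rewrite gt_eqF // (le_lt_trans _ big) // mulr_ge0 // divr_ge0 // ltW.
have [j /= cj|none] := pickP (fun j => collar j v != 0); last first.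
  by case/eqP: wv; apply: big1 => j _; have := none j; case: eqP.
have fj : f j v != 0 by apply: contraNneq cj => /collar_eq0 ->.
have jS : j \notin splittable.
  by apply: contraNN cj => jS; rewrite /collar jS.
have bj : bulk (f j) Y (B * level j) v.
  rewrite /bulk fj /= -rad_sqr.
  have h : rad Y v < 16 / rho * (kap j * f j v).
    move: big; rewrite (wallE fj) /collar (negbTE jS) => h.
    rewrite mulrAC ltr_pdivlMr //; move: h; lra.
  have : rad Y v ^+ 2 < (16 / rho * (kap j * f j v)) ^+ 2.
    by rewrite ltr_pXn2r // nnegrE // ltW // (le_lt_trans x0).
  have -> : (16 / rho * (kap j * f j v)) ^+ 2 =
    (16 / rho) ^+ 2 * kap j ^+ 2 * f j v ^+ 2 by ring.
  rewrite kap_sqr; suff -> : (16 / rho) ^+ 2 * (2 * level j) = B * level j by [].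
  by rewrite /B; field; rewrite gt_eqF.
rewrite (bigD1 j jS) /= bj mul1r.
have : 0 <= \sum_(i < m | (i \notin splittable) && (i != j))
   (bulk (f i) Y (B * level i) v)%:R * rad Y v ^+ 2.
  by apply: sumr_ge0 => i _; rewrite mulr_ge0 ?ler0n ?sqr_ge0.
have : 0 <= rho / 4 * rad Y v ^+ 2 by rewrite mulr_ge0 ?sqr_ge0 // divr_ge0 // ltW.
have := sqr_ge0 (shrunk v); lra.
Qed.

Let M := \sum_v weight d trimmed v.
Let sg : R := #|splittable|%:R.

Lemma trimmed_total : M = \sum_v d v * shrunk v ^+ 2 + sg.
Proof.
rewrite /M /weight; under eq_bigr => v _ do rewrite sqnorm_trimmed mulrDr.
rewrite big_split /=; congr (_ + _).
rewrite /sg -sum1_card natr_sum.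
under eq_bigr => v _ do rewrite mulr_sumr.
by rewrite exchange_big; apply: eq_bigr => j _ /=; rewrite -(f_mass j).
Qed.

(** The low walls cost [rho / 4 * a]. The bulks of the unsplit functions cost at most [rho / 16] of
    the sum of the levels, again at most [rho / 4 * a]. *)
Lemma trimmed_ge : a%:R + sg - rho / 2 * a%:R <= M.
Proof.
have H : a%:R - \sum_v d v * shrunk v ^+ 2 <= rho / 4 * a%:R + rho / 16 * \sum_j level j.
  rewrite -total_mass -sumrB.
  apply: (@le_trans _ _ (\sum_v (rho / 4 * (d v * sqnorm Y v) +
     \sum_(j | j \notin splittable) (bulk (f j) Y (B * level j) v)%:R * (d v * sqnorm Y v)))).
    apply: ler_sum => v _; rewrite -mulrBr -rad_sqr.
    apply: (le_trans (ler_wpM2l (d_ge0 v) (shrunk_loss v))).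
    rewrite mulrDr mulrCA lerD2l mulr_sumr; apply: ler_sum => j _.
    by rewrite [leLHS]mulrCA.
  rewrite big_split -mulr_sumr /= lerD2l exchange_big mulr_sumr /=.
  rewrite [leLHS]big_mkcond; apply: ler_sum => j _; case: ifP => [jS|_]; last first.
    by rewrite mulr_ge0 ?(ltW (level_gt0 j)) // divr_ge0 // ltW // rho_gt0.
  move: jS; rewrite inE -leNgt; apply: le_trans.
  rewrite /bulk_mass [leRHS]big_mkcond; apply: ler_sum => v _.
  by case: (bulk _ _ _ _); rewrite ?mul1r ?mul0r.
rewrite trimmed_total.
have h : rho / 16 * \sum_j level j <= rho / 4 * a%:R.
  apply: (@le_trans _ _ (rho / 16 * (4 * a%:R))); last lra.
  by apply: ler_wpM2l sum_level; rewrite divr_ge0 // ltW // rho_gt0.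
lra.
Qed.

Lemma trimmed_le : M <= a%:R + sg.
Proof.
rewrite trimmed_total lerD2r -total_mass; apply: ler_sum => v _.
rewrite -rad_sqr ler_wpM2l // ler_sqr ?nnegrE ?rad_ge0 ?shrunk_ge0 //.
exact: shrunk_le.
Qed.

Lemma trimmed_edge u v : \sum_i (trimmed (inl i) u - trimmed (inl i) v) ^+ 2 <=
  2 * \sum_i (Y i u - Y i v) ^+ 2 + 2 * \sum_j (collar j u - collar j v) ^+ 2.
Proof.
rewrite /= polar_scaled; [|exact: shrunk_eq0|exact: shrunk_eq0].
have h1 := sqr_pos_sub (rad Y u - wall u) (rad Y v - wall v).
have h2 := sqr_sub_separated (@collar_separated u) (@collar_separated v)
  (collar_ge0^~ u) (collar_ge0^~ v).
have h3 : shrunk u * shrunk v * gap Y u v <= rad Y u * rad Y v * gap Y u v.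
  by rewrite ler_wpM2r ?gap_ge0 // ler_pM ?shrunk_ge0 ?shrunk_le.
have h4 := polar Y u v.
have h5 : 0 <= rad Y u * rad Y v * gap Y u v by rewrite !mulr_ge0 ?rad_ge0 ?gap_ge0.
have h6 : (rad Y u - wall u - (rad Y v - wall v)) ^+ 2 <=
    2 * (rad Y u - rad Y v) ^+ 2 + 2 * (wall u - wall v) ^+ 2.
  have := sqr_ge0 (rad Y u - rad Y v + (wall u - wall v)); lra.
move: h1 h2; rewrite -/(shrunk u) -/(shrunk v) -/(wall u) -/(wall v) => h1 h2.
lra.
Qed.

Lemma trimmed_energy : \sum_t energy w (trimmed t) <= (66 * a%:R + sg) * L.
Proof.
rewrite big_sumType /=.
(* The factor is [66 = 2 + 2 * 32]: a collar has energy at most [8 * level j * L], and the levels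
   add up to at most [4 * a]. *)
have h1 : \sum_i energy w (trimmed (inl i)) <= 66 * a%:R * L.
  rewrite /energy -sum_edges_sum; apply: le_trans (ler_sum_edges w_ge0 trimmed_edge) _.
  rewrite sum_edgesD !sum_edgesZ !sum_edges_sum.
  have hY : \sum_i energy w (Y i) <= a%:R * L.
    rewrite -[a in leRHS]card_ord -sum1_card natr_sum mulr_suml.
    by apply: ler_sum => i _; rewrite mul1r.
  have hc : \sum_j energy w (collar j) <= 32 * a%:R * L.
    apply: (@le_trans _ _ (8 * L * \sum_j level j)); last first.
      have l0 : 0 <= 8 * L by rewrite mulr_ge0 // ltW.
      by have := ler_wpM2l l0 sum_level; lra.
    rewrite mulr_sumr; apply: ler_sum => j _; rewrite /collar; case: (j \in splittable).
      have l1 := ltW (mulr_gt0 (mulr_gt0 (ltr0n _ 8) L_gt0) (level_gt0 j)).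
      rewrite /energy big1 // => u _.
      by apply: big1 => v _; rewrite subrr expr0n mulr0.
    rewrite energyZ exprMn kap_sqr.
    have l0 : 0 <= 2 ^+ 2 * (2 * level j) by rewrite !mulr_ge0 // ltW ?level_gt0.
    by have := ler_wpM2l l0 (f_energy j); lra.
  move: hY hc; rewrite /energy; lra.
have h2 : \sum_j energy w (trimmed (inr j)) <= sg * L.
  rewrite /sg -sum1_card natr_sum mulr_suml [leRHS]big_mkcond.
  apply: ler_sum => j _; rewrite /trimmed; case: (j \in splittable).
    by rewrite mul1r; exact: f_energy.
  rewrite /energy big1 // => u _.
  by apply: big1 => v _; rewrite subrr expr0n mulr0.
move: h1 h2 => /=; lra.
Qed.

(* [shrunk v = rad Y v] wherever one of the dropped functions is nonzero. *)
Lemma trimmed_spread (c : 'I_a + 'I_m -> R) :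
  \sum_v d v * (\sum_t c t * trimmed t v) ^+ 2 <= \sum_t c t ^+ 2.
Proof.
pose F (t : 'I_a + 'I_m) := match t with inl i => Y i | inr j => f j end.
pose c' t := match t with inl i => c t | inr j => if j \in splittable then c t else 0 end.
have oF : orthonormal d F.
  case=> [i|j] [i'|j'] /=.
  - exact: Y_on.
  - by rewrite innerC fY.
  - by rewrite fY.
  - have [<-|jj] := eqVneq j j'; first by rewrite inner_mass f_mass eqxx.
    rewrite (_ : (inr j == inr j') = false); last by apply: contraNF jj => /eqP[->].
    by apply: big1 => v _; have [->|->] := f_disj v jj; rewrite ?mul0r ?mulr0.
apply: (@le_trans _ _ (\sum_t c' t ^+ 2)); last first.
  apply: ler_sum => -[i|j] _ //=; case: ifP => // _.
  by rewrite expr0n sqr_ge0.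
rewrite -(mass_orthonormal c' oF); apply: ler_sum => v _; apply: ler_wpM2l => //.
rewrite !big_sumType /=.
have -> : \sum_j c (inr j) * (if j \in splittable then f j v else 0) =
    \sum_j (if j \in splittable then c (inr j) else 0) * f j v.
  by apply: eq_bigr => j _; case: ifP; rewrite ?mulr0 ?mul0r.
have -> : \sum_i c (inl i) * (shrunk v * dir Y i v) = shrunk v * \sum_i c (inl i) * dir Y i v.
  by rewrite mulr_sumr; apply: eq_bigr => i _; rewrite mulrCA.
have -> : \sum_i c (inl i) * Y i v = rad Y v * \sum_i c (inl i) * dir Y i v.
  by rewrite mulr_sumr; apply: eq_bigr => i _; rewrite mulrCA rad_dir.
have [j /andP[jS fj]|none] := pickP (fun j => (j \in splittable) && (f j v != 0)).
  rewrite /shrunk (wallE fj) /collar jS subr0 (max_idPr _) ?rad_ge0 //.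
rewrite [\sum_(j < m) _]big1 => [|j _]; last first.
  have := none j; case: (j \in splittable) => /=; last by rewrite mul0r.
  by case: eqP => // ->; rewrite mulr0.
rewrite !addr0 !exprMn ler_wpM2r ?sqr_ge0 // ler_sqr ?nnegrE ?rad_ge0 ?shrunk_ge0 //.
exact: shrunk_le.
Qed.

(** The cap changes [f j] only where its square is below [sqnorm Y / (2 * level j)], which has total
    at most 1/2 on the support. *)
Lemma cap_kept_mass j : 1 / 2 <= mass d (cap (f j) Y (kap j)).
Proof.
have H : mass d (f j) - mass d (cap (f j) Y (kap j)) <= (2 * level j)^-1 * s j.
  rewrite /s /local_mass mulr_sumr big_mkcond -sumrB; apply: ler_sum => v _.
  rewrite -mulrBr; have [fv|fv] /= := eqVneq (f j v) 0.
    by rewrite fv cap_eq0 // subrr mulr0.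
  have [h|h] := leP (sqnorm Y v) (kap j ^+ 2 * f j v ^+ 2).
    rewrite cap_id // subrr mulr0 mulr_ge0 ?invr_ge0 ?mulr_ge0 ?sqnorm_ge0 //.
    exact/ltW/level_gt0.
  rewrite [leRHS]mulrCA ler_wpM2l //.
  apply: (@le_trans _ _ (f j v ^+ 2)); first by rewrite gerBl sqr_ge0.
  by rewrite ler_pdivlMl ?mulr_gt0 ?level_gt0 // -kap_sqr ltW.
have h : (2 * level j)^-1 * s j <= 1 / 2.
  rewrite ler_pdivrMl ?mulr_gt0 ?level_gt0 //.
  by have := local_mass_level j; lra.
move: H; rewrite f_mass; lra.
Qed.

Lemma cap_kept_energy j : energy w (cap (f j) Y (kap j)) <= 10 * L.
Proof.
apply: le_trans (cap_energy w_ge0 Y (f_ge0 j) (kap_gt0 j)) _.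
rewrite kap_sqr -/(e j).
have h : 2 / (2 * level j) * e j <= L.
  rewrite (_ : 2 / (2 * level j) * e j = e j / level j); last first.
    by field; rewrite gt_eqF ?level_gt0.
  by rewrite ler_pdivrMr ?level_gt0 ?local_energy_level.
by have := f_energy j; lra.
Qed.

Lemma cap_trimmed j t v : j \notin splittable -> cap (f j) Y (kap j) v != 0 -> trimmed t v = 0.
Proof.
move=> jS cv; have := cap_gt0 (kap_gt0 j) cv.
have fv : f j v != 0 by apply: contraNneq cv => fv; rewrite cap_eq0.
move=> h; case: t => [i|j'] /=.
  rewrite /shrunk (wallE fv) /collar (negbTE jS) (max_idPl _) ?mul0r //.
  by rewrite subr_le0 ltW.
case: ifP => // jS'; have jj : j' != j by apply: contraNneq jS => <-.
have [//|fj] := f_disj v jj.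
by rewrite fj eqxx in fv.
Qed.

(** A sum that covers the possible outcomes: splitting, capping (energy 10 L and mass 1/2, hence
    20), and localization at level [134 * L]. *)
Definition extend_const (N : nat) : R :=
  split_const (rho / 16) B + 21 +
  134 * (8 * (1 + 32 * N%:R ^+ 2 / (rho / 16)) / (rho / 16)).

Lemma extend_const_ge N : 21 <= extend_const N.
Proof.
have C0 := split_const_ge0; rewrite /extend_const.
have r0 : 0 <= rho / 16 by apply: divr_ge0 => //; exact: ltW.
have : 0 <= 8 * (1 + 32 * N%:R ^+ 2 / (rho / 16)) / (rho / 16).
  apply: divr_ge0 => //; apply: mulr_ge0 => //; apply: addr_ge0 => //.
  by apply: divr_ge0 => //; apply: mulr_ge0 => //; exact: sqr_ge0.
by move: C0; move: (split_const _ _) (_ / _) => x y; lra.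
Qed.

(* If at least [a] functions are splittable, split them all. Otherwise split none:
   trade the splittable ones, together with [Y], for the localization of [trimmed]
   and cap the others, which leaves them at least half of their mass. *)
Lemma extend_packs (h N : nat) : (0 < h)%N -> 32 <= rho * N%:R ->
  (4 / 5) ^+ h * (2 * a%:R) ^+ 2 <= rho / 128 ->
  exists t : nat, m%:R + a%:R - rho * a%:R - 1 / 2 <= t%:R /\
    packs w d 'I_t (extend_const N * h%:R ^+ 3 * L).
Proof.
move=> h0 hN hh; have rn := rho_gt0; have rl := rho_le; have an := aR.
have half0 : 0 < 1 / 2 :> R by rewrite divr_gt0.
have le20 x : 1 / 2 <= x -> 10 * L <= 20 * L * x.
  by move=> /(ler_wpM2l (ltW L_gt0)); lra.
have h1 : 1 <= h%:R ^+ 3 :> R by rewrite exprn_ege1 // ler1n.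
have C0 := split_const_ge0.
have C20 : 20 <= split_const (rho / 16) B + 21.
  by move: C0; move: (split_const _ _) => x; lra.
pose D : R := 8 * (1 + 32 * N%:R ^+ 2 / (rho / 16)) / (rho / 16).
have D0 : 0 <= D.
  have r0 : 0 <= rho / 16 by apply: divr_ge0 => //; exact: ltW.
  apply: divr_ge0 => //; apply: mulr_ge0 => //; apply: addr_ge0 => //.
  by apply: divr_ge0 => //; apply: mulr_ge0 => //; exact: sqr_ge0.
have Cle x : x <= split_const (rho / 16) B + 21 -> x * L <= extend_const N * h%:R ^+ 3 * L.
  move=> hx; apply: ler_wpM2r; first exact: ltW.
  apply: (le_trans hx); rewrite /extend_const -/D.
  apply: (@le_trans _ _ (split_const (rho / 16) B + 21 + 134 * D)).
    by rewrite lerDl mulr_ge0.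
  by rewrite ler_peMr // !addr_ge0 // mulr_ge0.
have [aS|Sa] := leqP a #|splittable|.
  exists (m + a)%N; split; first by rewrite natrD; have := mulr_ge0 (ltW rn) (ltW (lt_le_trans ltr01 an)); lra.
  by apply: packs_le (split_all aS) => //; apply: Cle; lra.
have sga : sg <= a%:R by rewrite ler_nat ltnW.
have sg0 : 0 <= sg by exact: ler0n.
have Mge := trimmed_ge; have Mle := trimmed_le.
have ra : rho * a%:R <= 1 / 2 * a%:R by rewrite ler_wpM2r ?ler0n.
have ra0 : 0 < rho * a%:R by rewrite mulr_gt0 ?ltr0n.
have M2 : M <= 2 * a%:R by apply: (le_trans Mle); rewrite mulr2n mulrDl mul1r lerD2l.
have Ma : 1 / 2 * a%:R <= M by lra.
have M0 : 0 < M by lra.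
have r1 : 0 < rho / 16 by rewrite divr_gt0.
have r2 : rho / 16 <= 1 / 2 by lra.
have hN' : 2 <= rho / 16 * N%:R by lra.
have L' : 0 < 134 * L by rewrite mulr_gt0.
(* The energy is at most [67 * a * L], and [M] is at least half of [a]. *)
have GE : \sum_t energy w (trimmed t) <= 134 * L * M.
  apply: (le_trans trimmed_energy).
  rewrite [134 * L * M](_ : _ = 134 * M * L); last ring.
  by rewrite ler_pM2r //; lra.
have hM : (4 / 5) ^+ h * M ^+ 2 <= rho / 16 / 8.
  rewrite (_ : rho / 16 / 8 = rho / 128); last by field.
  apply: le_trans hh; rewrite ler_wpM2l ?exprn_ge0 // ?divr_ge0 //.
  by rewrite ler_sqr ?nnegrE ?(ltW M0) // mulr_ge0.
have [n [g [ng g0 ge gd gs]]] := localization w_ge0 d_ge0 trimmed_spread h0 r1 r2 hN' L' M0 GE hM.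
pose I := ({j : 'I_m | j \notin splittable} + 'I_n)%type.
pose F (i : I) := match i with inl j => cap (f (val j)) Y (kap (val j)) | inr l => g l end.
have cI : #|{: I}| = (m - #|splittable| + n)%N.
  rewrite card_sum card_ord card_sig; congr (_ + _)%N.
  have := cardC [in splittable]; rewrite card_ord => /(canRL (addKn _)) <-.
  exact: eq_card.
have sm : (#|splittable| <= m)%N by apply: leq_trans (max_card _) _; rewrite card_ord.
exists #|{: I}|; split.
  rewrite cI natrD natrB //.
  (* Localization returns nearly [M], which includes the splittable functions given up. The mass
     lost in trimming and the [rho / 4 * M] lost in localization are at most [rho / 2 * a] each. *)
  have key : rho * M <= rho * (2 * a%:R) by rewrite ler_wpM2l ?(ltW rn).
  move: ng; rewrite -/M -/sg; lra.
apply: (@packs_card _ _ w d I); first by rewrite card_ord.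
exists F; split.
- by case=> [j|l] //=; apply: lt_le_trans half0 (cap_kept_mass _).
- case=> [j|l] /=.
    apply: (le_trans (cap_kept_energy _)).
    apply: (@le_trans _ _ (20 * L * mass d (cap (f (val j)) Y (kap (val j))))).
      exact/le20/cap_kept_mass.
    by rewrite ler_wpM2r ?mass_ge0 //; exact: Cle.
  apply: (le_trans (ge l)); rewrite ler_wpM2r ?(ltW (g0 l)) //.
  rewrite -/D /extend_const -/D.
  rewrite [leLHS](_ : _ = 134 * D * h%:R ^+ 3 * L); last ring.
  rewrite ler_wpM2r ?(ltW L_gt0) // ler_wpM2r ?(le_trans ler01 h1) //.
  by rewrite lerDr addr_ge0.
- case=> [j|l] [j'|l'] v /= ii.
  + have jj : val j != val j' by apply: contraNneq ii => /val_inj ->.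
    by have [h2|h2] := f_disj v jj; [left|right]; exact: cap_eq0.
  + have [->|c0] := eqVneq (cap (f (val j)) Y (kap (val j)) v) 0; first by left.
    by right; apply: gs => t; exact: cap_trimmed (valP j) c0.
  + have [->|c0] := eqVneq (cap (f (val j')) Y (kap (val j')) v) 0; first by right.
    by left; apply: gs => t; exact: cap_trimmed (valP j') c0.
  + by apply: gd; apply: contraNneq ii => ->.
Qed.

End Extension.

(** * Eigenfunctions *)

Section RealMatrices.
Variable R : realType.

Lemma row_norm_ge0 n (v : 'rV[R]_n) : 0 <= (v *m v^T) 0 0.
Proof. by rewrite mxE sumr_ge0 // => i _; rewrite mxE -expr2 sqr_ge0. Qed.

Lemma row_norm_gt0 n (v : 'rV[R]_n) : v != 0 -> 0 < (v *m v^T) 0 0.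
Proof.
move=> v0; rewrite lt_neqAle row_norm_ge0 andbT; apply: contraNneq v0 => /esym.
rewrite mxE => /eqP; rewrite psumr_eq0 => [/allP h|i _]; last by rewrite mxE -expr2 sqr_ge0.
apply/eqP/matrixP => i j; rewrite ord1 mxE; apply/eqP.
by have := h j (mem_index_enum _); rewrite mxE -expr2 sqrf_eq0.
Qed.

Lemma unit_row n (v : 'rV[R]_n) : v != 0 ->
  exists c : R, (c *: v) *m (c *: v)^T = 1%:M.
Proof.
move=> /row_norm_gt0 h; exists (Num.sqrt ((v *m v^T) 0 0))^-1.
rewrite linearZ /= -scalemxAl -scalemxAr scalerA -expr2 exprVn sqr_sqrtr ?ltW //.
by rewrite {2}[v *m _]mx11_scalar scale_scalar_mx mulVf ?gt_eqF.
Qed.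

Lemma orth_row m n (A : 'M[R]_(n, m)) : (m < n)%N -> exists2 v : 'rV_n, v != 0 & v *m A = 0.
Proof.
move=> mn; have : kermx A != 0.
  by rewrite -mxrank_eq0 mxrank_ker subn_eq0 -ltnNge (leq_ltn_trans (rank_leq_col _)).
by move=> /rowV0Pn[v /sub_kermxP vA v0]; exists v.
Qed.

Lemma orth_rows m n a (A : 'M[R]_(n, m)) : (m + a <= n)%N ->
  exists C : 'M[R]_(a, n), C *m C^T = 1%:M /\ C *m A = 0.
Proof.
elim: a => [|a IH] h; first by exists 0; split; [apply/matrixP => -[]|rewrite mul0mx].
have [|C [CC CA]] := IH; first by apply: leq_trans h; rewrite addnS.
have [|v v0] := @orth_row (m + a) n (row_mx A C^T); first by rewrite -addnS.
rewrite mul_mx_row => /eqP; rewrite row_mx_eq0 => /andP[/eqP vA /eqP vC].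
have [c hc] := unit_row v0.
suff : exists C' : 'M[R]_(1 + a, n), C' *m C'^T = 1%:M /\ C' *m A = 0 by [].
exists (col_mx (c *: v) C); split; last first.
  by rewrite mul_col_mx CA -scalemxAl vA scaler0 col_mx0.
rewrite tr_col_mx mul_col_row CC hc.
have -> : c *: v *m C^T = 0 by rewrite -scalemxAl vC scaler0.
have -> : C *m (c *: v)^T = 0 by apply: trmx_inj; rewrite trmx_mul trmxK -scalemxAl vC scaler0 trmx0.
by rewrite -scalar_mx_block.
Qed.

(* Cayley-Hamilton: the factors of the characteristic polynomial, applied one
   after the other, kill [u]; the last nonzero vector is an eigenvector. *)
Lemma eigenvector_in n p (M : 'M[R]_n) (Q : 'M[R]_(n, p)) (E : 'M[R]_p) (s : seq R) (u : 'rV_n) :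
  char_poly M = \prod_(a <- s) ('X - a%:P) -> M *m Q = Q *m E -> u != 0 -> u *m Q = 0 ->
  exists a (v : 'rV_n), [/\ v != 0, v *m Q = 0 & v *m M = a *: v].
Proof.
case: n M Q u => [M Q u|n M Q u Ms MQ]; first by move=> _ _ /eqP[]; apply/matrixP=> i [].
have := Cayley_Hamilton M; rewrite {}Ms => Ms u0 uQ.
have : u *m horner_mx M (\prod_(a <- s) ('X - a%:P)) = 0 by rewrite Ms mulmx0.
elim: s u u0 uQ {Ms} => [|b s IH] u u0 uQ.
  by rewrite big_nil rmorph1 mulmx1 => /eqP; rewrite (negbTE u0).
rewrite big_cons rmorphM /= mulmxA rmorphB /= horner_mx_X horner_mx_C.
have [uM _|u'0] := eqVneq (u *m (M - b%:M)) 0.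
  exists b, u; split=> //; apply/eqP; rewrite -subr_eq0 -uM mulmxBr.
  by rewrite -mul_scalar_mx scalar_mxC.
apply: IH u'0 _; rewrite -mulmxA mulmxBl MQ mulmxBr !mulmxA uQ mul0mx sub0r.
by rewrite -mulmxA -scalar_mxC mulmxA uQ mul0mx oppr0.
Qed.

(** Symmetry makes the orthogonal complement of the eigenvectors found so far invariant, and
    [eigenvector_in] finds the next one there. *)
Lemma orthogonal_diagonalization n (M : 'M[R]_n) (s : seq R) :
  M^T = M -> char_poly M = \prod_(a <- s) ('X - a%:P) ->
  exists (P : 'M[R]_n) (D : 'rV[R]_n), P *m P^T = 1%:M /\ P *m M = diag_mx D *m P.
Proof.
move=> Msym Ms; suff H j : (j <= n)%N -> exists (P : 'M[R]_(j, n)) (D : 'rV[R]_j),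
    P *m P^T = 1%:M /\ P *m M = diag_mx D *m P by exact: H.
elim: j => [|j IH] jn.
  by exists 0, 0; split; [apply/matrixP => -[]|rewrite mul0mx mulmx0].
have [P [D [PP PM]]] := IH (ltnW jn).
have [u u0 uP] := orth_row P^T jn.
have MP : M *m P^T = P^T *m diag_mx D.
  by apply: trmx_inj; rewrite !trmx_mul trmxK Msym tr_diag_mx PM.
have [a [v [v0 vP vM]]] := eigenvector_in Ms MP u0 uP.
have [c hc] := unit_row v0.
suff : exists (P' : 'M[R]_(1 + j, n)) (D' : 'rV[R]_(1 + j)),
  P' *m P'^T = 1%:M /\ P' *m M = diag_mx D' *m P' by [].
exists (col_mx (c *: v) P), (row_mx a%:M D); split.
  rewrite tr_col_mx mul_col_row PP hc.
  have -> : c *: v *m P^T = 0 by rewrite -scalemxAl vP scaler0.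
  have -> : P *m (c *: v)^T = 0 by apply: trmx_inj; rewrite trmx_mul trmxK -scalemxAl vP scaler0 trmx0.
  by rewrite -scalar_mx_block.
rewrite diag_mx_row mul_col_mx PM -scalemxAl vM.
rewrite mul_block_col !mul0mx addr0 add0r; congr col_mx.
have -> : diag_mx (a%:M : 'rV[R]_1) = a%:M by apply/matrixP=> i k; rewrite !ord1 !mxE eqxx.
by rewrite mul_scalar_mx !scalerA mulrC.
Qed.

Lemma diagonalization_char_poly n (M P : 'M[R]_n) (D : 'rV[R]_n) :
  P *m P^T = 1%:M -> P *m M = diag_mx D *m P ->
  char_poly M = \prod_i ('X - (D 0 i)%:P).
Proof.
move=> PP PM; have Pu : P \in unitmx by have [] := mulmx1_unit PP.
transitivity (char_poly (diag_mx D)); last first.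
  rewrite char_poly_trig ?diag_mx_is_trig //.
  by apply: eq_bigr => i _; rewrite mxE eqxx mulr1n.
have detP : \det (map_mx polyC P) != 0.
  by rewrite det_map_mx polyC_eq0 -unitfE -unitmxE.
apply: (mulfI detP); rewrite [RHS]mulrC -!det_mulmx; congr (\det _).
by rewrite /char_poly_mx mulmxBr mulmxBl -!map_mxM PM scalar_mxC.
Qed.

Lemma sorted_diagonalization n (M : 'M[R]_n) (s : seq R) :
  M^T = M -> char_poly M = \prod_(a <- s) ('X - a%:P) ->
  exists P : 'M[R]_n, P *m P^T = 1%:M /\ P *m M = diag_mx (\row_i s`_i) *m P.
Proof.
move=> Msym Ms; have [P [D [PP PM]]] := orthogonal_diagonalization Msym Ms.
have ps : perm_eq s [seq D 0 i | i <- enum 'I_n].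
  apply: prod_XsubC_eq.
  by rewrite -Ms (diagonalization_char_poly PP PM) big_map big_enum.
have sz : size s = n by rewrite (perm_size ps) size_map -cardE card_ord.
have [Is pI sI] := perm_iotaP 0 ps.
have szI : size Is = n by rewrite (perm_size pI) size_iota size_map -cardE card_ord.
have uI : uniq Is by rewrite (perm_uniq pI) iota_uniq.
have ltI (i : 'I_n) : (nth 0%N Is i < n)%N.
  have : nth 0%N Is i \in Is by rewrite mem_nth ?szI.
  by rewrite (perm_mem pI) mem_iota size_map -cardE card_ord.
pose g i : 'I_n := Ordinal (ltI i).
have g_inj : injective g.
  move=> i j /(congr1 val) /= /eqP; rewrite nth_uniq ?szI // => /eqP; exact: val_inj.
have sg (i : 'I_n) : s`_i = D 0 (g i).
  rewrite sI (nth_map 0%N) ?szI // (nth_map i) -?cardE ?card_ord ?ltI //.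
  congr (D 0 _); apply: val_inj => /=.
  by rewrite (nth_enum_ord i (ltI i)).
exists (rowsub g P); split.
  apply/matrixP => i j; have /matrixP/(_ (g i) (g j)) := PP.
  rewrite !mxE (inj_eq g_inj) => <-.
  by apply: eq_bigr => k _; rewrite !mxE.
apply/matrixP => i j; have /matrixP/(_ (g i) j) := PM.
rewrite !mxE => h; transitivity (\sum_k P (g i) k * M k j).
  by apply: eq_bigr => k _; rewrite mxE.
rewrite {}h (bigD1 (g i)) //= [RHS](bigD1 i) //= !mxE !eqxx !big1 ?sg // => k.
  by rewrite !mxE eq_sym => /negbTE ->; rewrite mulr0n mul0r.
by rewrite !mxE eq_sym => /negbTE ->; rewrite mulr0n mul0r.
Qed.

End RealMatrices.

Section Eigenfunctions.
Variables (R : realType) (V : finType) (w : V -> V -> R).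
Hypothesis w_sym : forall u v, w u v = w v u.
Let d v := \sum_u w v u.
Hypothesis d_gt0 : forall v, 0 < d v.

Lemma energyE f : energy w f = 2 * (mass d f - \sum_u \sum_v w u v * (f u * f v)).
Proof.
have E1 : mass d f = \sum_u \sum_v w u v * f u ^+ 2.
  by apply: eq_bigr => u _; rewrite /d mulr_suml.
have E2 : mass d f = \sum_u \sum_v w u v * f v ^+ 2.
  rewrite exchange_big; apply: eq_bigr => u _; rewrite /d mulr_suml.
  by apply: eq_bigr => v _; rewrite w_sym.
rewrite mulrBr mulr2n mulrDl mul1r {1}E1 E2 mulr_sumr -big_split -sumrB.
apply: eq_bigr => u _; rewrite mulr_sumr -big_split -sumrB.
by apply: eq_bigr => v _ /=; ring.
Qed.

Variables (M : 'M[R]_#|V|) (s : seq R).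
Hypothesis M_entry : forall u v, M (enum_rank u) (enum_rank v) =
  (Num.sqrt (d u))^-1 * (d u *+ (u == v) - w u v) * (Num.sqrt (d v))^-1.
Hypothesis M_char : char_poly M = \prod_(a <- s) ('X - a%:P).

Let sum_rank (F : 'I_#|V| -> R) : \sum_i F i = \sum_v F (enum_rank v).
Proof. by rewrite (reindex (@enum_rank V)) //; apply: onW_bij; exact: enum_rank_bij. Qed.

Let sq_neq0 v : Num.sqrt (d v) != 0.
Proof. by rewrite sqrtr_eq0 -ltNge. Qed.

Let sqK v : Num.sqrt (d v) ^+ 2 = d v.
Proof. by rewrite sqr_sqrtr // ltW. Qed.

(** Division by [Num.sqrt (d v)] turns orthonormal eigenvectors of the normalized Laplacian into
    functions orthonormal for [inner d]. The factor 2 is there because [energy] counts each edge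
    twice. *)
Lemma eigenfunctions : exists x : 'I_#|V| -> V -> R,
  [/\ orthonormal d x,
      forall f, mass d f = \sum_i inner d f (x i) ^+ 2 &
      forall f, energy w f = \sum_(i < #|V|) 2 * s`_i * inner d f (x i) ^+ 2].
Proof.
have Msym : M^T = M.
  apply/matrixP => i j; rewrite !mxE -(enum_valK i) -(enum_valK j) !M_entry w_sym.
  rewrite eq_sym mulrAC [RHS]mulrAC -!mulrA mulrCA; congr (_ * (_ * _)).
  by have [->|] := eqVneq.
have [P [PP PM]] := sorted_diagonalization Msym M_char.
have PtP : P^T *m P = 1%:M by exact: mulmx1C.
pose x i v := P i (enum_rank v) / Num.sqrt (d v).
pose F f : 'rV[R]_#|V| := \row_k (Num.sqrt (d (enum_val k)) * f (enum_val k)).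
have Fx f i : inner d f (x i) = (F f *m P^T) 0 i.
  rewrite mxE sum_rank; apply: eq_bigr => v _; rewrite !mxE enum_rankK /x -{1}sqK.
  by field; exact: sq_neq0.
exists x; split.
- move=> i j; have /matrixP/(_ i j) := PP; rewrite !mxE => <-.
  rewrite sum_rank; apply: eq_bigr => v _; rewrite !mxE /x -{1}sqK.
  by field; exact: sq_neq0.
- move=> f; transitivity ((F f *m (F f)^T) 0 0).
    rewrite mxE sum_rank; apply: eq_bigr => v _; rewrite !mxE enum_rankK -{1}sqK.
    by ring.
  have -> : F f *m (F f)^T = (F f *m P^T) *m (F f *m P^T)^T.
    by rewrite trmx_mul trmxK -!mulmxA (mulmxA P^T) PtP mul1mx.
  by rewrite mxE; apply: eq_bigr => i _; rewrite Fx [_^T _ _]mxE expr2.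
- move=> f; transitivity (2 * (F f *m M *m (F f)^T) 0 0).
    rewrite energyE; congr (2 * _).
    transitivity (\sum_u \sum_v f u * (d u *+ (u == v) - w u v) * f v).
      rewrite /mass -sumrB; apply: eq_bigr => u _.
      under [RHS]eq_bigr => v _ do rewrite mulrBr mulrBl.
      rewrite sumrB; congr (_ - _); last by apply: eq_bigr => v _; ring.
      rewrite (bigD1 u) //= eqxx big1 ?addr0; first by rewrite mulr1n; ring.
      by move=> v; rewrite eq_sym => /negbTE ->; rewrite mulr0 mul0r.
    rewrite mxE sum_rank exchange_big; apply: eq_bigr => v _.
    rewrite !mxE enum_rankK sum_rank mulr_suml; apply: eq_bigr => u _.
    rewrite mxE enum_rankK M_entry; field.
    by rewrite !sq_neq0.
  have -> : M = P^T *m (diag_mx (\row_i s`_i) *m P) by rewrite -PM mulmxA PtP mul1mx.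
  have -> : F f *m (P^T *m (diag_mx (\row_i s`_i) *m P)) *m (F f)^T =
    (F f *m P^T) *m diag_mx (\row_i s`_i) *m (F f *m P^T)^T.
    by rewrite trmx_mul trmxK !mulmxA.
  rewrite mul_mx_diag mxE mulr_sumr; apply: eq_bigr => i _.
  rewrite Fx !mxE; move: (\sum_j _) => z; ring.
Qed.

End Eigenfunctions.

(** Orthogonality to the [g j] imposes [m] linear conditions on [N] coefficients. *)
Lemma orthonormal_perp (R : realType) (V : finType) (d : V -> R) (N m a : nat)
    (x : 'I_N -> V -> R) (g : 'I_m -> V -> R) :
  (m + a <= N)%N -> orthonormal d x ->
  exists c : 'I_a -> 'I_N -> R,
    [/\ forall i, \sum_t c i t ^+ 2 = 1,
        orthonormal d (fun i v => \sum_t c i t * x t v) &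
        forall j i, inner d (g j) (fun v => \sum_t c i t * x t v) = 0].
Proof.
move=> h ox; have [C [CC CA]] := orth_rows (\matrix_(t, j) inner d (x t) (g j)) h.
have in_x i t : inner d (fun v => \sum_s C i s * x s v) (x t) = C i t.
  rewrite inner_suml (bigD1 t) //= ox eqxx mulr1 big1 ?addr0 // => s st.
  by rewrite ox (negbTE st) mulr0.
have oC i j : \sum_t C i t * C j t = (i == j)%:R.
  have /matrixP/(_ i j) := CC; rewrite !mxE => <-.
  by apply: eq_bigr => t _; rewrite mxE.
exists (fun i t => C i t); split.
- move=> i; transitivity ((i == i)%:R : R); last by rewrite eqxx.
  by rewrite -oC; apply: eq_bigr => t _; rewrite expr2.
- move=> i j; rewrite innerC inner_suml -oC; apply: eq_bigr => t _.
  by rewrite innerC in_x mulrC.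
- move=> j i; rewrite innerC inner_suml.
  have /matrixP/(_ i j) := CA; rewrite !mxE => h0.
  by rewrite -[RHS]h0; apply: eq_bigr => t _; rewrite mxE.
Qed.

(** * Counting *)

Section Bessel.
Variables (R : realType) (V : finType) (d : V -> R).
Hypothesis d_ge0 : forall v, 0 <= d v.

Lemma mass_sub f g : mass d (fun v => f v - g v) = mass d f - 2 * inner d f g + mass d g.
Proof. by rewrite /mass /inner mulr_sumr -sumrB -big_split; apply: eq_bigr => v _ /=; ring. Qed.

Lemma bessel (T : finType) (g : T -> V -> R) f :
  orthonormal d g -> \sum_t inner d (g t) f ^+ 2 <= mass d f.
Proof.
move=> og; have := mass_ge0 d_ge0 (fun v => f v - \sum_t inner d (g t) f * g t v).
rewrite mass_sub mass_orthonormal // innerC inner_suml.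
have -> : \sum_t inner d (g t) f * inner d (g t) f = \sum_t inner d (g t) f ^+ 2.
  by apply: eq_bigr => t _; rewrite expr2.
lra.
Qed.

End Bessel.

(** A local maximum suffices, since a packing of more than [m] functions contains one of [m.+1]. *)
Lemma max_index (P : nat -> Prop) k : P 0%N ->
  exists m, [/\ (m <= k)%N, P m & (m < k)%N -> ~ P m.+1].
Proof.
move=> P0; elim: k => [|k [m [mk Pm nP]]]; first by exists 0%N.
have [mk'|mk'] := ltnP m k.
  by exists m; split=> //; [exact: leqW|move=> _; exact: nP].
have {mk'}mE : m = k by apply/eqP; rewrite eqn_leq mk.
have [Pk|nPk] := EM (P k.+1); first by exists k.+1; split=> //; rewrite ltnn.
by exists m; rewrite mE; split=> //; rewrite -mE.
Qed.

Section Numeric.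
Variables (R : realType) (eps a b e m t : R).
Hypotheses (eps_gt0 : 0 < eps) (eps_le : eps <= 1 / 2000).

(** Here [t] is the size of the first extension, at most [m] of its functions are concentrated, and
    [b] are not. As [a >= 1], the loss is at most [3 / 4 * a], whence [b >= a / 4]. *)
Lemma middle_modes : 1 <= a -> m + a - eps / 16 * a - 1 / 2 <= t -> t <= m + b ->
  eps * b <= e -> eps * a <= 4 * e.
Proof.
move=> a1 at_ tb be; have a0 : 0 <= a by lra.
have ra : eps / 16 * a <= 1 / 4 * a by apply: ler_wpM2r => //; move: eps_le; lra.
have ab : a / 4 <= b by lra.
by have := ler_wpM2l (ltW eps_gt0) ab; lra.
Qed.

Lemma middle_modes_suffice : 1 <= e -> eps * a <= 4 * e ->
  m + a <= m + (a + e) - eps / 16 * (a + e) - 1 / 2.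
Proof.
move=> e1 ae; have e0 : 0 <= e by lra.
have h : eps <= 1 by move: eps_le; lra.
by have := ler_wpM2r e0 h; lra.
Qed.

End Numeric.

Section Counting.
Variables (R : realType) (V I : finType) (w : V -> V -> R) (d : V -> R).
Hypotheses (w_ge0 : forall u v, 0 <= w u v) (w_sym : forall u v, w u v = w v u).
Hypotheses (w_le_d : forall v, \sum_u w v u <= d v).
Variables (x : I -> V -> R) (mu : I -> R).
Hypothesis x_on : orthonormal d x.
Hypothesis mass_x : forall f, mass d f = \sum_i inner d f (x i) ^+ 2.
Hypothesis energy_x : forall f, energy w f = \sum_i 2 * mu i * inner d f (x i) ^+ 2.

Let d_ge0 v : 0 <= d v.
Proof. by apply: le_trans (w_le_d v); exact: sumr_ge0. Qed.

Lemma mu_ge0 i : 0 <= mu i.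
Proof.
have := energy_ge0 w_ge0 (x i); rewrite energy_x (bigD1 i) //= big1 ?addr0 => [|j ji].
  by rewrite x_on eqxx expr1n mulr1 pmulr_rge0.
by rewrite x_on eq_sym (negbTE ji) expr0n mulr0.
Qed.

Variables (k h N : nat) (eps : R).
Let rho := eps / 16.
Hypotheses (k_gt0 : (0 < k)%N) (h_gt0 : (0 < h)%N).
Hypotheses (eps_gt0 : 0 < eps) (eps_le : eps <= 1 / 2000) (N_big : 32 <= rho * N%:R).
Hypothesis h_big : (4 / 5) ^+ h * (4 * k%:R) ^+ 2 <= rho / 128.

Let rho_gt0 : 0 < rho. Proof. by rewrite divr_gt0. Qed.
Let rho_le : rho <= 1 / 4. Proof. by move: eps_le; rewrite /rho; lra. Qed.

(** A unit combination of the modes in [S] has energy at most [L], and there are enough of them to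
    have [a] orthogonal to all [f j]. *)
Lemma extend_in_modes (S : {set I}) (L : R) (m a : nat) (f : 'I_m -> V -> R) :
  0 < L -> (forall i, i \in S -> 2 * mu i <= L) ->
  (0 < a)%N -> (m + a <= #|S|)%N -> (a <= 2 * k)%N ->
  (forall j v, 0 <= f j v) -> (forall j, mass d (f j) = 1) ->
  (forall j, energy w (f j) <= L) ->
  (forall i j v, i != j -> f i v = 0 \/ f j v = 0) ->
  exists t : nat, m%:R + a%:R - rho * a%:R - 1 / 2 <= t%:R /\
    packs w d 'I_t (extend_const rho N * h%:R ^+ 3 * L).
Proof.
move=> L0 SL a0 maS ak f0 f1 fe fd.
have oS : orthonormal d (fun t : 'I_#|S| => x (enum_val t)).
  by move=> s t; rewrite x_on (inj_eq enum_val_inj).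
have [c [c1 cY fY]] := orthonormal_perp f maS oS.
have Ye i : energy w (fun v => \sum_t c i t * x (enum_val t) v) <= L.
  rewrite energy_x; apply: (@le_trans _ _ (\sum_j L * inner d (fun v => \sum_t c i t * x (enum_val t) v) (x j) ^+ 2)).
    apply: ler_sum => j _; have [jS|jS] := boolP (j \in S).
      by rewrite ler_wpM2r ?sqr_ge0 // SL.
    rewrite inner_suml big1 ?expr0n ?mulr0 //= => t _.
    rewrite x_on (_ : (enum_val t == j) = false) ?mulr0 //.
    by apply: contraNF jS => /eqP <-; exact: enum_valP.
  by rewrite -mulr_sumr -mass_x mass_orthonormal // c1 mulr1.
apply: (extend_packs w_ge0 d_ge0 L0 a0 f0 f1 fe fd cY fY Ye rho_gt0 _ h_gt0 N_big).
  by move: rho_le; lra.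
apply: le_trans h_big; apply: ler_wpM2l; first by rewrite exprn_ge0 // divr_ge0.
rewrite ler_sqr ?nnegrE ?mulr_ge0 ?ler0n //.
have : a%:R <= (2 * k)%:R :> R by rewrite ler_nat.
by rewrite natrM; lra.
Qed.

Variables (L : R) (I0 : {set I}).
Hypotheses (L_gt0 : 0 < L) (I0_card : #|I0| = k) (I0_le : forall i, i \in I0 -> 2 * mu i <= L).
Let C := extend_const rho N.
(** Chosen so that a unit function at the level of the first extension has at most [eps] of its mass
    in modes with [2 * mu i] above [K * L]. *)
Let K : R := 500 * (C * h%:R ^+ 3) / eps.
Hypothesis C_ge1 : 1 <= C.

Let Ch_ge1 : 1 <= C * h%:R ^+ 3.
Proof. by rewrite mulr_ege1 // exprn_ege1 // ler1n. Qed.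

Let K_ge : 500 <= K.
Proof.
rewrite /K ler_pdivlMr //; have := Ch_ge1; have := eps_le; lra.
Qed.

Let I1 := [set i | 2 * mu i <= K * L].

Lemma I0_sub_I1 : I0 \subset I1.
Proof.
apply/subsetP => i /I0_le h0; rewrite inE; apply: (le_trans h0).
by rewrite ler_peMl ?(ltW L_gt0) //; have := K_ge; lra.
Qed.

Definition lowpart (g : V -> R) v : R :=
  \sum_i (if i \in I0 then inner d g (x i) else 0) * x i v.

Definition midmass (g : V -> R) : R := \sum_(i in I1 :\: I0) inner d g (x i) ^+ 2.

Lemma inner_lin (c : I -> R) i : inner d (fun v => \sum_j c j * x j v) (x i) = c i.
Proof.
rewrite inner_suml (bigD1 i) //= x_on eqxx mulr1 big1 ?addr0 // => j ji.
by rewrite x_on (negbTE ji) mulr0.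
Qed.

Lemma lowpart_energy g : mass d g = 1 -> energy w (lowpart g) <= L.
Proof.
move=> g1; rewrite energy_x; apply: (@le_trans _ _ (\sum_i L * inner d g (x i) ^+ 2)).
  apply: ler_sum => i _; rewrite inner_lin; case: ifP => [/I0_le h0|_].
    by rewrite ler_wpM2r ?sqr_ge0.
  by rewrite expr0n mulr0 mulr_ge0 ?sqr_ge0 // ltW.
by rewrite -mulr_sumr -mass_x g1 mulr1.
Qed.

Lemma lowpart_mass g : mass d (lowpart g) = \sum_(i in I0) inner d g (x i) ^+ 2.
Proof.
rewrite mass_orthonormal // [RHS]big_mkcond; apply: eq_bigr => i _.
by case: ifP => //; rewrite expr0n.
Qed.

Lemma mass_split g : energy w g <= C * h%:R ^+ 3 * (500 * L) ->
  mass d g - mass d (lowpart g) <= midmass g + eps.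
Proof.
move=> ge; have hi : \sum_(i | i \notin I1) inner d g (x i) ^+ 2 <= eps.
  have KL : 0 < K * L by rewrite mulr_gt0 //; have := K_ge; lra.
  rewrite -(ler_pM2l KL); apply: (@le_trans _ _ (energy w g)).
    rewrite energy_x mulr_sumr big_mkcond; apply: ler_sum => i _.
    rewrite inE -ltNge; case: ifP => [/ltW h1|_]; first by rewrite ler_wpM2r ?sqr_ge0.
    by rewrite mulr_ge0 ?sqr_ge0 // mulr_ge0 // mu_ge0.
  apply: (le_trans ge); rewrite /K le_eqVlt; apply/orP; left; apply/eqP.
  by field; rewrite gt_eqF.
rewrite mass_x lowpart_mass (bigID [in I1]) /= (bigID [in I0]) /=.
have -> : \sum_(i in I1 | i \in I0) inner d g (x i) ^+ 2 = \sum_(i in I0) inner d g (x i) ^+ 2.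
  apply: eq_bigl => i; rewrite andbC; case i0: (i \in I0) => //=.
  by rewrite (subsetP I0_sub_I1).
have -> : \sum_(i in I1 | i \notin I0) inner d g (x i) ^+ 2 = midmass g.
  by apply: eq_bigl => i; rewrite in_setD andbC.
lra.
Qed.

Lemma lowpart_mass_sub g : mass d (fun v => g v - lowpart g v) = mass d g - mass d (lowpart g).
Proof.
have E : mass d (lowpart g) = inner d g (lowpart g).
  rewrite lowpart_mass innerC inner_suml big_mkcond; apply: eq_bigr => i _.
  by case: ifP; rewrite ?mul0r // innerC expr2.
by rewrite mass_sub -E; ring.
Qed.

Lemma disjoint_orthonormal t (g : 'I_t -> V -> R) : (forall j, mass d (g j) = 1) ->
  (forall i j v, i != j -> g i v = 0 \/ g j v = 0) -> orthonormal d g.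
Proof.
move=> g1 gd i j; have [<-|ij] := eqVneq i j; first by rewrite inner_mass g1.
by apply: big1 => v _; have [->|->] := gd _ _ v ij; rewrite ?mul0r ?mulr0.
Qed.

Lemma sum_midmass t (g : 'I_t -> V -> R) : orthonormal d g ->
  \sum_j midmass (g j) <= #|I1 :\: I0|%:R.
Proof.
move=> og; rewrite exchange_big -sum1_card natr_sum; apply: ler_sum => i _ /=.
by apply: le_trans (bessel d_ge0 _ og) _; rewrite -inner_mass x_on eqxx.
Qed.

(** With little mass in the middle and high modes, [g j] is close to its projection [lowpart], which
    therefore leaks little out of the support of [g j]. The projection has energy at most [L], so
    concentration gets rid of the factor [C * h ^ 3]. *)
Lemma good_packs t (g : 'I_t -> V -> R) : (forall j, mass d (g j) = 1) ->
  (forall i j v, i != j -> g i v = 0 \/ g j v = 0) ->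
  (forall j, energy w (g j) <= C * h%:R ^+ 3 * (500 * L)) ->
  packs w d 'I_#|[set j | midmass (g j) <= eps]| (500 * L).
Proof.
move=> g1 gd ge; set G := [set j | _].
have gG (j : 'I_#|G|) : midmass (g (enum_val j)) <= eps.
  by have := enum_valP j; rewrite inE.
have loss (j : 'I_#|G|) : 1 - mass d (lowpart (g (enum_val j))) <= 1 / 1000.
  have := mass_split (ge (enum_val j)); rewrite g1.
  by have := gG j; have := eps_le; lra.
apply: (@concentrated_packs _ _ w d w_ge0 w_sym w_le_d _ (fun j => lowpart (g (enum_val j)))
  (fun j => [set v | g (enum_val j) v != 0]) L L_gt0).
- move=> i j ij; rewrite -setI_eq0; apply/eqP/setP => v; rewrite !inE.
  have ij' : enum_val i != enum_val j by apply: contraNneq ij => /enum_val_inj ->.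
  by have [->|->] := gd _ _ v ij'; rewrite eqxx ?andbF.
- by move=> j; apply: lowpart_energy.
- by move=> j; have := loss j; lra.
- move=> j; apply: le_trans (loss j); rewrite -{1}(g1 (enum_val j)).
  have <- := lowpart_mass_sub (g (enum_val j)); rewrite /mass [leLHS]big_mkcond.
  apply: ler_sum => v _; rewrite inE negbK; case: eqP => [->|_].
    by rewrite sub0r sqrrN.
  by rewrite mulr_ge0 ?sqr_ge0.
Qed.

(* Were [t - m] larger than the number of functions with much mass in the middle
   modes, [good_packs] would contradict the maximality of [m]; hence [k - m] is at
   most a constant times the number [e] of middle modes, and these make up for the
   loss in the second extension. *)
Lemma packs_low_modes : packs w d 'I_k (C * h%:R ^+ 3 * (K * L)).
Proof.
have Kg := K_ge; have rp := rho_gt0; have rl := rho_le; have Ch := Ch_ge1.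
have k1 : 1 <= k%:R :> R by rewrite ler1n.
have KL0 : 0 < K * L by apply: mulr_gt0 => //; lra.
have I1P i : i \in I1 -> 2 * mu i <= K * L by rewrite inE.
have finish t : packs w d 'I_t (C * h%:R ^+ 3 * (K * L)) -> k%:R <= t%:R :> R ->
    packs w d 'I_k (C * h%:R ^+ 3 * (K * L)).
  by move=> pt; rewrite ler_nat => kt; apply: packs_card pt; rewrite !card_ord.
(* With [2 * k] modes available the empty packing can be extended by [2 * k], and the loss is less
   than [k]. Otherwise the second extension below stays within the bound [2 * k] for which [h] was
   chosen. *)
have [big|small] := leqP (2 * k) #|I1|.
  have [| | | | | | |t [tk pt]] := @extend_in_modes I1 (K * L) 0 (2 * k) (fun _ _ => 0) KL0 I1P.
  - by rewrite muln_gt0.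
  - by rewrite add0n.
  - exact: leqnn.
  - by [].
  - by case.
  - by case.
  - by case.
  apply: finish pt _; apply: le_trans tk; rewrite natrM.
  have := ler_wpM2r (ler0n R k) rl; lra.
have [m [mk pm mmax]] : exists m, [/\ (m <= k)%N, packs w d 'I_m (500 * L) &
    (m < k)%N -> ~ packs w d 'I_m.+1 (500 * L)].
  apply: (@max_index (fun m => packs w d 'I_m (500 * L))).
  by exists (fun _ _ => 0); split=> -[].
move: mk; rewrite leq_eqVlt => /orP[/eqP mE|mk].
  rewrite mE in pm; apply: packs_le pm => //.
  rewrite mulrA ler_wpM2r ?(ltW L_gt0) //; have := ler_pM (ler0n R 500) ler01 Kg Ch.
  by rewrite mulr1 mulrC; apply.
have {}mmax := mmax mk.
have [f [f0 f1 fe fd]] := packs_normalized w_ge0 pm.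
have a0 : (0 < k - m)%N by rewrite subn_gt0.
have L5 : 0 < 500 * L by rewrite mulr_gt0.
have I05 i : i \in I0 -> 2 * mu i <= 500 * L.
  by move=> /I0_le; have := L_gt0; lra.
have [| |t [tk pt]] := extend_in_modes L5 I05 a0 _ _ f0 f1 fe fd.
- by rewrite subnKC ?I0_card // ltnW.
- by rewrite mul2n -addnn (leq_trans (leq_subr _ _)) ?leq_addr.
have [g [_ g1 ge gd]] := packs_normalized w_ge0 pt.
have og := disjoint_orthonormal g1 gd.
pose G := [set j | midmass (g j) <= eps].
have Gm : (#|G| <= m)%N.
  rewrite leqNgt; apply/negP => mG; apply: mmax.
  by apply: packs_card (good_packs g1 gd ge); rewrite !card_ord.
pose e := #|I1 :\: I0|.
have bad : eps * #|~: G|%:R <= e%:R.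
  apply: le_trans (sum_midmass og); rewrite -sum1_card natr_sum mulr_sumr big_mkcond.
  apply: ler_sum => j _; rewrite !inE; case: (leP (midmass (g j)) eps) => [_|h1] /=.
    by rewrite /midmass; apply: sumr_ge0 => i _; exact: sqr_ge0.
  by rewrite mulr1 ltW.
have tG : t%:R <= m%:R + #|~: G|%:R :> R.
  have tE := cardsC G; rewrite card_ord in tE.
  by rewrite -natrD ler_nat -[leqLHS]tE leq_add2r.
have a1 : 1 <= (k - m)%:R :> R by rewrite ler1n.
have ae := middle_modes eps_gt0 eps_le a1 tk tG bad.
have e1 : 1 <= e%:R :> R.
  rewrite ler1n lt0n; apply/eqP => e0; move: ae; rewrite e0 mulr0 leNgt.
  by rewrite mulr_gt0 // (lt_le_trans ltr01).
have eE : (k + e)%N = #|I1| by rewrite -(cardsID I0 I1) (setIidPr I0_sub_I1) I0_card.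
have fe' j : energy w (f j) <= K * L.
  by apply: (le_trans (fe j)); rewrite ler_wpM2r // ltW.
have [| | |t' [tk' pt']] := extend_in_modes KL0 I1P _ _ _ f0 f1 fe' fd (a := (k - m + e)%N).
- by rewrite addn_gt0 a0.
- by rewrite addnA subnKC ?eE // ltnW.
- apply: (@leq_trans (k + e)); first by rewrite leq_add2r leq_subr.
  by rewrite eE ltnW.
apply: finish pt' _; apply: le_trans tk'.
by rewrite -[k in k%:R](subnKC (ltnW mk)) !natrD middle_modes_suffice.
Qed.

End Counting.

(** * Cheeger's sweep *)

Section Cheeger.
Variables (R : realType) (V : finType) (w : V -> V -> R).
Hypotheses (w_ge0 : forall u v, 0 <= w u v) (w_sym : forall u v, w u v = w v u).
Let d v := \sum_u w v u.
Hypothesis d_gt0 : forall v, 0 < d v.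

Let d_ge0 v : 0 <= d v. Proof. exact: ltW. Qed.

Definition cut (S : {set V}) : R := \sum_(v in S) \sum_(u in ~: S) w v u.
Definition vol (S : {set V}) : R := \sum_(v in S) d v.
Definition variation (g : V -> R) : R := \sum_u \sum_v w u v * `|g u - g v|.
Definition indic (S : {set V}) v : R := (v \in S)%:R.

Lemma cut_ge0 S : 0 <= cut S.
Proof. by apply: sumr_ge0 => u _; exact: sumr_ge0. Qed.

Lemma vol_gt0 S : S != set0 -> 0 < vol S.
Proof.
case/set0Pn => v vS; by rewrite /vol (bigD1 v) //= ltr_pwDl // sumr_ge0.
Qed.

Lemma mass_indic S : mass d (indic S) = vol S.
Proof.
rewrite /vol [RHS]big_mkcond; apply: eq_bigr => v _; rewrite /indic.
by case: (v \in S); rewrite ?expr1n ?expr0n ?mulr1 ?mulr0.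
Qed.

Lemma sum_separating (S : {set V}) : \sum_u \sum_v w u v * ((u \in S) != (v \in S))%:R = 2 * cut S.
Proof.
have E : cut S = \sum_u \sum_v w u v * ((u \in S) && (v \notin S))%:R.
  rewrite /cut big_mkcond; apply: eq_bigr => u _ /=; case: (u \in S) => /=.
    rewrite big_mkcond; apply: eq_bigr => v _; rewrite inE.
    by case: (v \in S); rewrite /= ?mulr0 ?mulr1.
  by rewrite big1 // => v _; rewrite mulr0.
have E' : cut S = \sum_u \sum_v w u v * ((v \in S) && (u \notin S))%:R.
  rewrite E exchange_big; apply: eq_bigr => u _; apply: eq_bigr => v _.
  by rewrite w_sym.
rewrite mulr2n mulrDl mul1r {1}E E' -sum_edgesD.
apply: eq_bigr => u _; apply: eq_bigr => v _; congr (_ * _).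
by case: (u \in S); case: (v \in S); rewrite ?addr0 ?add0r.
Qed.

Lemma energy_indic (S : {set V}) : energy w (indic S) = 2 * cut S.
Proof.
rewrite -sum_separating; apply: eq_bigr => u _; apply: eq_bigr => v _; congr (_ * _).
rewrite /indic; case: (u \in S); case: (v \in S);
  by rewrite ?subrr ?subr0 ?sub0r ?sqrrN ?expr1n ?expr0n.
Qed.

(** The coarea formula, by induction on the size of the support: subtracting the least nonzero value
    on the support removes one level set. *)
Lemma variation_ge (c : R) (g : V -> R) : (forall v, 0 <= g v) ->
  (forall S : {set V}, S != set0 -> S \subset [set v | g v != 0] -> c * vol S <= cut S) ->
  2 * c * \sum_v d v * g v <= variation g.
Proof.
have [n] := ubnP #|[set v | g v != 0]|; elim: n g => // n IH g sn g0 hc.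
set S := [set v | g v != 0] in sn hc.
have [SE|Sn0] := eqVneq S set0.
  rewrite big1 ?mulr0 => [|v _]; last first.
    have : v \notin S by rewrite SE inE.
    by rewrite inE negbK => /eqP ->; rewrite mulr0.
  by apply: sumr_ge0 => u _; apply: sumr_ge0 => v _; rewrite mulr_ge0.
have [v0 v0S] := set0Pn _ Sn0.
pose v1 := [arg min_(v < v0 in S) g v]%O.
have [v1S v1min] : v1 \in S /\ forall v, v \in S -> g v1 <= g v.
  by rewrite /v1; case: arg_minP.
have t0 : 0 < g v1 by rewrite lt_neqAle eq_sym g0 andbT; move: v1S; rewrite inE.
have gS v : v \notin S -> g v = 0 by rewrite inE negbK => /eqP.
pose g' v := g v - g v1 * (v \in S)%:R.
have g'0 v : 0 <= g' v.
  rewrite /g'; have [vS|vS] := boolP (v \in S); first by rewrite mulr1 subr_ge0 v1min.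
  by rewrite mulr0 subr0.
have sub : [set v | g' v != 0] \subset S.
  apply/subsetP => v; rewrite inE; apply: contraR => vS.
  by rewrite /g' gS // (negbTE vS) mulr0 subr0.
have IHg : 2 * c * \sum_v d v * g' v <= variation g'.
  apply: IH => // [|T T0 Ts]; last by apply: hc => //; exact: subset_trans Ts sub.
  apply: leq_trans (_ : #|S| <= n)%N; last by rewrite -ltnS.
  apply: proper_card; apply/properP; split=> //; exists v1 => //.
  by rewrite inE /g' v1S mulr1 subrr eqxx.
have E1 : \sum_v d v * g v = \sum_v d v * g' v + g v1 * vol S.
  rewrite /vol mulr_sumr [X in _ + X]big_mkcond -big_split; apply: eq_bigr => v _ /=.
  by rewrite /g'; case: (v \in S); [rewrite mulr1; ring|rewrite mulr0 subr0 addr0].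
have E2 : variation g = variation g' + g v1 * (2 * cut S).
  rewrite -sum_separating -sum_edgesZ -sum_edgesD.
  apply: eq_bigr => u _; apply: eq_bigr => v _; congr (_ * _).
  have ug := g'0 u; have vg := g'0 v; have ug0 := g0 u; have vg0 := g0 v.
  move: ug vg; rewrite /g'; have [uS|uS] := boolP (u \in S); have [vS|vS] := boolP (v \in S);
    rewrite /= ?mulr1 ?mulr0 ?subr0 ?addr0 => hu hv.
  - by congr (`| _ |); ring.
  - by rewrite (gS v vS) !subr0 !ger0_norm //; lra.
  - by rewrite (gS u uS) !sub0r !normrN !ger0_norm //; lra.
  - by [].
rewrite E1 E2 mulrDr lerD // [leLHS]mulrCA ler_wpM2l ?(ltW t0) // -mulrA ler_pM2l //.
exact: hc.
Qed.

(** Since [f] vanishes outside its support, no restriction on the volume is needed. Instead of a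
    level set of [f], the subset of the support with least conductance is taken. *)
Lemma cheeger_sweep (r : R) (f : V -> R) : 0 < mass d f -> energy w f <= r * mass d f ->
  exists S : {set V}, [/\ S != set0, S \subset [set v | f v != 0] &
    (cut S / vol S) ^+ 2 <= r].
Proof.
move=> m0 er; set F := [set v | f v != 0].
have F0 : F != set0.
  apply: contraTneq m0 => FE; rewrite -leNgt /mass big1 // => v _.
  have : v \notin F by rewrite FE inE.
  by rewrite inE negbK => /eqP ->; rewrite expr0n mulr0.
pose P (S : {set V}) := (S != set0) && (S \subset F).
pose S := [arg min_(S < F | P S) (cut S / vol S)]%O.
have [/andP[S0 SF] Smin] : P S /\ forall T, P T -> cut S / vol S <= cut T / vol T.
  by rewrite /S; case: arg_minP => //; rewrite /P F0 subxx.
exists S; split=> //; set c := cut S / vol S in Smin *.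
have c0 : 0 <= c by rewrite divr_ge0 ?cut_ge0 // ltW ?vol_gt0.
have r0 : 0 <= r.
  by rewrite -(pmulr_lge0 _ m0) (le_trans _ er) // energy_ge0.
have [->|cn0] := eqVneq c 0; first by rewrite expr0n.
have c1 : 0 < c by rewrite lt_neqAle eq_sym cn0.
have lower : 2 * c * mass d f <= variation (fun v => f v ^+ 2).
  apply: variation_ge => [v|T T0 TF]; first exact: sqr_ge0.
  rewrite -ler_pdivlMr ?vol_gt0 //; apply: Smin; rewrite /P T0 /=.
  by apply: subset_trans TF _; apply/subsetP => v; rewrite !inE sqrf_eq0.
have plus : \sum_u \sum_v w u v * (f u + f v) ^+ 2 <= 4 * mass d f.
  have E1 : mass d f = \sum_u \sum_v w u v * f u ^+ 2.
    by apply: eq_bigr => u _; rewrite /d mulr_suml.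
  have E2 : mass d f = \sum_u \sum_v w u v * f v ^+ 2.
    rewrite exchange_big; apply: eq_bigr => u _; rewrite /d mulr_suml.
    by apply: eq_bigr => v _; rewrite w_sym.
  apply: (@le_trans _ _ (2 * mass d f + 2 * mass d f)); last lra.
  rewrite {1}E1 E2 -!sum_edgesZ -sum_edgesD; apply: ler_sum_edges => // u v.
  have := sqr_ge0 (f u - f v); lra.
have upper : variation (fun v => f v ^+ 2) <= c^-1 * energy w f + c / 4 * (4 * mass d f).
  (* The weights are tuned to [c]: the second term becomes half of the lower bound
     [2 * c * mass d f] and is absorbed by it. *)
  apply: (@le_trans _ _ (c^-1 * energy w f + c / 4 * \sum_u \sum_v w u v * (f u + f v) ^+ 2)).
    rewrite /energy -!sum_edgesZ -sum_edgesD; apply: ler_sum_edges => // u v.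
    rewrite subr_sqr normrM -[(f u - f v) ^+ 2]real_normK ?num_real //.
    rewrite -[(f u + f v) ^+ 2]real_normK ?num_real //.
    move: `|f u - f v| `|f u + f v| => x y; rewrite -subr_ge0.
    have -> : c^-1 * x ^+ 2 + c / 4 * y ^+ 2 - x * y = c * (x / c - y / 2) ^+ 2.
      by field.
    by rewrite mulr_ge0 ?sqr_ge0.
  by rewrite lerD2l ler_wpM2l // divr_ge0.
have h : c * mass d f <= c^-1 * (r * mass d f).
  have : c^-1 * energy w f <= c^-1 * (r * mass d f) by rewrite ler_wpM2l ?invr_ge0.
  lra.
by move: h; rewrite mulrA ler_pM2r // ler_pdivlMl // -expr2.
Qed.

End Cheeger.

(** * Constants and the passage to weighted graphs *)

Lemma positive_gap (R : realType) (T : finType) (F : T -> R) :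
  exists2 e : R, 0 < e & forall t, F t < e -> F t <= 0.
Proof.
exists (\big[Num.min/1]_(t | 0 < F t) F t).
  by elim/big_rec: _ => // t y Ft y0; rewrite lt_min Ft.
move=> t; apply: contraTT; rewrite -!ltNge -leNgt => Ft.
by rewrite (bigD1 t) //= ge_min lexx.
Qed.

Lemma depth_exists (R : realType) (c : R) : 0 < c ->
  exists2 H : R, 1 <= H & forall k, (0 < k)%N -> exists h : nat,
    [/\ (0 < h)%N, (4 / 5) ^+ h * (4 * k%:R) ^+ 2 <= c & h%:R <= H * (1 + ln k.+1%:R)].
Proof.
move=> c0; pose q := Num.bound (16 / c).
have hq : 16 / c < 2 ^+ q :> R.
  apply: lt_le_trans (archi_boundP _) _; first by rewrite divr_ge0 // ltW.
  by rewrite -natrX ler_nat ltnW // ltn_expl.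
have l2 : 0 < ln 2 :> R by rewrite ln_gt0 // ltr1n.
pose a : R := 12 + 4 * q%:R.
have a1 : 12 <= a by rewrite lerDl mulr_ge0 // ler0n.
have b0 : 0 < 8 / ln 2 :> R by rewrite divr_gt0.
exists (a + 8 / ln 2); first by move: a1 b0; move: a (8 / _) => x y; lra.
move=> k k0; pose u := up_log 2 k.
have k1 : 1 <= k%:R :> R by rewrite ler1n.
have lk0 : 0 <= ln k.+1%:R :> R by rewrite ln_ge0 // ler1n.
(* Four factors 4/5 are below 1/2, so the power is at most the inverse of [2 ^ (2 * u + q)], where
   [2 ^ u >= k] and [2 ^ q > 16 / c]. *)
exists (4 * (2 * u + q).+1)%N; split=> //.
  have half : (4 / 5) ^+ (4 * (2 * u + q).+1) <= (2 ^+ (2 * u + q))^-1 :> R.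
    rewrite exprM -exprVn; apply: (@le_trans _ _ (2^-1 ^+ (2 * u + q).+1)).
      by rewrite lerXn2r ?nnegrE ?exprn_ge0 ?invr_ge0 ?divr_ge0 //; lra.
    by rewrite exprS ler_piMl ?exprn_ge0 ?invr_ge0 //; lra.
  have ku : k%:R <= 2 ^+ u :> R by rewrite -natrX ler_nat up_logP.
  apply: (le_trans (ler_wpM2r (sqr_ge0 _) half)).
  rewrite mulrC ler_pdivrMr ?exprn_gt0 // exprD mulrC.
  have k2 : k%:R ^+ 2 <= (2 ^+ u) ^+ 2 :> R by rewrite ler_sqr ?nnegrE ?exprn_ge0 ?ler0n.
  rewrite exprMn mulnC exprM.
  have c1 : 16 <= 2 ^+ q * c by rewrite -ler_pdivrMr // ltW.
  have s0 : 0 <= (2 ^+ u) ^+ 2 :> R by exact: sqr_ge0.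
  apply: (@le_trans _ _ (16 * (2 ^+ u) ^+ 2)); first by move: k2; move: (_ ^+ 2) (_ ^+ 2) => x y; lra.
  have -> : c * (2 ^+ u ^+ 2 * 2 ^+ q) = 2 ^+ q * c * (2 ^+ u) ^+ 2 by ring.
  by rewrite ler_wpM2r.
have uk : u%:R <= 1 + ln k.+1%:R / ln 2 :> R.
  have [->|u0] := posnP u; first by rewrite addr_ge0 // divr_ge0 // ltW.
  have kk : (1 < k)%N by move: u0; rewrite up_log_gt0.
  rewrite -(prednK u0) -natr1 [leRHS]addrC lerD2r ler_pdivlMr //.
  rewrite mulr_natl -lnXn // ler_ln ?posrE ?exprn_gt0 ?ltr0n //.
  by rewrite -natrX ler_nat ltnW // ltnS ltnW // up_log_gtn.
have -> : (4 * (2 * u + q).+1)%:R = 8 * u%:R + 4 * q%:R + 4 :> R.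
  have -> : (4 * (2 * u + q).+1 = 8 * u + 4 * q + 4)%N by rewrite mulnS mulnDr mulnA addnC.
  by rewrite (natrD _ (8 * u + 4 * q)%N) (natrD _ (8 * u)%N) (natrM _ 8 u) (natrM _ 4 q).
have aL : 0 <= a * ln k.+1%:R by rewrite mulr_ge0 //; lra.
have e1 : 8 / ln 2 * ln k.+1%:R = 8 * (ln k.+1%:R / ln 2) :> R by rewrite mulrAC mulrA.
rewrite mulrDr mulr1 [(a + _) * ln _]mulrDl e1; move: aL uk b0; rewrite /a.
move: (u%:R) (8 / _) (ln _ / _) (_ * ln _) => x y z t; move: (q%:R) => b; lra.
Qed.

Section Graph.
Variables (R : realType) (V : finType) (w : V -> V -> R).
Hypotheses (w_sym : forall v u, w v u = w u v) (w_ge0 : forall v u, 0 <= w v u).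
Hypothesis d_gt0 : forall v, 0 < degree w v.

Lemma rayleighE f : rayleigh w f = energy w f / 2 / mass (degree w) f.
Proof.
rewrite /rayleigh; congr (_ / _); apply: (mulIf (_ : 2 != 0)); rewrite ?pnatr_eq0 //.
rewrite divfK ?pnatr_eq0 // mulr2n mulrDr mulr1.
transitivity (\sum_v \sum_(u | (enum_rank v < enum_rank u)%N) w v u * (f v - f u) ^+ 2 +
   \sum_v \sum_(u | (enum_rank u < enum_rank v)%N) w v u * (f v - f u) ^+ 2).
  congr (_ + _); rewrite (exchange_big_dep predT) //=; apply: eq_bigr => u _.
  by apply: eq_bigr => v _; rewrite w_sym sqr_subC.
rewrite -big_split; apply: eq_bigr => v _ /=.
rewrite [RHS](bigID (fun u => enum_rank v < enum_rank u)%N) /=; congr (_ + _).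
rewrite [RHS](bigID (fun u => enum_rank u < enum_rank v)%N) /=.
rewrite [X in _ = _ + X]big1 ?addr0 => [|u]; last first.
  rewrite -!leqNgt -eqn_leq => /eqP /val_inj /enum_rank_inj ->.
  by rewrite subrr expr0n mulr0.
by apply: eq_bigl => u; case: ltngtP.
Qed.

Lemma laplacian_entry u v : normalized_laplacian w (enum_rank u) (enum_rank v) =
  (Num.sqrt (degree w u))^-1 * (degree w u *+ (u == v) - w u v) * (Num.sqrt (degree w v))^-1.
Proof.
rewrite /normalized_laplacian /inv_sqrt_degree mul_diag_mx mul_mx_diag !mxE.
by rewrite !enum_rankK (inj_eq enum_rank_inj).
Qed.

Lemma low_modes (k : nat) : (1 <= k <= #|V|)%N ->
  exists (x : 'I_#|V| -> V -> R) (mu : 'I_#|V| -> R) (I0 : {set 'I_#|V|}),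
  [/\ orthonormal (degree w) x,
      forall f, mass (degree w) f = \sum_i inner (degree w) f (x i) ^+ 2,
      forall f, energy w f = \sum_i 2 * mu i * inner (degree w) f (x i) ^+ 2,
      #|I0| = k & forall i, i \in I0 -> mu i <= lambda w k] /\
  0 <= lambda w k.
Proof.
move=> /andP[k0 kV].
have [sorted_s char_s] := spectrumP (normalized_laplacian_sym w_sym).
have [x [ox mx ex]] := eigenfunctions w_sym d_gt0 laplacian_entry char_s.
pose mu (i : 'I_#|V|) := (spectrum (normalized_laplacian w))`_i.
exists x, mu, [set i : 'I_#|V| | (i < k)%N]; split.
  split=> //.
    by rewrite cardsE -sum1_card (big_ord_narrow kV) sum1_card card_ord.
  move=> i; rewrite inE => ik; rewrite /lambda /mu.
  apply: (sorted_leq_nth le_trans le_refl) => //.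
  - by rewrite inE size_spectrum_normalized_laplacian.
  - by rewrite inE size_spectrum_normalized_laplacian // prednK.
  - by rewrite -ltnS prednK.
have hk : (k.-1 < #|V|)%N by rewrite prednK.
(* The [k]-th eigenvalue is the entry of index [k.-1]; it is half the energy of its own
   eigenfunction. *)
have w0 := mu_ge0 w_ge0 ox ex (Ordinal hk); exact: w0.
Qed.

End Graph.

Lemma graph_packs (R : realType) : exists2 B : R, 1 <= B &
  forall (V : finType) (w : V -> V -> R) (k : nat),
    (forall v u, w v u = w u v) ->
    (forall v u, 0 <= w v u) ->
    (forall v, 0 < degree w v) ->
    (1 <= k <= #|V|)%N ->
    forall L, 0 < L -> 2 * lambda w k <= L ->
    packs w (degree w) 'I_k (B * (1 + ln k.+1%:R) ^+ 6 * L).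
Proof.
have [eps eps0 eps1] : exists2 eps : R, 0 < eps & eps <= 1 / 2000.
  by exists (1 / 2000); [lra|exact: lexx].
have rho0 : 0 < eps / 16 by rewrite divr_gt0.
have rho1 : eps / 16 <= 1 / 2 by lra.
pose N := Num.bound (32 / (eps / 16)).
have hN : 32 <= eps / 16 * N%:R.
  rewrite mulrC -ler_pdivrMr // ltW // archi_boundP //.
  by rewrite divr_ge0 // ltW.
have c0 : 0 < eps / 16 / 128 by rewrite divr_gt0.
have [H H1 hH] := depth_exists c0.
have C21 := extend_const_ge rho0 N.
set C := extend_const (eps / 16) N in C21.
have D0 : 0 <= C * (500 * C / eps).
  by apply: mulr_ge0; [lra|apply: divr_ge0; lra].
(* The summand 1 ensures [B >= 1], so that later [B <= B ^+ 2]. *)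
exists (1 + C * (500 * C / eps) * H ^+ 6).
  by rewrite lerDl mulr_ge0 // exprn_ge0 //; lra.
move=> V w k w_sym w_ge0 d_gt0 kV L L0 lL.
have [x [mu [I0 [[ox mx ex cI lI] l0]]]] := low_modes w_sym w_ge0 d_gt0 kV.
have k0 : (0 < k)%N by case/andP: kV.
have [h [h0 hk hl]] := hH k k0.
have I0L i : i \in I0 -> 2 * mu i <= L.
  by move=> /lI h1; apply: le_trans lL; rewrite ler_pM2l.
have C1 : 1 <= C by lra.
have wd v : \sum_u w v u <= degree w v by [].
have := packs_low_modes w_ge0 w_sym wd ox mx ex k0 h0 eps0 eps1 hN hk L0 cI I0L C1.
apply: packs_le => //; first by move=> v; exact: ltW.
rewrite -/C.
have -> : C * h%:R ^+ 3 * (500 * (C * h%:R ^+ 3) / eps * L) =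
  C * (500 * C / eps) * h%:R ^+ 6 * L by ring.
rewrite ler_wpM2r ?(ltW L0) //.
have h6 : h%:R ^+ 6 <= H ^+ 6 * (1 + ln k.+1%:R) ^+ 6.
  rewrite -exprMn lerXn2r ?nnegrE ?ler0n //.
  by rewrite (le_trans _ hl) // ler0n.
apply: (le_trans (ler_wpM2l D0 h6)); rewrite [leLHS]mulrA.
by apply: ler_wpM2r; rewrite ?lerDr // exprn_ge0 // addr_ge0 // ln_ge0 // ler1n.
Qed.

Theorem theorem1p1 (R : realType) :
  exists C : R,
  forall (V : finType) (w : V -> V -> R) (k : nat),
    (forall v u, w v u = w u v) ->
    (forall v u, 0 <= w v u) ->
    (forall v, 0 < degree w v) ->
    (1 <= k <= #|V|)%N ->
    (exists S : 'I_k -> {set V},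
      [/\ forall i, S i != finset.set0,
          forall i j, i != j -> [disjoint S i & S j]
        & \big[Num.max/0]_(i < k) conductance w (S i)
            <= C * (1 + ln k.+1%:R) ^+ 5 * Num.sqrt (lambda w k)])
    /\
    (exists f : 'I_k -> V -> R,
      [/\ forall i, exists v, f i v != 0,
          forall i v, 0 <= f i v,
          forall i j, i != j -> [disjoint fsupport (f i) & fsupport (f j)]
        & forall i, rayleigh w (f i)
            <= C * (1 + ln k.+1%:R) ^+ 10 * lambda w k]).
Proof.
have [B B1 hB] := graph_packs R.
exists (2 * B) => V w k w_sym w_ge0 d_gt0 kV.
have [x [mu [I0 [_ l0]]]] := low_modes w_sym w_ge0 d_gt0 kV.
set l := lambda w k in l0 *.
set ell := 1 + ln k.+1%:R.
have ell1 : 1 <= ell by rewrite lerDl ln_ge0 // ler1n.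
have ell0 n : 0 <= ell ^+ n by rewrite exprn_ge0 // (le_trans ler01).
have dge v : 0 <= degree w v by exact: ltW.
have B0 : 0 <= B by exact: le_trans B1.
have sets L : 0 < L -> 2 * l <= L -> exists S : 'I_k -> {set V},
   [/\ forall i, S i != finset.set0, forall i j, i != j -> [disjoint S i & S j] &
       forall i, conductance w (S i) ^+ 2 <= B * ell ^+ 6 * L].
  move=> L0 lL; have [f [f0 fe fd]] := hB V w k w_sym w_ge0 d_gt0 kV L L0 lL.
  have /choice[S SP] i := cheeger_sweep w_ge0 w_sym d_gt0 (f0 i) (fe i).
  exists S; split=> [i|i j ij|i]; try by have [] := SP i.
  have [_ Si _] := SP i; have [_ Sj _] := SP j.
  apply: disjointWl Si _; apply: disjointWr Sj _.
  rewrite -setI_eq0; apply/eqP/setP => v; rewrite !inE.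
  by have [->|->] := fd _ _ v ij; rewrite eqxx ?andbF.
have [lE|ln0] := eqVneq l 0.
  (* With [L] so small that every squared conductance is below the least positive one, all
     conductances vanish. The indicators of these sets then have energy 0 and serve for (ii). *)
  have [e e0 gap] := positive_gap (fun S : {set V} => conductance w S ^+ 2).
  have Bl : 0 < B * ell ^+ 6.
    by rewrite mulr_gt0 ?exprn_gt0 // (lt_le_trans ltr01).
  have L0 : 0 < e / (B * ell ^+ 6) / 2 by rewrite !divr_gt0.
  have [|S [S0 Sd Sc]] := sets _ L0; first by rewrite lE mulr0 ltW.
  have cond0 i : conductance w (S i) = 0.
    apply/eqP; rewrite -sqrf_eq0 eq_le sqr_ge0 andbT; apply: gap.
    apply: le_lt_trans (Sc i) _.
    rewrite (_ : B * ell ^+ 6 * (e / (B * ell ^+ 6) / 2) = e / 2); last first.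
      by field; rewrite !gt_eqF ?exprn_gt0 //; lra.
    by lra.
  split.
    exists S; split=> //; rewrite lE sqrtr0 mulr0.
    by apply/bigmax_leP; split=> // i _; rewrite cond0.
  exists (fun i => indic R (S i)); split=> [i|i v|i j ij|i].
  - by have [v vS] := set0Pn _ (S0 i); exists v; rewrite /indic vS oner_neq0.
  - by rewrite /indic ler0n.
  - rewrite -setI_eq0; apply/eqP/setP => v; rewrite !inE /indic !pnatr_eq0.
    have := Sd _ _ ij; rewrite -setI_eq0 => /eqP/setP/(_ v); rewrite !inE.
    by case: (v \in S i); case: (v \in S j).
  - rewrite rayleighE // energy_indic // mass_indic //.
    have cut0 : cut w (S i) = 0.
      have := cond0 i; rewrite /conductance -/(cut w (S i)) => /eqP.
      rewrite mulf_eq0 => /orP[/eqP //|]; rewrite invr_eq0 => /eqP v0.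
      by have := vol_gt0 d_gt0 (S0 i); rewrite /vol v0 ltxx.
    by rewrite cut0 mulr0 !mul0r lE mulr0.
have lpos : 0 < l by rewrite lt_neqAle eq_sym ln0.
have L0 : 0 < 2 * l by rewrite mulr_gt0.
split.
  have [S [S0 Sd Sc]] := sets _ L0 (lexx _).
  exists S; split=> //.
  have rhs0 : 0 <= 2 * B * ell ^+ 5 * Num.sqrt l.
    by rewrite mulr_ge0 ?sqrtr_ge0 // mulr_ge0 // mulr_ge0.
  apply/bigmax_leP; split=> // i _; apply: le_trans (ler_norm _) _.
  rewrite -ler_sqr ?nnegrE // real_normK ?num_real //; apply: (le_trans (Sc i)).
  (* The slack between the exponents 6 and 10, together with [B <= B ^+ 2], absorbs the factor 2 of
     [L = 2 * l]. *)
  have -> : (2 * B * ell ^+ 5 * Num.sqrt l) ^+ 2 =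
    4 * (B ^+ 2 * ell ^+ 10) * Num.sqrt l ^+ 2 by ring.
  rewrite sqr_sqrtr // (_ : B * ell ^+ 6 * (2 * l) = 2 * (B * ell ^+ 6) * l); last ring.
  apply: ler_wpM2r => //.
  have h1 : ell ^+ 6 <= ell ^+ 10 by rewrite ler_weXn2l.
  have h2 : B <= B ^+ 2 by rewrite expr2 ler_peMl.
  have h3 := ler_pM B0 (ell0 6%N) h2 h1.
  have h4 : 0 <= B ^+ 2 * ell ^+ 10 by rewrite mulr_ge0 ?sqr_ge0.
  by lra.
have [f [f0 f1 fe fd]] := packs_normalized w_ge0 (hB V w k w_sym w_ge0 d_gt0 kV _ L0 (lexx _)).
exists f; split=> [i||i j ij|i].
- have [v fv|fi0] := pickP (fun v => f i v != 0); first by exists v.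
  have := f1 i; rewrite /mass big1 => [/eqP|v _]; first by rewrite eq_sym oner_eq0.
  by have /negbFE/eqP -> := fi0 v; rewrite expr0n mulr0.
- exact: f0.
- rewrite -setI_eq0; apply/eqP/setP => v; rewrite !inE.
  by have [->|->] := fd _ _ v ij; rewrite eqxx ?andbF.
- rewrite rayleighE // f1 divr1 ler_pdivrMr //; apply: (le_trans (fe i)).
  rewrite (_ : B * ell ^+ 6 * (2 * l) = 2 * B * ell ^+ 6 * l); last ring.
  have h1 : ell ^+ 6 <= ell ^+ 10 by rewrite ler_weXn2l.
  have h2 : 0 <= 2 * B * ell ^+ 10 * l by rewrite mulr_ge0 // mulr_ge0 // mulr_ge0.
  have h3 : 2 * B * ell ^+ 6 * l <= 2 * B * ell ^+ 10 * l.
    by rewrite ler_wpM2r // ler_wpM2l // mulr_ge0.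
  by lra.
Qed.
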